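(* Let $N\ge 2$, let $\Omega\subset\mathbb R^N$ be a bounded $C^2$ domain with $0\in\partial\Omega$, and let $\mu\ge\mu_1:=-\frac{N^2}{4}$. Let $u$ be a nonnegative solution of $\mathcal L_\mu u:=-\Delta u+\frac{\mu}{|x|^2}u=0$ in $\Omega$ which vanishes on $B_{r_0}(0)\cap(\partial\Omega\setminus\{0\})$ for some $r_0>0$. Then there exists $k\ge 0$ such that $$\lim_{x\to 0}\frac{u(x)}{\rho(x)|x|^{\alpha_--1}}=k\quad\text{if }\mu>\mu_1,\qquad \lim_{x\to0}\frac{|x|^{\frac N2}u(x)}{\rho(x)\ln|x|}=-k\quad\text{if }\mu=\mu_1 .$$
   Context: $\rho(x)=\operatorname{dist}(x,\partial\Omega)$. For $\mu\ge\mu_1=-N^2/4$, $\alpha_-=\frac{2-N}{2}-\sqrt{\mu+\frac{N^2}{4}}$. A function $u$ with $\mathcal L_\mu u=0$ in $\Omega$ is called $\mathcal L_\mu$-harmonic. *)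

(* Defs.v *)
From HB Require Import structures.
From mathcomp Require Import all_boot all_order all_algebra.
From mathcomp Require Import all_classical all_reals all_analysis.
Set Implicit Arguments. Unset Strict Implicit. Unset Printing Implicit Defensive.
Import Order.TTheory GRing.Theory Num.Theory.
Import numFieldNormedType.Exports.
Local Open Scope classical_set_scope.
Local Open Scope ring_scope.

Section Defs.
Context {R : realType} {N : nat}.
Notation V := 'rV[R]_N.

(* Euclidean norm |x| on R^N (the library norm on 'rV is the sup norm). *)
Definition enorm (x : V) : R := Num.sqrt (\sum_(i < N) x ord0 i ^+ 2).

Definition evec (i : 'I_N) : V := delta_mx ord0 i.

Definition partial (i : 'I_N) (f : V -> R) : V -> R := fun x => 'D_(evec i) f x.

Definition laplacian (f : V -> R) : V -> R :=
  fun x => \sum_(i < N) partial i (partial i f) x.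

Definition C2_on (A : set V) (f : V -> R) : Prop :=
  [/\ (forall x, A x -> {for x, continuous f}),
      (forall x, A x -> forall i, derivable f x (evec i)),
      (forall x, A x -> forall i j, derivable (partial i f) x (evec j)),
      (forall x, A x -> forall i, {for x, continuous (partial i f)}) &
      (forall x, A x -> forall i j, {for x, continuous (partial j (partial i f))})].

Definition bdry (A : set V) : set V := closure A `\` interior A.

Definition dist_bdry (A : set V) (x : V) : R :=
  inf [set enorm (x - y) | y in bdry A].

Definition bounded_set (A : set V) : Prop :=
  exists M : R, forall x, A x -> enorm x <= M.

Definition bounded_domain (A : set V) : Prop :=
  [/\ open A, connected A, A !=set0 & bounded_set A].

(* C^2 boundary: near every boundary point p, after a rigid motion
   y = (x - p) Q (Q orthogonal), A is the supergraph {y_j > g(y')} of a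
   C^2 function g of the other N-1 coordinates. *)
Definition C2_boundary (A : set V) : Prop :=
  forall p, bdry A p ->
  exists (r : R) (Q : 'M[R]_N) (j : 'I_N) (g : V -> R),
    [/\ 0 < r, Q *m Q^T = 1%:M, C2_on setT g,
        (forall y (t : R), g (y + t *: evec j) = g y) &
        (forall x, enorm (x - p) < r ->
           (A x <-> g ((x - p) *m Q) < ((x - p) *m Q) ord0 j))].

Definition L_op (mu : R) (u : V -> R) : V -> R :=
  fun x => - laplacian u x + mu / (enorm x ^+ 2) * u x.

Definition L_harmonic (mu : R) (A : set V) (u : V -> R) : Prop :=
  C2_on A u /\ forall x, A x -> L_op mu u x = 0.

End Defs.

Definition mu1 {R : realType} (N : nat) : R := - (N%:R ^+ 2) / 4.

Definition alpha_minus {R : realType} (N : nat) (mu : R) : R :=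
  (2 - N%:R) / 2 - Num.sqrt (mu + N%:R ^+ 2 / 4).

(* Main.v *)
(* Near 0 write the domain as {d > 0} with d of class C^2 and |grad d(0)| = 1, and put
   p = alpha_- - 1 = - N/2 - sqrt (mu + N^2/4).  The function h = d |x|^p (multiplied by
   - ln |x| in the critical case) solves the equation up to an error of lower order, and a
   corrector Z = o(h) makes h + Z a supersolution and h - Z a subsolution.  Comparison with
   these shows that the supremum k of all c with u >= c h near 0 is finite, and that every
   small sphere centred at 0 carries a point where u <= (k + o(1)) h.  A boundary Harnack
   inequality for u - (k - eps) (h -+ Z), propagated along chains of balls of radius
   comparable to |x|, extends the last bound to the whole sphere.  Since d / rho -> 1, the
   function d may be replaced by the distance rho to the boundary.

   The boundary Harnack inequality V1(x) / d(x) <= C V2(z) / d(z) is obtained from the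
   maximum principle for ln (V1 / d)(x) - ln (V2 / d)(y) penalized by a concave function of
   ln |x - y|: at an interior maximum the second derivatives along a contracted reflection
   coupling of x and y add up to a contradiction. *)
Require Import Defs.
From mathcomp Require Import all_boot all_order all_algebra.
From mathcomp Require Import all_classical all_reals all_analysis.
From mathcomp Require Import ring lra.
Import Order.TTheory GRing.Theory Num.Theory.
Import numFieldNormedType.Exports.
Local Open Scope classical_set_scope.
Local Open Scope ring_scope.

Set Implicit Arguments. Unset Strict Implicit. Unset Printing Implicit Defensive.

(** * One-variable second order calculus *)

Section TwiceDerivable.
Context {R : realType}.
Implicit Types (f g : R -> R) (a b c : R).

(** The obstacle common to barriers and Harnack inequality is that [h] solves the equation only up
    to an error without a sign. The Harnack inequality is therefore stated for a pair [V1 <= V2]: a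
    subsolution [u - k' (h + Z)] and a nonnegative supersolution [u - k' (h - Z)], with [k']
    slightly below [k]. Their difference [2 k' Z] is [o(h)] and enters the chain as a small additive
    error. Dividing by [d] creates the drift [2 grad d / d], singular at the boundary. Coupled at
    two points it is harmless: with [X = d x], [Y = d y], [l = |x - y|] its leading part is
    [(X - Y) (1/Y - a^2/X) / l^2], and completing a square bounds it below by [- (1 - a)^2 / l^2].
    The curvature of the boundary leaves errors of order [1/d]; adding [A d] to the first logarithm
    and subtracting it from the second, with [A = 8 k], absorbs them. One argument thus serves in
    the interior and up to the boundary. A good point exists on each small sphere because otherwise
    [u > (k + eps) h] would hold on whole spheres of arbitrarily small radius, and comparison
    outwards from these would make a coefficient larger than [k] admissible. *)

Lemma is_derive1_add f g a b b' : is_derive a 1 f b -> is_derive a 1 g b' ->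
  is_derive a 1 (fun t => f t + g t) (b + b').
Proof. by move=> hf hg; exact: is_deriveD. Qed.

Lemma is_derive1_mul f g a b b' : is_derive a 1 f b -> is_derive a 1 g b' ->
  is_derive a 1 (fun t => f t * g t) (b * g a + f a * b').
Proof.
move=> hf hg; apply: (@is_derive_eq _ _ _ _ _ _ _ _ (is_deriveM hf hg)).
by rewrite /GRing.scale /= addrC [g a * b]mulrC.
Qed.

(** A relation rather than a derivative operator: the values of [f'] and [f''] at [a] are carried
    along as terms, so the formula for a composite function is assembled by the rules below and
    adjusted once by [D2_eq]. *)
Definition D2 f a b c := exists f1 : R -> R,
  [/\ \forall t \near a, is_derive (t : R) (1 : R) f (f1 t), f1 a = b & is_derive a 1 f1 c].

Lemma D2_eq f a b b' c c' : D2 f a b c -> b = b' -> c = c' -> D2 f a b' c'.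
Proof. by move=> h <- <-. Qed.

Lemma D2_is_derive f a b c : D2 f a b c -> is_derive a 1 f b.
Proof. by move=> [f1 [h <- _]]; exact: nbhs_singleton h. Qed.

Lemma is_derive1_continuous f a b : is_derive a 1 f b -> {for a, continuous f}.
Proof.
by move=> h; apply: differentiable_continuous; apply/derivable1_diffP; case: h.
Qed.

Lemma D2_continuous f a b c : D2 f a b c -> {for a, continuous f}.
Proof. by move=> /D2_is_derive; exact: is_derive1_continuous. Qed.

Lemma D2_cst k a : D2 (cst k) a 0 0.
Proof.
exists (cst 0); split=> //; last exact: is_derive_cst.
by apply: filterE => t; exact: is_derive_cst. Qed.

Lemma D2_affine k l a : D2 (fun t => k + t * l) a l 0.
Proof.
exists (cst l); split=> //; last exact: is_derive_cst.
apply: filterE => t /=.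
have h := is_derive1_add (is_derive_cst k t 1)
  (is_derive1_mul (is_derive_id t 1) (is_derive_cst l t 1)).
by apply: (is_derive_eq h) => /=; ring.
Qed.

Lemma D2_add f g a b c b' c' : D2 f a b c -> D2 g a b' c' ->
  D2 (fun t => f t + g t) a (b + b') (c + c').
Proof.
move=> [f1 [hf <- hf1]] [g1 [hg <- hg1]]; exists (fun t => f1 t + g1 t); split=> //; last exact: is_derive1_add.
near=> t.
have h1 : is_derive t 1 f (f1 t) by near: t.
have h2 : is_derive t 1 g (g1 t) by near: t.
exact: is_derive1_add.
Unshelve. all: by end_near. Qed.

Lemma D2_mul f g a b c b' c' : D2 f a b c -> D2 g a b' c' ->
  D2 (fun t => f t * g t) a (b * g a + f a * b')
     (c * g a + 2 * b * b' + f a * c').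
Proof.
move=> [f1 [hf <- hf1]] [g1 [hg <- hg1]].
have hfa := nbhs_singleton hf; have hga := nbhs_singleton hg.
exists (fun t => f1 t * g t + f t * g1 t); split=> //; last first.
  apply: (is_derive_eq (is_derive1_add (is_derive1_mul hf1 hga)
    (is_derive1_mul hfa hg1))).
  by ring.
near=> t.
have h1 : is_derive t 1 f (f1 t) by near: t.
have h2 : is_derive t 1 g (g1 t) by near: t.
exact: is_derive1_mul.
Unshelve. all: by end_near. Qed.

Lemma D2_comp f g a b c b' c' : D2 g a b c -> D2 f (g a) b' c' ->
  D2 (fun t => f (g t)) a (b' * b) (c' * b ^+ 2 + b' * c).
Proof.
move=> hgD [f1 [hf <- hf1]].
have cg := D2_continuous hgD.
move: hgD => [g1 [hg <- hg1]].
have hga := nbhs_singleton hg.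
exists (fun t => f1 (g t) * g1 t); split=> //; last first.
  have h := @is_derive1_comp _ f1 g a _ _ hf1 hga.
  by apply: (is_derive_eq (is_derive1_mul h hg1)) => /=; ring.
have hfg : \forall t \near a, is_derive (g t) 1 f (f1 (g t)) := cg _ hf.
near=> t.
have h1 : is_derive (g t) 1 f (f1 (g t)) by near: t.
have h2 : is_derive t 1 g (g1 t) by near: t.
exact: is_derive1_comp.
Unshelve. all: by end_near. Qed.

Lemma D2_local_max f a b c : D2 f a b c -> (\forall t \near a, f t <= f a) ->
  b = 0 /\ c <= 0.
Proof.
move=> [f1 [hf <- hc]] hmax.
have /nbhs_ballP[e /= e0 he] : \forall t \near a, is_derive (t : R) (1 : R) f (f1 t) /\ f t <= f a.
  exact: filterI.
have hD t : a - e < t < a + e -> is_derive t 1 f (f1 t) /\ f t <= f a.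
  move=> /andP[t1 t2]; apply: he; rewrite /ball /= ltr_distlC; apply/andP; split; lra.
have f1a : f1 a = 0.
  have : is_derive a 1 f 0.
    apply: (@derive1_at_max _ f (a - e) (a + e)); first lra.
    - by move=> t; rewrite in_itv /= => /hD[[]].
    - by rewrite in_itv /=; apply/andP; split; lra.
    - by move=> t; rewrite in_itv /= => /hD[].
  move=> /@derive_val <-.
  have [|h _] := hD a; first by apply/andP; split; lra.
  by rewrite derive_val.
split=> //; rewrite leNgt; apply/negP => c0.
have hcv : (fun h => h^-1 *: (f1 (h + a) - f1 a)) @ 0^' --> c.
  have [dh <-] := hc; rewrite /derivable /derive in dh *.
  have -> : (fun h => h^-1 *: (f1 (h + a) - f1 a)) =
    (fun h => h^-1 *: ((f1 \o shift a) (h *: 1) - f1 a)).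
    by apply/funext => h /=; rewrite /GRing.scale /= mulr1.
  exact: dh.
have : \forall h \near 0^', 0 < h^-1 *: (f1 (h + a) - f1 a).
  by apply: (cvgr_gt c hcv).
rewrite f1a /dnbhs /within /= => /nbhs_ballP[e' /= e'0 he'].
(* If [c > 0], then [f1 a = 0] forces [f1 > 0] just to the right of [a], and the mean value theorem
   makes [f] exceed [f a] there. *)
have hpos t : a < t < a + e' -> 0 < f1 t.
  move=> /andP[t1 t2].
  have := he' (t - a); rewrite /ball /= sub0r normrN => /(_ _ _).
  rewrite gtr0_norm; last lra.
  move=> /(_ ltac:(lra)) /(_ ltac:(by rewrite subr_eq0 gt_eqF)).
  rewrite subrK subr0 /GRing.scale /= pmulr_rgt0 // invr_gt0; lra.
set m := Num.min e e' / 2.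
have m0 : 0 < m by rewrite divr_gt0 // lt_min e0.
have me : m < e by rewrite /m ltr_pdivrMr // (@le_lt_trans _ _ e) ?ge_min ?lexx //; lra.
have me' : m < e'.
  by rewrite /m ltr_pdivrMr // (@le_lt_trans _ _ e') ?ge_min ?lexx ?orbT //; lra.
have [] := @MVT _ f f1 a (a + m); first lra.
- move=> x; rewrite in_itv /= => /andP[x1 x2].
  by have [] := hD x; first by apply/andP; split; lra.
- apply: derivable_within_continuous => x; rewrite in_itv /= => /andP[x1 x2].
  by have [|[]] := hD x; first by apply/andP; split; lra.
move=> x; rewrite in_itv /= => /andP[x1 x2] hx.
have [|_ hle] := hD (a + m); first by apply/andP; split; lra.
have : 0 < f1 x by apply: hpos; apply/andP; split; lra.
nra.
Qed.

Lemma D2_mean_value f f1 f2 :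
  (forall t, 0 <= t <= 1 -> D2 f t (f1 t) (f2 t)) ->
  exists2 t, 0 <= t <= 1 & f 1 - f 0 = f1 t.
Proof.
move=> h; have [] := @MVT _ f f1 0 1; first lra.
- move=> x; rewrite in_itv /= => /andP[x1 x2].
  by apply: (@D2_is_derive _ _ _ (f2 x)); apply: h; apply/andP; split; lra.
- apply: derivable_within_continuous => x; rewrite in_itv /= => hx.
  by have /D2_is_derive[] := h _ hx.
move=> t; rewrite in_itv /= => /andP[t1 t2] ->; exists t; last lra.
by apply/andP; split; lra.
Qed.

End TwiceDerivable.

(** * Euclidean norm *)

Section Euclidean.
Context {R : realType} {N : nat}.
Notation V := 'rV[R]_N.
Implicit Types (x y u v w : V) (a b : R).

Definition dot u v : R := \sum_i u ord0 i * v ord0 i.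

Lemma dotC u v : dot u v = dot v u.
Proof. by apply: eq_bigr => i _; rewrite mulrC. Qed.

Lemma dotDl u v w : dot (u + v) w = dot u w + dot v w.
Proof. by rewrite -big_split /=; apply: eq_bigr => i _; rewrite mxE mulrDl. Qed.

Lemma dotDr u v w : dot w (u + v) = dot w u + dot w v.
Proof. by rewrite dotC dotDl ![dot _ w]dotC. Qed.

Lemma dotZl a u v : dot (a *: u) v = a * dot u v.
Proof. by rewrite big_distrr /=; apply: eq_bigr => i _; rewrite mxE mulrA. Qed.

Lemma dotZr a u v : dot u (a *: v) = a * dot u v.
Proof. by rewrite dotC dotZl dotC. Qed.

Lemma dotNl u v : dot (- u) v = - dot u v.
Proof. by rewrite -scaleN1r dotZl mulN1r. Qed.

Lemma dotNr u v : dot u (- v) = - dot u v.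
Proof. by rewrite dotC dotNl dotC. Qed.

Lemma dot0l u : dot 0 u = 0.
Proof. by rewrite -(scale0r 0) dotZl mul0r. Qed.

Lemma dot0r u : dot u 0 = 0.
Proof. by rewrite dotC dot0l. Qed.

Definition dotE := (dotDl, dotDr, dotZl, dotZr, dotNl, dotNr, dot0l, dot0r).

Lemma dot_ge0 u : 0 <= dot u u.
Proof. by apply: sumr_ge0 => i _; rewrite -expr2 sqr_ge0. Qed.

Lemma enormE u : enorm u = Num.sqrt (dot u u).
Proof. by congr Num.sqrt; apply: eq_bigr => i _; rewrite expr2. Qed.

Lemma enorm_sqr u : enorm u ^+ 2 = dot u u.
Proof. by rewrite enormE sqr_sqrtr // dot_ge0. Qed.

Lemma enorm_ge0 u : 0 <= enorm u.
Proof. exact: sqrtr_ge0. Qed.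
Hint Resolve enorm_ge0 : core.

Lemma enorm0 : enorm (0 : V) = 0.
Proof. by rewrite enormE dot0l sqrtr0. Qed.

Lemma coord_le_enorm u i : `|u ord0 i| <= enorm u.
Proof.
rewrite enormE -sqrtr_sqr; apply: ler_wsqrtr.
rewrite /dot (bigD1 i) //= -expr2 lerDl.
by apply: sumr_ge0 => j _; rewrite -expr2 sqr_ge0.
Qed.

Lemma norm_le_enorm u : `|u| <= enorm u.
Proof.
rewrite [leLHS]/Num.norm /= mx_normrE; apply: bigmax_le => // -[i j] _ /=.
by rewrite ord1 coord_le_enorm.
Qed.

Lemma enorm_eq0 u : (enorm u == 0) = (u == 0).
Proof.
apply/idP/eqP => [/eqP h|->]; last by rewrite enorm0.
by apply/eqP; rewrite -normr_le0 -h norm_le_enorm.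
Qed.

Lemma enorm_gt0 u : (0 < enorm u) = (u != 0).
Proof. by rewrite lt_def enorm_eq0 enorm_ge0 andbT. Qed.

Lemma cauchy_schwarz u v : `|dot u v| <= enorm u * enorm v.
Proof.
have [/eqP|v0] := boolP (enorm v == 0).
  by move=> /eqP; rewrite enorm_eq0 => /eqP ->; rewrite dot0r enorm0 mulr0 normr0.
have vp : 0 < dot v v.
  by rewrite -enorm_sqr; apply: exprn_gt0; rewrite lt_def v0 enorm_ge0.
rewrite -(@ler_sqr _ `|_|) ?nnegrE ?mulr_ge0 // exprMn !enorm_sqr.
rewrite real_normK ?num_real //.
have := dot_ge0 (dot v v *: u - dot u v *: v).
rewrite !dotE [dot v u]dotC => h.
suff : 0 <= dot v v * (dot u u * dot v v - dot u v ^+ 2).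
  by rewrite pmulr_rge0 // subr_ge0.
by nra.
Qed.

Lemma dot_le u v : dot u v <= enorm u * enorm v.
Proof. exact: le_trans (ler_norm _) (cauchy_schwarz u v). Qed.

Lemma enormD u v : enorm (u + v) <= enorm u + enorm v.
Proof.
rewrite -ler_sqr ?nnegrE ?addr_ge0 // enorm_sqr !dotE [dot v u]dotC.
have := dot_le u v; rewrite -!enorm_sqr; nra.
Qed.

Lemma enormZ a u : enorm (a *: u) = `|a| * enorm u.
Proof. by rewrite !enormE dotZl dotZr mulrA -expr2 sqrtrM ?sqr_ge0 // sqrtr_sqr. Qed.

Lemma enormN u : enorm (- u) = enorm u.
Proof. by rewrite -scaleN1r enormZ normrN normr1 mul1r. Qed.

Lemma enormB u v : enorm (u - v) <= enorm u + enorm v.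
Proof. by rewrite (le_trans (enormD _ _)) // enormN. Qed.

Lemma enormC u v : enorm (u - v) = enorm (v - u).
Proof. by rewrite -opprB enormN. Qed.

Lemma enorm_triangle u v w : enorm (u - w) <= enorm (u - v) + enorm (v - w).
Proof. by rewrite (_ : u - w = (u - v) + (v - w)) ?enormD // addrA subrK. Qed.

Lemma enorm_le_sub u v : enorm u <= enorm v + enorm (u - v).
Proof. by have := enormD v (u - v); rewrite addrC subrK. Qed.

Lemma enorm_le_norm u : enorm u <= N%:R * `|u|.
Proof.
have -> : enorm u = enorm (\sum_i u ord0 i *: evec i).
  congr enorm; rewrite {1}[u]row_sum_delta.
  by apply: eq_bigr.
have : enorm (\sum_i u ord0 i *: evec i) <= \sum_(i < N) `|u ord0 i| * enorm (evec i : V).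
  elim/big_ind2 : _ => [|x1 x2 y1 y2 h1 h2|i _].
  - by rewrite enorm0.
  - exact: le_trans (enormD _ _) (lerD h1 h2).
  - by rewrite enormZ.
move=> /le_trans; apply.
rewrite -[N in N%:R]card_ord -sumr_const mulr_suml; apply: ler_sum => i _.
have -> : enorm (evec i : V) = 1.
  rewrite enormE /dot (bigD1 i) //= big1 => [|j ji]; first by rewrite !mxE !eqxx mulr1 addr0 sqrtr1.
  by rewrite !mxE (negbTE ji) andbF mulr0.
rewrite mulr1 mul1r /Num.norm /= mx_normrE.
by apply/bigmax_geP; right; exists (ord0, i).
Qed.

Lemma nbhs_enormP x (A : set V) :
  nbhs x A <-> exists2 e, 0 < e & forall y, enorm (y - x) < e -> A y.
Proof.
split=> [/nbhs_ballP[e /= e0 h]|[e e0 h]].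
  exists e => // y yx; apply: h; rewrite -ball_normE /=.
  by rewrite (le_lt_trans (norm_le_enorm _)) // enormC.
(* The sup norm controls [enorm] up to the factor [N]; [N.+1] keeps the divisor nonzero in dimension
   0. *)
apply/nbhs_ballP; exists (e / N.+1%:R) => /=; first by rewrite divr_gt0.
move=> y; rewrite -ball_normE /= => yx; apply: h; rewrite enormC.
apply: le_lt_trans (enorm_le_norm _) _.
apply: (@le_lt_trans _ _ (N.+1%:R * `|x - y|)).
  by apply: ler_wpM2r => //; rewrite ler_nat.
by rewrite mulrC -ltr_pdivlMr.
Qed.

Lemma enorm_continuous : continuous (enorm : V -> R).
Proof.
move=> x; apply/(@cvgrPdist_lt _ _ _ (nbhs x)) => e e0.
apply/nbhs_enormP; exists e => // y yx.
apply: le_lt_trans yx; rewrite ler_norml; apply/andP; split.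
  by have := enorm_le_sub y x; lra.
by have := enorm_le_sub x y; rewrite enormC; lra.
Qed.

Lemma closed_ebounded_compact (A : set V) M :
  closed A -> (forall x, A x -> enorm x <= M) -> compact A.
Proof.
move=> cA bA; apply: bounded_closed_compact => //.
exists M; split; first exact: num_real.
move=> M' MM' x /bA xM; apply: le_trans (norm_le_enorm _) _.
exact: le_trans xM (ltW MM').
Qed.

Lemma dot_evec i u : dot (evec i) u = u ord0 i.
Proof.
rewrite /dot (bigD1 i) //= big1 => [|j ji]; first by rewrite !mxE !eqxx mul1r addr0.
by rewrite !mxE (negbTE ji) andbF mul0r.
Qed.

Lemma sum_dot_evec u v : \sum_i dot (evec i) u * dot (evec i) v = dot u v.
Proof. by apply: eq_bigr => i _; rewrite !dot_evec. Qed.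

Lemma dotmx u v : dot u v = (u *m v^T) ord0 ord0.
Proof. by rewrite mxE; apply: eq_bigr => i _; rewrite !mxE. Qed.

Lemma dot_mulmx u (H : 'M[R]_N) v : dot (u *m H) v = dot u (v *m H^T).
Proof. by rewrite !dotmx trmx_mul trmxK mulmxA. Qed.

Lemma dot_outer u g h v : dot (u *m (g^T *m h)) v = dot u g * dot h v.
Proof.
rewrite mulmxA; have -> : u *m g^T = (dot u g)%:M.
  by apply/matrixP => i j; rewrite !ord1 dotmx !mxE mulr1n.
by rewrite mul_scalar_mx dotZl.
Qed.

Lemma sum_quad (W H : 'M[R]_N) :
  \sum_i dot (evec i *m W *m H) (evec i *m W) = \tr (W *m H *m W^T).
Proof.
apply: eq_bigr => i _.
by rewrite dotC dot_mulmx dot_evec -!mulmxA -rowE mxE mulmxA.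
Qed.

Lemma sum_quad_evec (H : 'M[R]_N) : \sum_i dot (evec i *m H) (evec i) = \tr H.
Proof.
have := sum_quad 1%:M H; rewrite mul1mx trmx1 mulmx1 => <-.
by apply: eq_bigr => i _; rewrite mulmx1.
Qed.

Lemma tr_outer g h : \tr (g^T *m h) = dot g h.
Proof. by rewrite mxtrace_mulC dotC dotmx; rewrite /mxtrace big_ord1. Qed.

End Euclidean.
#[export] Hint Extern 0 (is_true (0 <= enorm _)) => solve [apply: enorm_ge0] : core.

(** * Directional second order jets *)

Section Jets.
Context {R : realType} {N : nat}.
Notation V := 'rV[R]_N.
Implicit Types (f : V -> R) (x y u v w g : V) (H : 'M[R]_N) (a b s t K : R).

(* Second order directional jets: [g] plays the gradient of [f] at [x] and
   [H] the Hessian matrix, but only their values along lines are recorded. *)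
Definition J2 f x g H :=
  forall v, D2 (fun e => f (x + e *: v)) 0 (dot v g) (dot (v *m H) v).

Lemma J2_eq f x g g' H H' : J2 f x g H -> g = g' -> H = H' -> J2 f x g' H'.
Proof. by move=> h <- <-. Qed.

Lemma line_continuous x v : continuous (fun e : R => x + e *: v).
Proof.
move=> e; apply: (@cvgD _ _ _ _ _ (fun=> x) (fun e : R => e *: v)).
  exact: cvg_cst.
exact: scalel_continuous.
Qed.

Lemma near_line x v (P : set V) : (\forall y \near x, P y) ->
  \forall e \near (0 : R), P (x + e *: v).
Proof.
move=> h; have c := @line_continuous x v 0; apply: c.
by rewrite /= scale0r addr0.
Qed.

Lemma J2_cst a x : J2 (cst a) x 0 0.
Proof. by move=> v; rewrite mulmx0 dot0l dot0r; exact: D2_cst. Qed.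

Lemma J2_add f f' x g g' H H' : J2 f x g H -> J2 f' x g' H' ->
  J2 (fun y => f y + f' y) x (g + g') (H + H').
Proof.
move=> h h' v; rewrite mulmxDr dotDr dotDl.
exact: (D2_add (h v) (h' v)).
Qed.

Lemma J2_mul f f' x g g' H H' : J2 f x g H -> J2 f' x g' H' ->
  J2 (fun y => f y * f' y) x (f' x *: g + f x *: g')
     (f' x *: H + f x *: H' + g^T *m g' + g'^T *m g).
Proof.
move=> h h' v; have := D2_mul (h v) (h' v); rewrite /= scale0r addr0.
move=> /D2_eq; apply; rewrite ?mulmxDr -?scalemxAr !dotE ?dot_outer //.
  by ring.
by rewrite [dot g v]dotC [dot g' v]dotC; ring.
Qed.

Lemma J2_scale a f x g H : J2 f x g H -> J2 (fun y => a * f y) x (a *: g) (a *: H).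
Proof.
move=> h; apply: (J2_eq (J2_mul (J2_cst a x) h)).
  by rewrite scaler0 add0r.
by rewrite scaler0 add0r trmx0 mul0mx mulmx0 !addr0.
Qed.

Lemma J2_comp (phi : R -> R) f x g H b c : J2 f x g H -> D2 phi (f x) b c ->
  J2 (fun y => phi (f y)) x (b *: g) (b *: H + c *: (g^T *m g)).
Proof.
move=> h hphi v; have hv := h v.
have := @D2_comp _ phi (fun e => f (x + e *: v)) 0 _ _ b c hv.
rewrite scale0r addr0 => /(_ hphi) /D2_eq; apply.
  by rewrite dotZr.
by rewrite mulmxDr -!scalemxAr !dotE dot_outer [dot g v]dotC; ring.
Qed.

Lemma J2_affine f z r x g H : J2 f (z + r *: x) g H ->
  J2 (fun y => f (z + r *: y)) x (r *: g) (r ^+ 2 *: H).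
Proof.
move=> h v; have := h (r *: v).
have -> : (fun e => f (z + r *: x + e *: (r *: v))) =
          (fun e => f (z + r *: (x + e *: v))).
  by apply/funext => e; rewrite scalerDr addrA !scalerA [e * r]mulrC.
move=> /D2_eq; apply; first by rewrite dotZl dotZr.
by rewrite -scalemxAl -scalemxAr !dotE; ring.
Qed.

Lemma J2_linear f (Q : 'M[R]_N) x g H : J2 f (x *m Q) g H ->
  J2 (fun y => f (y *m Q)) x (g *m Q^T) (Q *m H *m Q^T).
Proof.
move=> h v; have := h (v *m Q).
have -> : (fun e => f (x *m Q + e *: (v *m Q))) =
          (fun e => f ((x + e *: v) *m Q)).
  by apply/funext => e; rewrite mulmxDl scalemxAl.
move=> /D2_eq; apply; first by rewrite dot_mulmx.
by rewrite !mulmxA [RHS]dot_mulmx trmxK.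
Qed.

Lemma J2_dot w x : J2 (fun y => dot y w) x w 0.
Proof.
move=> v; rewrite mulmx0 dot0l.
have -> : (fun e => dot (x + e *: v) w) = (fun e => dot x w + e * dot v w).
  by apply/funext => e; rewrite !dotE.
exact: D2_affine.
Qed.

Lemma J2_sqnorm x : J2 (fun y => dot y y) x (2 *: x) (2%:M).
Proof.
move=> v.
have -> : (fun e => dot (x + e *: v) (x + e *: v)) =
    (fun e => (dot x x + e * (2 * dot v x)) + (0 + e * dot v v) * (0 + e * 1)).
  by apply/funext => e; rewrite !dotE [dot x v]dotC; ring.
apply: (D2_eq (D2_add (D2_affine _ _ _) (D2_mul (D2_affine _ _ _) (D2_affine _ _ _)))).
  by rewrite dotZr; ring.
by rewrite mul_mx_scalar dotZl; ring.
Qed.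

Lemma D2_shift (phi : R -> R) t b c : D2 (fun e => phi (t + e)) 0 b c -> D2 phi t b c.
Proof.
move=> h.
have h2 := @D2_comp _ (fun e => phi (t + e)) (fun s => - t + s * 1) t 1 0 b c
  (D2_affine _ _ _).
have e1 : - t + t * 1 = 0 by ring.
rewrite e1 in h2; have := h2 h.
have -> : (fun s => phi (t + (- t + s * 1))) = phi.
  by apply/funext => s; congr phi; ring.
by move=> /D2_eq; apply; ring.
Qed.

Lemma J2_line f x v t g H : J2 f (x + t *: v) g H ->
  D2 (fun e => f (x + e *: v)) t (dot v g) (dot (v *m H) v).
Proof.
move=> h; apply: D2_shift; have := h v; congr (D2 _ _ _ _).
by apply/funext => e; rewrite scalerDl addrA.
Qed.

Lemma J2_mean_value f (G : V -> V) (Hs : V -> 'M[R]_N) x y :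
  (forall t, 0 <= t <= 1 -> let z := y + t *: (x - y) in J2 f z (G z) (Hs z)) ->
  exists2 t, 0 <= t <= 1 & f x - f y = dot (x - y) (G (y + t *: (x - y))).
Proof.
move=> h.
have [t t01] := D2_mean_value (fun t (t01 : 0 <= t <= 1) => J2_line (h t t01)).
by rewrite scale1r scale0r addr0 [y + _]addrC subrK => ->; exists t.
Qed.

(** The mean value theorem is applied to [f] on the segment and then to its directional derivative.
    Hence [K] bounds the quadratic form itself, without the factor 1/2 of the sharp remainder. *)
Lemma J2_taylor f (G : V -> V) (Hs : V -> 'M[R]_N) (U : set V) x y K :
  open U -> (forall z, U z -> J2 f z (G z) (Hs z)) ->
  (forall t, 0 <= t <= 1 -> let z := y + t *: (x - y) in
     U z /\ `|dot ((x - y) *m Hs z) (x - y)| <= K) ->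
  `|f x - f y - dot (x - y) (G y)| <= K.
Proof.
move=> oU hU h.
have [t t01 ->] := J2_mean_value (fun t t01 => hU _ (h t t01).1).
set v := x - y.
pose g1 s := dot v (G (y + s *: v)).
pose g2 s := dot (v *m Hs (y + s *: v)) v.
have dg1 s : 0 <= s <= 1 -> is_derive s 1 g1 (g2 s).
  move=> s01; have [Us _] := h s s01.
  have [e1 [p1 p2 p3]] := J2_line (hU _ Us).
  have Ur : \forall r \near s, U (y + r *: v).
    by apply: (@line_continuous y v s); exact: open_nbhs_nbhs.
  (* The derivative inside [D2] is only some witness; uniqueness of derivatives identifies it with
     [g1] near [s]. *)
  have e1g1 : \near s, e1 s = g1 s.
    near=> r.
    have Ur' : U (y + r *: v) by near: r.
    have [_ q1] := D2_is_derive (J2_line (hU _ Ur')).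
    have h1 : is_derive (r : R) (1 : R) (fun e => f (y + e *: v)) (e1 r) by near: r.
    by have [_ q2] := h1; rewrite /g1 -q1 -q2.
  exact: near_eq_is_derive e1g1 p3.
have [] := @MVT_segment _ g1 g2 0 t; first by case/andP: t01.
- move=> s; rewrite in_itv /= => /andP[s0 s1]; apply: dg1.
  by move: t01 => /andP[t0 t1]; apply/andP; split; lra.
- apply: derivable_within_continuous => s; rewrite in_itv /= => /andP[s0 s1].
  have s01 : 0 <= s <= 1 by move: t01 => /andP[t0 t1]; apply/andP; split; lra.
  by have [] := dg1 s s01.
move=> s'; rewrite in_itv /= => /andP[s0 st].
rewrite /g1 scale0r addr0 => ->.
have s01 : 0 <= s' <= 1 by move: t01 => /andP[t0 t1]; apply/andP; split; lra.
rewrite normrM subr0 (le_trans _ (h s' s01).2) // -[leRHS]mulr1.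
apply: ler_wpM2l => //; rewrite ger0_norm; by move: t01 => /andP[].
Unshelve. all: by end_near. Qed.

Lemma J2_local_max f x g H : J2 f x g H -> (\forall y \near x, f y <= f x) ->
  \tr H <= 0.
Proof.
move=> h hmax; rewrite -sum_quad_evec; apply: sumr_le0 => i _.
have := near_line (evec i) hmax => hm.
have [] := D2_local_max (h (evec i)); last by [].
by apply: filterS hm => e; rewrite scale0r addr0.
Qed.

End Jets.

(** * Jets of functions of class C^2 *)

Section SmoothJets.
Context {R : realType} {N : nat}.
Notation V := 'rV[R]_N.
Implicit Types (f : V -> R) (x y u v w : V) (h s t : R) (i : 'I_N).

Lemma is_derive0P (phi : R -> R) (l : R) :
  is_derive (0 : R) (1 : R) phi l <->
  (fun h : R => h^-1 * (phi h - phi 0)) @ 0^' --> l.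
Proof.
have e : (fun h : R => h^-1 *: ((phi \o shift 0) (h *: (1 : R)) - phi 0)) =
  (fun h : R => h^-1 * (phi h - phi 0)).
  by apply/funext => h; rewrite /= addr0 /GRing.scale /= mulr1.
split=> [[]|c].
  by rewrite /derivable /derive e => d <-.
apply: DeriveDef; rewrite /derivable /derive e; first by apply/cvg_ex; exists l.
exact/cvg_lim.
Qed.

Lemma derivable_line f x v : derivable f x v ->
  is_derive (0 : R) (1 : R) (fun h => f (x + h *: v)) ('D_v f x).
Proof.
move=> d.
have -> : (fun h : R => f (x + h *: v)) = (fun h : R => f (h *: v + x)).
  by apply/funext => h; rewrite addrC.
apply: DeriveDef; first by move/derivable1P: d.
rewrite /derive; set g1 := fun h => h^-1 *: _; set g2 := fun h => h^-1 *: _.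
suff -> : g1 = g2 by [].
by apply/funext => h; rewrite /g1 /g2 /= addr0 scale0r add0r [_%:A]mulr1.
Qed.

Definition grad f x : V := \row_i partial i f x.

Definition hess f x : 'M[R]_N := \matrix_(i, j) partial j (partial i f) x.

Lemma tr_hess f x : \tr (hess f x) = laplacian f x.
Proof. by apply: eq_bigr => i _; rewrite mxE. Qed.

Lemma derivable_line_at f i y (s t : R) : derivable f (y + t *: (s *: evec i)) (evec i) ->
  is_derive (t : R) (1 : R) (fun t => f (y + t *: (s *: evec i)))
    (s * partial i f (y + t *: (s *: evec i))).
Proof.
move=> /derivable_line d.
have da : is_derive (t : R) (1 : R) (fun r : R => (- t * s) + r * s) s.
  exact: D2_is_derive (D2_affine _ _ _).
have e0 : - t * s + t * s = 0 by ring.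
rewrite -[(0 : R)]e0 in d.
have := @is_derive1_comp _ (fun h => f (y + t *: (s *: evec i) + h *: evec i)) _ t _ _ d da.
rewrite [_ * s]mulrC.
set F := _ \o _; suff -> : F = (fun t => f (y + t *: (s *: evec i))) by [].
apply/funext => r; rewrite /F /=; congr f.
rewrite !scalerA -addrA -scalerDl; congr (_ + _ *: _).
ring.
Qed.

(** The direction is built up one coordinate at a time: the increment in the new coordinate is given
    by the mean value theorem, and continuity of that partial derivative moves the intermediate
    point back to [x]. *)
Lemma C1_line (A : set V) f : open A ->
  (forall x, A x -> forall i, derivable f x (evec i)) ->
  (forall x, A x -> forall i, {for x, continuous (partial i f)}) ->
  forall x v, A x ->
  is_derive (0 : R) (1 : R) (fun h => f (x + h *: v)) (dot v (grad f x)).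
Proof.
move=> oA dA cA x v Ax.
have -> : v = \sum_i v ord0 i *: evec i by rewrite {1}[v]row_sum_delta.
elim/big_rec : _ => [|i w _ hw].
  rewrite dot0l (_ : (fun _ => _) = cst (f x)); first exact: is_derive_cst.
  by apply/funext => h; rewrite scaler0 addr0.
set s := v ord0 i.
apply/is_derive0P; rewrite scale0r addr0.
have {hw} := (is_derive0P _ _).1 hw; rewrite scale0r addr0 => hw.
rewrite dotDl dotZl dot_evec mxE.
have -> : (fun h : R => h^-1 * (f (x + h *: (s *: evec i + w)) - f x)) =
  (fun h : R => h^-1 * (f (x + h *: w + h *: (s *: evec i)) - f (x + h *: w)) +
    h^-1 * (f (x + h *: w) - f x)).
  apply/funext => h; rewrite -mulrDr; congr (_ * _).
  by rewrite scalerDr [h *: (s *: _) + _]addrC addrA addrA subrK.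
apply: cvgD hw.
apply/(@cvgrPdist_le _ _ _ _ _) => e e0.
have /nbhs_enormP[d d0 hd] : \forall y \near x, A y /\
    `|partial i f x - partial i f y| <= e / (1 + `|s|).
  apply: filterI; first exact: open_nbhs_nbhs.
  have /(@cvgrPdist_le _ _ _ (nbhs x)) := cA x Ax i; apply.
  by rewrite divr_gt0 // ltr_pwDl.
(* For [|h| < d / M] every point reached by the two increments lies in the Euclidean ball of radius
   [d] around [x]. *)
set M := enorm w + enorm (s *: evec i : V) + 1.
have M0 : 0 < M by rewrite ltr_wpDl // addr_ge0 // enorm_ge0.
have hM (h t : R) : `|h| < d / M -> 0 <= t <= 1 ->
    enorm (x + h *: w + t *: ((h * s) *: evec i) - x) < d.
  move=> hh /andP[t0 t1]; rewrite addrAC [x + _]addrC addrK.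
  rewrite ltr_pdivlMr // in hh; apply: le_lt_trans hh.
  apply: le_trans (enormD _ _) _; rewrite -[(h * s) *: _]scalerA !enormZ (ger0_norm t0).
  have h0 : 0 <= `|h| := normr_ge0 h.
  have p0 : 0 <= `|s| * enorm (evec i : V) by rewrite mulr_ge0.
  rewrite /M enormZ.
  have := mulr_ge0 h0 p0; move: (`|h|) (enorm w) (`|s| * _) h0 p0 => H W P h0 p0 hp.
  have : t * (H * P) <= H * P by rewrite ler_piMl.
  nra.
near=> h.
have hn0 : h != 0 by near: h; exact: nbhs_dnbhs_neq.
have hd' : `|h| < d / M.
  by near: h; apply: dnbhs0_lt; rewrite divr_gt0.
have [||t t01 /=] := @MVT_segment _ (fun t => f (x + h *: w + t *: ((h * s) *: evec i)))
  (fun t => h * s * partial i f (x + h *: w + t *: ((h * s) *: evec i))) 0 1 ler01.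
- move=> t; rewrite in_itv /= => /andP[t0 t1].
  apply: derivable_line_at; apply: dA.
  by have [] := hd _ (hM h t hd' ltac:(apply/andP; split; lra)).
- apply: derivable_within_continuous => t; rewrite in_itv /= => t01.
  have [Ah _] := hd _ (hM h t hd' t01).
  by have [] := derivable_line_at (dA _ Ah i).
rewrite scale1r scale0r addr0 subr0 mulr1 => hmv.
rewrite [h *: (s *: _)]scalerA hmv.
rewrite in_itv /= in t01.
have [_] := hd _ (hM h t hd' t01).
rewrite -scalerA !mulrA mulVf // mul1r -mulrBr normrM => hle.
apply: (@le_trans _ _ (`|s| * (e / (1 + `|s|)))).
  by apply: ler_wpM2l => //; rewrite scalerA.
have s0 : 0 <= `|s| := normr_ge0 s.
rewrite mulrA ler_pdivrMr; nra.
Unshelve. all: by end_near. Qed.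

Lemma C2_J2 (A : set V) f x : open A -> C2_on A f -> A x ->
  J2 f x (grad f x) (hess f x).
Proof.
move=> oA [cf d1 d2 c1 c2] Ax v.
exists (fun h => dot v (grad f (x + h *: v))); split.
- have hA : \forall h \near (0 : R), A (x + h *: v).
    by apply: near_line; exact: open_nbhs_nbhs.
  near=> h.
  have Ah : A (x + h *: v) by near: h.
  have := C1_line oA d1 c1 v Ah => hh.
  have da : is_derive (h : R) (1 : R) (fun r : R => - h + r * 1) 1.
    exact: D2_is_derive (D2_affine _ _ _).
  have e0 : - h + h * 1 = 0 by ring.
  rewrite -[(0 : R)]e0 in hh.
  have := @is_derive1_comp _ (fun r => f (x + h *: v + r *: v)) _ h _ _ hh da.
  rewrite mulr1.
  set F := _ \o _; suff -> : F = (fun r => f (x + r *: v)) by [].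
  apply/funext => r; rewrite /F /=; congr f.
  rewrite -addrA -scalerDl; congr (_ + _ *: _).
  ring.
- by rewrite scale0r addr0.
have -> : dot (v *m hess f x) v = \sum_i v ord0 i * dot v (grad (partial i f) x).
  rewrite /dot; under eq_bigr do rewrite mxE mulr_suml.
  rewrite exchange_big /=; apply: eq_bigr => i _; rewrite mulr_sumr.
  by apply: eq_bigr => j _; rewrite !mxE; ring.
rewrite /dot.
have -> : (fun h => \sum_i v ord0 i * grad f (x + h *: v) ord0 i) =
   \sum_i (fun h => v ord0 i * partial i f (x + h *: v)).
  by apply/funext => h; rewrite fct_sumE; apply: eq_bigr => i _; rewrite mxE.
apply: is_derive_sum => i.
have hi := C1_line oA (fun y Ay j => d2 y Ay i j) (fun y Ay j => c2 y Ay i j) v Ax.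
apply: (is_derive_eq (is_derive1_mul (is_derive_cst _ _ _) hi)).
by rewrite mul0r add0r.
Unshelve. all: by end_near. Qed.

End SmoothJets.

(** * Doubling of variables *)

Section Doubling.
Context {R : realType} {N : nat}.
Notation V := 'rV[R]_N.
Implicit Types (x y u v w z e : V) (a b c l : R).

Lemma D2_ln a : 0 < a -> D2 (@ln R) a a^-1 (- a ^- 2).
Proof.
move=> a0; exists (fun t => t^-1); split=> //.
  near=> t; apply: is_derive1_ln; near: t.
  exact: lt_nbhsr.
have h := @is_deriveV R id a 1 1 (lt0r_neq0 a0) (is_derive_id _ _).
by apply: (is_derive_eq h); rewrite /GRing.scale /= mulr1.
Unshelve. all: by end_near. Qed.

Lemma D2_expR a : D2 (@expR R) a (expR a) (expR a).
Proof.
exists (@expR R); split=> //; last exact: is_derive_expR.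
by apply: filterE => t; exact: is_derive_expR.
Qed.

Definition lognorm x : R := 2^-1 * ln (dot x x).

Lemma lognormE x : x != 0 -> lognorm x = ln (enorm x).
Proof.
move=> x0; rewrite /lognorm -enorm_sqr lnXn ?enorm_gt0 // -[ln _ *+ 2]mulr_natl.
by rewrite mulrA mulVf ?mul1r.
Qed.

Lemma dot_gt0 x : x != 0 -> 0 < dot x x.
Proof. by move=> x0; rewrite -enorm_sqr exprn_gt0 // enorm_gt0. Qed.

Lemma J2_lognorm x : x != 0 ->
  J2 lognorm x ((dot x x)^-1 *: x)
     ((dot x x)^-1 *: (1%:M - (2 * (dot x x)^-1) *: (x^T *m x))).
Proof.
move=> x0; have p0 := dot_gt0 x0; have n0 := lt0r_neq0 p0.
have := J2_scale 2^-1 (J2_comp (J2_sqnorm x) (D2_ln p0)).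
move=> /J2_eq; apply.
  rewrite !scalerA; congr (_ *: _); field; exact: n0.
apply/matrixP => i j; rewrite !(mxE, big_ord1).
by case: (i == j); rewrite ?mulr1n ?mulr0n; field; exact: n0.
Qed.

Lemma dot_eq0P u v : (forall w, dot w u = dot w v) -> u = v.
Proof.
move=> h; apply/eqP; rewrite -subr_eq0 -enorm_eq0 -sqrf_eq0 enorm_sqr.
by rewrite dotDr dotNr h subrr.
Qed.

(** Moving [x] along [u] and [y] along [v] reduces the maximum to one variable. The first-order
    condition with [v = 0] and with [u = 0] identifies the two gradients; the second-order condition
    is kept for all pairs, so that a coupling can still be chosen. *)
Lemma doubling_max (G1 G2 f1 f2 lam : V -> R) (phi : R -> R) x y
    g1 g2 h1 h2 gl (H1 H2 K1 K2 Hl : 'M[R]_N) b c :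
  J2 G1 x g1 H1 -> J2 G2 y g2 H2 -> J2 f1 x h1 K1 -> J2 f2 y h2 K2 ->
  J2 lam (x - y) gl Hl -> D2 phi (lam (x - y) + f1 x + f2 y) b c ->
  (forall u v, \forall t \near (0 : R),
     G1 (x + t *: u) - G2 (y + t *: v) -
       phi (lam (x - y + t *: (u - v)) + f1 (x + t *: u) + f2 (y + t *: v))
     <= G1 x - G2 y - phi (lam (x - y) + f1 x + f2 y)) ->
  [/\ g1 = b *: (gl + h1), g2 = b *: (gl - h2) &
   forall u v, dot (u *m H1) u - dot (v *m H2) v <=
     c * (dot (u - v) gl + dot u h1 + dot v h2) ^+ 2 +
     b * (dot ((u - v) *m Hl) (u - v) + dot (u *m K1) u + dot (v *m K2) v)].
Proof.
move=> hG1 hG2 hf1 hf2 hl hphi hmax.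
have key u v : dot u g1 - dot v g2 - b * (dot (u - v) gl + dot u h1 + dot v h2) = 0
   /\ dot (u *m H1) u - dot (v *m H2) v - (c * (dot (u - v) gl + dot u h1 + dot v h2) ^+ 2 +
     b * (dot ((u - v) *m Hl) (u - v) + dot (u *m K1) u + dot (v *m K2) v)) <= 0.
  have hin := D2_add (D2_add (hl (u - v)) (hf1 u)) (hf2 v).
  have hphi0 : D2 phi (lam (x - y + 0 *: (u - v)) + f1 (x + 0 *: u) + f2 (y + 0 *: v)) b c.
    by rewrite !scale0r !addr0.
  have hc := D2_comp hin hphi0.
  have hF := D2_add (D2_add (hG1 u) (D2_mul (D2_cst (-1) 0) (hG2 v)))
    (D2_mul (D2_cst (-1) 0) hc).
  have := D2_local_max hF; rewrite /=.
  case=> [|e1 e2].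
    have hm := hmax u v; apply: filterS hm => t; rewrite !scale0r !addr0 !mulN1r.
    exact.
  by split; [rewrite -e1|apply: le_trans e2]; rewrite ?le_eqVlt; first ring;
    apply/orP; left; apply/eqP; ring.
split.
- apply: dot_eq0P => u; have [e _] := key u 0.
  by move: e; rewrite subr0 dotZr dotDr !dot0l !addr0 subr0 => /eqP; rewrite subr_eq0 => /eqP.
- apply: dot_eq0P => v; have [e _] := key 0 v.
  move: e; rewrite sub0r dotZr dotDr !dotNl dotNr !dot0l addr0 add0r => e.
  by apply/eqP; rewrite -subr_eq0 -oppr_eq0 -[X in _ == X]e; apply/eqP; ring.
by move=> u v; have [_] := key u v; rewrite subr_le0.
Qed.

Section Reflection.
Variable e : V.
Hypothesis e1 : dot e e = 1.
Let Pe : 'M[R]_N := e^T *m e.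
(** Householder reflection in the hyperplane orthogonal to the unit vector [e]. *)
Definition refl : 'M[R]_N := 1%:M - 2 *: (e^T *m e).

Lemma projK : Pe *m Pe = Pe.
Proof.
rewrite /Pe -mulmxA [e *m (_ *m _)]mulmxA.
have -> : e *m e^T = 1%:M by apply/matrixP => i j; rewrite !ord1 -dotmx e1 mxE.
by rewrite mul1mx.
Qed.

Lemma refl_tr : refl^T = refl.
Proof. by rewrite /refl linearB /= trmx1 linearZ /= trmx_mul trmxK. Qed.

Lemma refl_sqr : refl *m refl = 1%:M.
Proof.
rewrite /refl; move: projK; rewrite /Pe; move: (e^T *m e) => P hP.
rewrite mulmxBl mul1mx mulmxBr mulmx1 -scalemxAl -scalemxAr hP.
by apply/matrixP => i j; rewrite !mxE; ring.
Qed.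

Lemma enorm_refl v : enorm (v *m refl) = enorm v.
Proof.
by rewrite !enormE dot_mulmx refl_tr -mulmxA refl_sqr mulmx1.
Qed.

Lemma refl_e : e *m refl = - e.
Proof.
rewrite /refl mulmxBr mulmx1 -scalemxAr mulmxA.
have -> : e *m e^T = 1%:M by apply/matrixP => i j; rewrite !ord1 -dotmx e1 mxE.
rewrite mul1mx -[X in X - _]scale1r -scalerBl.
have -> : (1 - 2 : R) = -1 by ring.
by rewrite scaleN1r.
Qed.

(** [refl] has eigenvalue -1 on [e] and 1 on its complement, so [a - refl] acts there as [1 + a] and
    [a - 1]. Only the direction of [x - y] yields the large negative term [- (1 + a) ^+ 2]. *)
Lemma refl_coupling_trace a :
  \tr ((a%:M - refl) *m refl *m (a%:M - refl)^T) =
  (N%:R - 1) * (1 - a) ^+ 2 - (1 + a) ^+ 2.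
Proof.
have -> : (a%:M - refl)^T = a%:M - refl.
  by rewrite linearB /= tr_scalar_mx refl_tr.
have -> : (a%:M - refl) *m refl *m (a%:M - refl) =
   (a ^+ 2 + 1) *: refl - (2 * a) *: 1%:M.
  move: refl_sqr; move: refl => P hP.
  have -> : (a%:M - P) *m P = a *: P - 1%:M by rewrite mulmxBl mul_scalar_mx hP.
  rewrite mulmxBr mul_mx_scalar mulmxBl mul1mx -scalemxAl hP.
  by apply/matrixP => i j; rewrite !mxE; ring.
rewrite linearB /= !linearZ /= mxtrace1 /refl linearB /= linearZ /= mxtrace1 tr_outer e1.
by rewrite /GRing.scale /=; ring.
Qed.

End Reflection.

(* The coupling moves [x] along [a E_i] and [y] along the reflection of [E_i]
   in the hyperplane orthogonal to [x - y]; the contraction factor [a < 1] makes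
   the quadratic gradient terms coercive. *)
Lemma doubling_trace_inequality (G1 G2 f1 f2 : V -> R) (phi : R -> R) x y a
    g1 g2 h1 h2 (H1 H2 K1 K2 : 'M[R]_N) b c :
  x != y -> let l := enorm (x - y) in let e := l^-1 *: (x - y) in
  J2 G1 x g1 H1 -> J2 G2 y g2 H2 -> J2 f1 x h1 K1 -> J2 f2 y h2 K2 ->
  D2 phi (lognorm (x - y) + f1 x + f2 y) b c ->
  (forall u v, \forall t \near (0 : R),
     G1 (x + t *: u) - G2 (y + t *: v) -
       phi (lognorm (x - y + t *: (u - v)) + f1 (x + t *: u) + f2 (y + t *: v))
     <= G1 x - G2 y - phi (lognorm (x - y) + f1 x + f2 y)) ->
  [/\ dot e e = 1, g1 = b *: (l^-1 *: e + h1), g2 = b *: (l^-1 *: e - h2) &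
   a ^+ 2 * \tr H1 - \tr H2 <=
     c * enorm (((1 + a) / l) *: e + a *: h1 + h2 *m refl e) ^+ 2 +
     b * (l ^- 2 * ((N%:R - 1) * (1 - a) ^+ 2 - (1 + a) ^+ 2) +
          a ^+ 2 * \tr K1 + \tr K2)].
Proof.
move=> xy l e hG1 hG2 hf1 hf2 hphi hmax.
have z0 : x - y != 0 by rewrite subr_eq0.
have l0 : 0 < l by rewrite enorm_gt0.
have ln0 : l != 0 by rewrite gt_eqF.
have e1 : dot e e = 1.
  rewrite /e dotZl dotZr -enorm_sqr -/l; field; exact: ln0.
have zE : x - y = l *: e by rewrite /e scalerA mulfV // scale1r.
have hl := J2_lognorm z0.
have l2 : dot (x - y) (x - y) = l ^+ 2 by rewrite -enorm_sqr.
have [r1 r2 r3] := doubling_max hG1 hG2 hf1 hf2 hl hphi hmax.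
have glE : (dot (x - y) (x - y))^-1 *: (x - y) = l^-1 *: e.
  rewrite l2 [in LHS]zE scalerA; congr (_ *: _); field; exact: ln0.
rewrite glE in r1 r2 r3.
(* The Hessian of [ln |z|] is [|z|^-2] times the reflection in the direction of [z]. It is the same
   matrix that defines the coupling, whence the closed trace formula. *)
have HlE : (dot (x - y) (x - y))^-1 *: (1%:M - (2 / dot (x - y) (x - y)) *: ((x - y)^T *m (x - y)))
  = l ^- 2 *: refl e.
  rewrite l2 /refl; congr (_ *: (_ - _)).
  have -> : (x - y)^T *m (x - y) = l ^+ 2 *: (e^T *m e).
    by rewrite zE; apply/matrixP => i j; rewrite !(mxE, big_ord1); ring.
  rewrite scalerA; congr (_ *: _); field; exact: ln0.
rewrite HlE in r3.
split=> //.
have hs : \sum_i (dot ((a *: evec i) *m H1) (a *: evec i) -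
    dot ((evec i *m refl e) *m H2) (evec i *m refl e)) <=
  \sum_(i < N) (c * dot (evec i) (((1 + a) / l) *: e + a *: h1 + h2 *m refl e) ^+ 2 +
    b * (l ^- 2 * dot ((evec i *m (a%:M - refl e)) *m refl e) (evec i *m (a%:M - refl e))
     + a ^+ 2 * dot (evec i *m K1) (evec i) + dot (evec i *m refl e *m K2) (evec i *m refl e))).
  apply: ler_sum => i _; apply: le_trans (r3 _ _) _.
  have -> : a *: evec i - evec i *m refl e = evec i *m (a%:M - refl e).
    by rewrite [RHS]mulmxBr mul_mx_scalar.
  rewrite le_eqVlt; apply/orP; left; apply/eqP; congr (c * _ ^+ 2 + b * (_ + _ + _)).
  - rewrite dot_mulmx.
    have -> : (a%:M - refl e)^T = a%:M - refl e.
      by rewrite linearB /= tr_scalar_mx refl_tr.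
    have -> : (l^-1 *: e) *m (a%:M - refl e) = ((1 + a) / l) *: e.
      rewrite [LHS]mulmxBr mul_mx_scalar -scalemxAl refl_e // scalerA scalerN opprK.
      by rewrite -scalerDl; congr (_ *: _); field; exact: ln0.
    have -> : dot (evec i *m refl e) h2 = dot (evec i) (h2 *m refl e).
      by rewrite dot_mulmx refl_tr.
    by rewrite !dotE.
  - by rewrite -scalemxAr dotZl.
  - by rewrite -scalemxAl dotZl dotZr mulrA -expr2.
move: hs.
rewrite sumrB.
under eq_bigr do rewrite -scalemxAl dotZl dotZr mulrA -expr2.
rewrite -mulr_sumr sum_quad_evec sum_quad refl_tr.
have -> : \tr (refl e *m H2 *m refl e) = \tr H2.
  by rewrite mxtrace_mulC mulmxA refl_sqr // mul1mx.
move=> /le_trans; apply.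
rewrite big_split /= -!mulr_sumr !big_split /= -!mulr_sumr sum_quad_evec !sum_quad.
rewrite refl_tr refl_coupling_trace // enorm_sqr -sum_dot_evec.
have -> : \tr (refl e *m K2 *m refl e) = \tr K2.
  by rewrite mxtrace_mulC mulmxA refl_sqr // mul1mx.
rewrite lerD2r le_eqVlt; apply/orP; left; apply/eqP; congr (c * _).
Qed.

End Doubling.

(** * Scalar inequalities at an interior maximum *)

Section InteriorMaximum.
Context {R : realType}.

(** To leading order the singular drift is [(X - Y) (1/Y - a^2/X) / l^2], which equals [((X - a Y)^2
    - (1 - a)^2 X Y) / (X Y l^2)]. The Taylor errors [k] are covered by [A * G1] and [A * G2], and
    the cutoff costs only [2 / eta] because [r >= - 2 Y]. *)
Lemma drift_bound (a X Y S1 S2 G1 G2 A k r l eta : R) :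
  0 < X -> 0 < Y -> 0 < l -> 0 < eta ->
  l * S1 <= X - Y + k * l ^+ 2 -> X - Y - k * l ^+ 2 <= l * S2 ->
  2 * k <= A * G1 -> 2 * k <= A * G2 -> 0 <= k ->
  A * G2 - 2 * Y - 2 * k <= r ->
  - ((1 - a) ^+ 2 / l ^+ 2) - 2 / eta <=
  (S2 / l + A * G2 + r / eta) / Y - a ^+ 2 * (S1 / l - A * G1) / X.
Proof.
move=> X0 Y0 l0 eta0 h1 h2 hG1 hG2 k0 hr.
have l2 : 0 < l ^+ 2 by rewrite exprn_gt0.
have e1 : S1 / l <= (X - Y) / l ^+ 2 + k.
  have -> : S1 / l = (l * S1) / l ^+ 2 by field; rewrite gt_eqF.
  by rewrite -[k](mulfK (lt0r_neq0 l2)) -mulrDl ler_pM2r ?invr_gt0.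
have e2 : (X - Y) / l ^+ 2 - k <= S2 / l.
  have -> : S2 / l = (l * S2) / l ^+ 2 by field; rewrite gt_eqF.
  by rewrite -[k](mulfK (lt0r_neq0 l2)) -mulrBl ler_pM2r ?invr_gt0.
have e3 : - 2 * Y / eta <= r / eta by rewrite ler_pM2r ?invr_gt0 //; lra.
have e4 : ((X - Y) / l ^+ 2 - 2 * Y / eta) / Y <= (S2 / l + A * G2 + r / eta) / Y.
  by rewrite ler_pM2r ?invr_gt0 //; lra.
have e5 : a ^+ 2 * (S1 / l - A * G1) / X <= a ^+ 2 * ((X - Y) / l ^+ 2) / X.
  by rewrite ler_pM2r ?invr_gt0 //; apply: ler_wpM2l; rewrite ?sqr_ge0 //; lra.
apply: (@le_trans _ _ (((X - Y) / l ^+ 2 - 2 * Y / eta) / Y - a ^+ 2 * ((X - Y) / l ^+ 2) / X)); last lra.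
have -> : ((X - Y) / l ^+ 2 - 2 * Y / eta) / Y - a ^+ 2 * ((X - Y) / l ^+ 2) / X =
  - ((1 - a) ^+ 2 / l ^+ 2) - 2 / eta + (X - a * Y) ^+ 2 / (X * Y * l ^+ 2).
  by field; rewrite !gt_eqF.
by rewrite lerDl divr_ge0 ?sqr_ge0 // ltW // !mulr_gt0.
Qed.

(** Here [X], [Y] stand for [d] at the two points, [S1], [S2] for its slopes along [e], [G1], [G2]
    for [|grad d|^2], [L1], [L2] for its Laplacians, and [Q1], [Q2] for the squared gradients at the
    maximum. The terms in [1 / X] and [1 / Y] either belong to [drift_bound] or are nonnegative,
    since [2 * A * G] dominates the Laplacian of [d]. *)
Lemma trace_lower_bound (a b X Y S1 S2 G1 G2 A k r l eta T1 T2 Q1 Q2 L1 L2 TH1 TH2 : R) :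
  0 < X -> 0 < Y -> 0 < l -> 0 < eta -> 0 <= a <= 1 -> 0 <= b ->
  l * S1 <= X - Y + k * l ^+ 2 -> X - Y - k * l ^+ 2 <= l * S2 ->
  A = 8 * k -> 0 <= k -> 4^-1 <= G1 <= 4 -> 4^-1 <= G2 <= 4 ->
  A * G2 - 2 * Y - 2 * k <= r -> `|r| <= 6 -> `|S1| <= 2 -> `|S2| <= 2 ->
  `|L1| <= k -> `|L2| <= k -> - 2^-1 <= T1 -> T2 <= 2^-1 ->
  TH1 = T1 - Q1 - 2 * (b * (S1 / l - A * G1)) * (1 / X - A)
      - G1 * (A ^+ 2 - 2 * A / X) - L1 / X + A * L1 ->
  TH2 = T2 - Q2 - 2 * (b * (S2 / l + A * G2 + r / eta)) * (1 / Y + A)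
      - G2 * (A ^+ 2 + 2 * A / Y) - L2 / Y - A * L2 ->
  (Q2 - a ^+ 2 * Q1) - 1 - 4 * A ^+ 2 - 2 * A * k
  - 2 * b * ((1 - a) ^+ 2 / l ^+ 2 + 2 / eta)
  - 2 * b * A * (4 / l + 6 / eta + 4 * A) <= a ^+ 2 * TH1 - TH2.
Proof.
move=> X0 Y0 l0 eta0 /andP[a0 a1] b0 h1 h2 AE k0 /andP[G10 G14] /andP[G20 G24] hr.
move=> /ler_normlP[r1 r2] /ler_normlP[s11 s12] /ler_normlP[s21 s22].
move=> /ler_normlP[l11 l12] /ler_normlP[l21 l22] hT1 hT2 -> ->.
have A0 : 0 <= A by rewrite AE mulr_ge0.
have AG1 : 2 * k <= A * G1 by rewrite AE; clear -k0 G10; nra.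
have AG2 : 2 * k <= A * G2 by rewrite AE; clear -k0 G20; nra.
have hd := drift_bound a X0 Y0 l0 eta0 h1 h2 AG1 AG2 k0 hr.
have a2 : a ^+ 2 <= 1 by rewrite expr_le1.
have a20 : 0 <= a ^+ 2 by rewrite sqr_ge0.
have iX : 0 <= X^-1 by rewrite invr_ge0 ltW.
have iY : 0 <= Y^-1 by rewrite invr_ge0 ltW.
have il : 0 <= l^-1 by rewrite invr_ge0 ltW.
have ie : 0 <= eta^-1 by rewrite invr_ge0 ltW.
set D := (S2 / l + A * G2 + r / eta) / Y - a ^+ 2 * (S1 / l - A * G1) / X in hd.
have hn : - (4 / l + 6 / eta + 4 * A) <=
    (S2 / l + A * G2 + r / eta) + a ^+ 2 * (S1 / l - A * G1).
  have p1 : - (2 / l) <= S2 / l by rewrite -mulNr; apply: ler_wpM2r; rewrite // lerNl.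
  have p2 : - (2 / l) <= S1 / l by rewrite -mulNr; apply: ler_wpM2r; rewrite // lerNl.
  have p3 : - (6 / eta) <= r / eta by rewrite -mulNr; apply: ler_wpM2r; rewrite // lerNl.
  have p4 : 0 <= A * G2 by apply: le_trans AG2; exact: mulr_ge0.
  have p5 : A * G1 <= 4 * A by rewrite mulrC; apply: ler_wpM2r.
  have p6 : - (2 / l + 4 * A) <= a ^+ 2 * (S1 / l - A * G1).
    apply: (@le_trans _ _ (a ^+ 2 * - (2 / l + 4 * A))).
      by rewrite mulrN lerN2 ler_piMl // addr_ge0 // mulr_ge0.
    by apply: ler_wpM2l => //; rewrite opprD lerD // lerN2.
  have e4 : 4 / l = 2 / l + 2 / l by field; rewrite gt_eqF.
  by clear -p1 p3 p4 p6 e4; lra.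
have q1 : 0 <= X^-1 * (2 * A * G1 - L1).
  by apply: mulr_ge0 => //; clear -AG1 l12 k0; lra.
have q2 : 0 <= Y^-1 * (2 * A * G2 + L2).
  by apply: mulr_ge0 => //; clear -AG2 l21 k0; lra.
have q3 : - (4 * A ^+ 2) <= - (a ^+ 2 * (G1 * A ^+ 2)).
  rewrite lerN2 mulrA; apply: ler_wpM2r; first exact: sqr_ge0.
  by apply: le_trans G14; rewrite ler_piMl // (le_trans _ G10) // invr_ge0.
have q4 : 0 <= G2 * A ^+ 2 by rewrite mulr_ge0 ?sqr_ge0 // (le_trans _ G20) // invr_ge0.
have q5 : - (A * k) <= a ^+ 2 * (A * L1).
  apply: (@le_trans _ _ (a ^+ 2 * - (A * k))).
    by rewrite mulrN lerN2 ler_piMl // mulr_ge0.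
  by apply: ler_wpM2l => //; rewrite -mulrN; apply: ler_wpM2l; rewrite // lerNl.
have q6 : - (A * k) <= A * L2 by rewrite -mulrN; apply: ler_wpM2l; rewrite // lerNl.
have q7 : - 2^-1 <= a ^+ 2 * T1 by clear -a2 a20 hT1; nra.
have b2 : 0 <= 2 * b by rewrite mulr_ge0.
have q8 := ler_wpM2l b2 hd.
have q9 := ler_wpM2l (mulr_ge0 b2 A0) hn.
have q10 := mulr_ge0 a20 q1.
have -> : a ^+ 2 *
    (T1 - Q1 - 2 * (b * (S1 / l - A * G1)) * (1 / X - A) -
     G1 * (A ^+ 2 - 2 * A / X) - L1 / X + A * L1) -
  (T2 - Q2 - 2 * (b * (S2 / l + A * G2 + r / eta)) * (1 / Y + A) -
   G2 * (A ^+ 2 + 2 * A / Y) - L2 / Y - A * L2) =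
  (Q2 - a ^+ 2 * Q1) + a ^+ 2 * T1 - T2 + 2 * b * D +
  2 * b * A * ((S2 / l + A * G2 + r / eta) + a ^+ 2 * (S1 / l - A * G1)) +
  a ^+ 2 * (X^-1 * (2 * A * G1 - L1)) + Y^-1 * (2 * A * G2 + L2)
  - a ^+ 2 * (G1 * A ^+ 2) + G2 * A ^+ 2 + a ^+ 2 * (A * L1) + A * L2.
  by rewrite /D; field; rewrite !gt_eqF.
move: q8 q9; rewrite mulrDr mulrN.
by rewrite [2 * b * A * - _]mulrN; clear -q2 q3 q4 q5 q6 q7 q10 hT2; lra.
Qed.

(** These are the errors after multiplication by [l ^+ 2], with [u = l / eta]. They are small
    because [u <= 2 * cc]; the one that grows with the dimension, [2 * n * (l * u)], is compensated
    by one of the two factors [sg] contained in [cc ^+ 2]. *)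
Lemma profile_errors (n sg cc l u A k : R) :
  2 <= n -> (n + 1) * sg = 2^-1 -> cc = sg / 200 ->
  0 < l -> 0 < u -> u <= 2 * cc -> l <= 5 / 4 * u ->
  0 <= A -> A <= 8^-1 -> 0 <= k -> k <= 64^-1 ->
  4 * (l * u) + 2 * A * (4 * l + 6 * (l * u) + 4 * A * l ^+ 2) +
   (2 * A * k * l ^+ 2 + (2 * n + A * k) * (l * u) + 9 * u ^+ 2) <= 4^-1
  /\ l ^+ 2 * (1 + 4 * A ^+ 2 + 2 * A * k) <= 3 * l.
Proof.
move=> n2 nsg ccE l0 u0 ucc lu A0 A1 k0 k1.
have sg0 : 0 < sg by nra.
have sg6 : sg <= 6^-1 by nra.
have Ak : A * k <= 8^-1 by nra.
have Ak0 : 0 <= A * k by apply: mulr_ge0.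
have A2 : A ^+ 2 <= 8^-1 by nra.
have A20 : 0 <= A ^+ 2 := sqr_ge0 A.
have cc0 : 0 < cc by lra.
have cc1 : cc <= 200^-1 by lra.
have nu : (2 * n + A * k) * (l * u) <= 10^-1.
  have h1 : l * u <= 5 * cc ^+ 2.
    clear - lu ucc l0 u0 cc0; nra.
  have h2 : 2 * n + A * k <= 4 * (n + 1) by lra.
  have h3 : 0 <= l * u by rewrite mulr_ge0 // ltW.
  apply: (@le_trans _ _ (4 * (n + 1) * (5 * cc ^+ 2))).
    by apply: ler_pM => //; lra.
  have -> : 4 * (n + 1) * (5 * cc ^+ 2) = ((n + 1) * sg) * (cc / 10).
    by rewrite expr2 {2}ccE; field.
  by rewrite nsg; lra.
have u1 : u <= 100^-1 by lra.
have ll : l <= 80^-1 by lra.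
have l2 : l ^+ 2 <= 80^-1 * l by clear - l0 ll; nra.
have l20 : 0 <= l ^+ 2 := sqr_ge0 l.
have u2 : u ^+ 2 <= 100^-1 * u by clear - u0 u1; nra.
have lu1 : l * u <= 100^-1 * l by clear - u0 u1 l0; nra.
have lu0 : 0 <= l * u by rewrite mulr_ge0 // ltW.
have Al2 : A * l ^+ 2 <= l ^+ 2.
  by clear - A0 A1 l20; move: (l ^+ 2) l20 => P P0; nra.
have Al20 : 0 <= A * l ^+ 2 by apply: mulr_ge0.
have m2 : A * k * l ^+ 2 <= l ^+ 2.
  by clear - Ak Ak0 l20; move: (A * k) (l ^+ 2) Ak Ak0 l20 => Q P Q1 Q0 P0; nra.
split.
  have m1 : A * (4 * l + 6 * (l * u) + 4 * A * l ^+ 2) <= 8^-1 * (4 * l + 6 * (l * u) + 4 * l ^+ 2).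
    apply: ler_pM => //; last lra.
    by rewrite -!mulrA !addr_ge0 // mulr_ge0 // ltW.
  have -> : 2 * A * k * l ^+ 2 = 2 * (A * k * l ^+ 2) by ring.
  have -> : 2 * A * (4 * l + 6 * (l * u) + 4 * A * l ^+ 2) =
   2 * (A * (4 * l + 6 * (l * u) + 4 * A * l ^+ 2)) by ring.
  lra.
have h1 : 1 + 4 * A ^+ 2 + 2 * A * k <= 3 by lra.
apply: (@le_trans _ _ (l * 3)); last lra.
by apply: ler_pM => //; lra.
Qed.

(* With [a = 1 - sg] the coercive term [b ^+ 2 * sg] beats the quadratic part
   of the concave profile, and its linear part beats everything else. *)
Lemma profile_balance (n sg M a Y b c E F : R) :
  2 <= n -> (n + 1) * sg = 2^-1 -> M * sg = 6 -> a = 1 - sg -> 0 < Y ->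
  b = M * Y / 2 -> c = M * Y * (1 + Y) / 4 -> E <= 4^-1 -> F <= Y ->
  b ^+ 2 * (3 * sg / 4) - F <= c * (2 - 3 * sg / 4) ^+ 2 +
    b * ((n + 1) * (1 - a) ^+ 2 - (1 + a) ^+ 2 + E) -> False.
Proof.
move=> n2 nsg Msg aE Y0 bE cE hE hF H.
have sg0 : 0 < sg by nra.
have sg6 : sg <= 6^-1 by nra.
have M36 : 36 <= M by nra.
have MY : 36 * Y <= M * Y by apply: ler_wpM2r => //; exact: ltW.
have MY2 : 0 < M * Y ^+ 2 by apply: mulr_gt0; rewrite ?exprn_gt0 //; lra.
have e1 : (n + 1) * (1 - a) ^+ 2 = sg / 2.
  rewrite aE; have -> : (n + 1) * (1 - (1 - sg)) ^+ 2 = ((n + 1) * sg) * sg by ring.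
  by rewrite nsg; field.
have e2 : c * (2 - 3 * sg / 4) ^+ 2 <= M * Y + M * Y ^+ 2.
  have -> : M * Y + M * Y ^+ 2 = M * Y * (1 + Y) by ring.
  have h4 : (2 - 3 * sg / 4) ^+ 2 <= 4 by clear - sg0 sg6; nra.
  have P0 : 0 <= M * Y * (1 + Y) by apply: mulr_ge0; lra.
  rewrite cE; clear - h4 P0.
  by move: (M * Y * (1 + Y)) ((2 - 3 * sg / 4) ^+ 2) P0 h4 => P Q P0 Q0; nra.
have e3 : b ^+ 2 * (3 * sg / 4) = 18 / 16 * (M * Y ^+ 2).
  have -> : b ^+ 2 * (3 * sg / 4) = 3 / 16 * (M * sg) * (M * Y ^+ 2).
    by rewrite bE; field.
  by rewrite Msg; field.
have e4 : - (1 + a) ^+ 2 <= - 4 + 4 * sg by rewrite aE; clear - sg0; nra.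
have e5 : b * ((n + 1) * (1 - a) ^+ 2 - (1 + a) ^+ 2 + E) <= M * Y / 2 * (- (5 / 2)).
  rewrite -bE; apply: ler_wpM2l; first by rewrite bE; lra.
  rewrite e1; lra.
rewrite e3 in H; lra.
Qed.

(** Multiplication by [l ^+ 2] reduces the claim to [profile_balance]. As [b] and [c] carry a factor
    [Y], errors without that factor must be bounded by [Y] as well; this is the purpose of
    [l <= 2 * cc * eta * T] with [T <= Y]. *)
Lemma profile_contradiction (n sg cc M a l eta A k T Y b c W : R) :
  2 <= n -> (n + 1) * sg = 2^-1 -> M * sg = 6 -> a = 1 - sg -> cc = sg / 200 ->
  0 < l -> 0 < eta -> eta <= 5 / 4 -> l <= 2 * cc * eta * T -> T <= Y -> T <= 1 ->
  0 <= A -> A <= 8^-1 -> 0 <= k -> k <= 64^-1 -> 0 < Y ->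
  b = M * Y / 2 -> c = M * Y * (1 + Y) / 4 ->
  0 <= W -> W <= (2 - 3 * sg / 4) / l ->
  (b ^+ 2 * (3 * sg / 4) / l ^+ 2) - 1 - 4 * A ^+ 2 - 2 * A * k
  - 2 * b * ((1 - a) ^+ 2 / l ^+ 2 + 2 / eta)
  - 2 * b * A * (4 / l + 6 / eta + 4 * A) <=
  c * W ^+ 2 + b * (l ^- 2 * ((n - 1) * (1 - a) ^+ 2 - (1 + a) ^+ 2) +
    A * k + (A * k + (2 * n + A * k) / eta + 9 / eta ^+ 2)) -> False.
Proof.
move=> n2 nsg Msg aE ccE l0 eta0 eta1 hl TY T1 A0 A1 k0 k1 Y0 bE cE W0 hW.
have sg0 : 0 < sg by clear - n2 nsg; nra.
have sg6 : sg <= 6^-1 by clear - n2 nsg sg0; nra.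
have M36 : 36 <= M by clear - Msg sg0 sg6; nra.
have cc0 : 0 < cc by rewrite ccE divr_gt0 ?ltr0n.
have l2 : 0 < l ^+ 2 by rewrite exprn_gt0.
pose u := l / eta.
have u0 : 0 < u by rewrite divr_gt0.
have lE : l = u * eta by rewrite /u mulfVK // gt_eqF.
have uT : u <= 2 * cc * T.
  by rewrite /u ler_pdivrMr // [_ * eta]mulrAC.
have T0 : 0 < T.
  by rewrite -(pmulr_rgt0 _ (_ : 0 < 2 * cc)); lra.
have ucc : u <= 2 * cc.
  by apply: le_trans uT _; rewrite ler_piMr //; lra.
have lu : l <= 5 / 4 * u.
  by rewrite lE mulrC; apply: ler_wpM2r => //; exact: ltW.
have b0 : 0 < b by rewrite bE divr_gt0 // mulr_gt0 //; lra.
have c0 : 0 < c by rewrite cE divr_gt0 // !mulr_gt0 //; lra.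
have W2 : l ^+ 2 * (c * W ^+ 2) <= c * (2 - 3 * sg / 4) ^+ 2.
  have -> : l ^+ 2 * (c * W ^+ 2) = c * (l * W) ^+ 2 by ring.
  apply: ler_wpM2l; first exact: ltW.
  rewrite ler_sqr ?nnegrE; [|by rewrite mulr_ge0 // ltW|lra].
  by rewrite mulrC -ler_pdivlMr.
have [hE hF] := profile_errors n2 nsg ccE l0 u0 ucc lu A0 A1 k0 k1.
have lY : 3 * l <= Y.
  have : l <= 5 / 4 * (2 * cc * T) by lra.
  have : cc * T <= 200^-1 * T by apply: ler_wpM2r; lra.
  lra.
move=> /(ler_wpM2l (ltW l2)) H.
apply: (profile_balance n2 nsg Msg aE Y0 bE cE hE (le_trans hF lY)).
move: H.
have -> : l ^+ 2 * (b ^+ 2 * (3 * sg / 4) / l ^+ 2 - 1 - 4 * A ^+ 2 - 2 * A * k -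
    2 * b * ((1 - a) ^+ 2 / l ^+ 2 + 2 / eta) - 2 * b * A * (4 / l + 6 / eta + 4 * A))
  = b ^+ 2 * (3 * sg / 4) - l ^+ 2 * (1 + 4 * A ^+ 2 + 2 * A * k)
    - b * (2 * (1 - a) ^+ 2 + 4 * (l * u)) - b * (2 * A * (4 * l + 6 * (l * u) + 4 * A * l ^+ 2)).
  by rewrite /u; field; rewrite !gt_eqF.
have -> : l ^+ 2 * (c * W ^+ 2 + b * (l ^- 2 * ((n - 1) * (1 - a) ^+ 2 - (1 + a) ^+ 2) +
    A * k + (A * k + (2 * n + A * k) / eta + 9 / eta ^+ 2))) =
  l ^+ 2 * (c * W ^+ 2) + b * ((n - 1) * (1 - a) ^+ 2 - (1 + a) ^+ 2 +
     (2 * A * k * l ^+ 2 + (2 * n + A * k) * (l * u) + 9 * u ^+ 2)).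
  by rewrite /u; field; rewrite !gt_eqF.
clear - W2; move=> H.
have {}H := le_trans H (lerD W2 (lexx _)).
set X := l ^+ 2 * _ in H *.
set P := (1 - a) ^+ 2 in H *; set Q := (1 + a) ^+ 2 in H *.
rewrite -subr_ge0; move: H; rewrite -subr_ge0; congr (0 <= _); rewrite /X; ring.
Qed.

End InteriorMaximum.

(** * Exclusion of interior maxima of the doubled function *)

Section NoInteriorMaximum.
Context {R : realType} {N : nat}.
Notation V := 'rV[R]_N.
Implicit Types (x y u v g gx gy e h ev : V) (H : 'M[R]_N) (d U : V -> R) (A M c : R).

(** Localizes [y] near the unit ball. The term [A * d y] tilts the cutoff inwards, so that its slope
    along [grad d] is at least [- 2 * d y] and stays bounded below after division by [d y]. *)
Definition cutoff A d y : R := 1 - dot y y + A * d y.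

(** At [t = ln c] this is [- M ln (1 - sqrt c)]: for small [c] it behaves like the concave function
    [M sqrt c], and it blows up at [c = 1], which confines a maximum to [c < 1]. *)
Definition profile M (t : R) : R := - M * ln (1 - expR (2^-1 * t)).

Lemma D2_profile M (t : R) : t < 0 ->
  let s := expR (2^-1 * t) in let Y := s / (1 - s) in
  D2 (profile M) t (M * Y / 2) (M * Y * (1 + Y) / 4).
Proof.
move=> t0 s Y.
have s1 : 0 < 1 - s by rewrite subr_gt0 expR_lt1 pmulr_rlt0.
have h1 : D2 (fun t => 0 + t * 2^-1) t 2^-1 0 := D2_affine _ _ _.
have h2 := D2_comp h1 (D2_expR _).
have h3 := D2_add (D2_cst 1 t) (D2_mul (D2_cst (-1) t) h2).
have sE : expR (0 + t * 2^-1) = s by rewrite add0r mulrC.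
have h4 := D2_comp (f := @ln R) (b' := (1 - s)^-1) (c' := - (1 - s) ^- 2) h3.
have {h4} := h4 _; rewrite /= sE mulN1r => /(_ (D2_ln s1)) h4.
have h5 := D2_mul (D2_cst (- M) t) h4.
have -> : profile M = (fun t0 => cst (- M) t0 * ln (cst 1 t0 + cst (-1) t0 * expR (0 + t0 * 2^-1))).
  by apply/funext => r; rewrite /profile /= mulN1r add0r [r * _]mulrC.
by apply: (D2_eq h5); rewrite /= ?sE /Y; field; rewrite gt_eqF.
Qed.

Lemma J2_cutoff A d y g H : J2 d y g H ->
  J2 (cutoff A d) y (- 2 *: y + A *: g) ((- 2)%:M + A *: H).
Proof.
move=> h; have := J2_add (J2_add (J2_cst 1 y) (J2_scale (-1) (J2_sqnorm y))) (J2_scale A h).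
have -> : (fun z => cst 1 z + -1 * dot z z + A * d z) = cutoff A d.
  by apply/funext => z; rewrite /cutoff /= mulN1r.
move=> /J2_eq; apply; first by rewrite add0r scalerA; congr (_ *: _ + _); ring.
by rewrite add0r -scalemx1 scalerA scalemx1; congr (_ %:M + _); ring.
Qed.

Lemma le_of_sqr (a b : R) : 0 <= b -> a ^+ 2 <= b ^+ 2 -> a <= b.
Proof.
move=> b0 ab; have [|a0] := lerP a 0; first by move=> /le_trans; apply.
by rewrite -ler_sqr // nnegrE ltW.
Qed.

Lemma enorm_le_of_dot u (b : R) : 0 <= b -> dot u u <= b ^+ 2 -> enorm u <= b.
Proof. by move=> b0 h; apply: le_of_sqr => //; rewrite enorm_sqr. Qed.

Lemma cutoff_gradient_bound d y gy (k A : R) : 0 <= k -> k <= 64^-1 -> A = 8 * k ->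
  dot gy gy <= 4 -> 4 * A * d y <= 1 -> 0 < cutoff A d y ->
  [/\ 0 <= A, A <= 8^-1, cutoff A d y <= 5 / 4 & enorm (- 2 *: y + A *: gy) <= 3].
Proof.
move=> k0 k1 AE hGy Ady; rewrite /cutoff => eta0.
have A0 : 0 <= A by lra.
have A8 : A <= 8^-1 by lra.
have dy4 : A * d y <= 4^-1 by lra.
have y0 := dot_ge0 y.
split=> //; first by lra.
have y1 : enorm y <= 9 / 8 by apply: enorm_le_of_dot; lra.
have g2' : enorm gy <= 2 by apply: enorm_le_of_dot; lra.
apply: le_trans (enormD _ _) _; rewrite !enormZ normrN !ger0_norm //.
have : A * enorm gy <= 8^-1 * 2 by apply: ler_pM.
lra.
Qed.

(** Both gradients are [b / l] times a vector within [sg / 8] of the unit vector [e]. Hence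
    [|g2|^2 - a^2 |g1|^2] is at least of order [sg (b / l)^2]: the positive term for the sake of
    which [a < 1] is chosen. *)
Lemma coupling_gradient_bounds (sg b l a : R) e h1 h2 :
  0 < sg -> sg <= 6^-1 -> 0 < b -> 0 < l -> a = 1 - sg -> dot e e = 1 ->
  l * enorm h1 <= sg / 8 -> l * enorm h2 <= sg / 8 ->
  let g1 := b *: (l^-1 *: e + h1) in let g2 := b *: (l^-1 *: e - h2) in
  enorm (((1 + a) / l) *: e + a *: h1 + h2 *m refl e) <= (2 - 3 * sg / 4) / l
  /\ b ^+ 2 * (3 * sg / 4) / l ^+ 2 <= dot g2 g2 - a ^+ 2 * dot g1 g1.
Proof.
move=> sg0 sg6 b0 l0 aE e1 lh1 lh2 g1 g2.
have ene : enorm e = 1 by rewrite enormE e1 sqrtr1.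
have a0 : 0 <= a by lra.
have a1 : a <= 1 by lra.
have il0 : 0 < l^-1 by rewrite invr_gt0.
have nh1 : enorm h1 <= l^-1 * (sg / 8) by rewrite mulrC ler_pdivlMr // mulrC.
have nh2 : enorm h2 <= l^-1 * (sg / 8) by rewrite mulrC ler_pdivlMr // mulrC.
split.
  apply: (@le_trans _ _ ((1 + a) / l + a * enorm h1 + enorm h2)).
    apply: le_trans (enormD _ _) _; rewrite enorm_refl // lerD2r.
    apply: le_trans (enormD _ _) _; rewrite !enormZ ene mulr1 !ger0_norm //.
    by rewrite divr_ge0 ?(ltW l0) // addr_ge0.
  have h : a * enorm h1 <= enorm h1 by rewrite ler_piMl.
  apply: (@le_trans _ _ ((1 + a) / l + l^-1 * (sg / 8) + l^-1 * (sg / 8))).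
    by rewrite lerD // lerD2l (le_trans h).
  rewrite le_eqVlt aE; apply/orP; left; apply/eqP; field; exact: lt0r_neq0.
have bl0 : 0 < b / l by rewrite divr_gt0.
have q1 : enorm g1 <= b / l * (1 + sg / 8).
  rewrite enormZ gtr0_norm // -mulrA; apply: ler_wpM2l; first exact: ltW.
  apply: le_trans (enormD _ _) _; rewrite enormZ ene mulr1 gtr0_norm //.
  by rewrite mulrDr mulr1 lerD2l.
have q2 : b / l * (1 - sg / 8) <= enorm g2.
  rewrite enormZ gtr0_norm // -mulrA; apply: ler_wpM2l; first exact: ltW.
  have := enorm_le_sub (l^-1 *: e) h2; rewrite enormZ ene mulr1 gtr0_norm //.
  rewrite mulrBr mulr1; clear - nh2; lra.
rewrite -!enorm_sqr.
have q1' : enorm g1 ^+ 2 <= (b / l * (1 + sg / 8)) ^+ 2.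
  by rewrite ler_sqr ?nnegrE // mulr_ge0 ?(ltW bl0) //; lra.
have q2' : (b / l * (1 - sg / 8)) ^+ 2 <= enorm g2 ^+ 2.
  by rewrite ler_sqr ?nnegrE // mulr_ge0 ?(ltW bl0) //; lra.
have q3 : a ^+ 2 * enorm g1 ^+ 2 <= a ^+ 2 * (b / l * (1 + sg / 8)) ^+ 2.
  by apply: ler_wpM2l => //; exact: sqr_ge0.
apply: le_trans (lerB q2' q3).
have -> : (b / l * (1 - sg / 8)) ^+ 2 - a ^+ 2 * (b / l * (1 + sg / 8)) ^+ 2 =
  (b / l) ^+ 2 * ((3 * sg / 4 + sg ^+ 2 / 8) * (2 - sg - sg ^+ 2 / 8)).
  by rewrite aE; field; exact: lt0r_neq0.
have -> : b ^+ 2 * (3 * sg / 4) / l ^+ 2 = (b / l) ^+ 2 * (3 * sg / 4).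
  by field; exact: lt0r_neq0.
apply: ler_wpM2l; first exact: sqr_ge0.
clear - sg0 sg6.
have h2 : sg ^+ 2 <= sg by nra.
have h3 : 0 <= sg ^+ 2 by exact: sqr_ge0.
have h4 : 1 <= 2 - sg - sg ^+ 2 / 8 by lra.
apply: (@le_trans _ _ ((3 * sg / 4 + sg ^+ 2 / 8) * 1)); first lra.
by apply: ler_wpM2l => //; lra.
Qed.

(** [t] is the argument of the profile; solving for [l] leaves the factor [expR (A * X + A * Y)],
    which is at most 2 since both summands are at most 1/4. *)
Lemma distance_le_cutoff (l A X Y cc eta t : R) : 0 < l -> 0 < cc * eta ->
  4 * A * X <= 1 -> 4 * A * Y <= 1 -> t = ln l + - A * X + (- A * Y + -1 * ln (cc * eta)) ->
  l <= 2 * cc * eta * expR t.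
Proof.
move=> l0 ce0 AX AY tE.
have hz : l = expR t * (cc * eta) * expR (A * X + A * Y).
  have -> : cc * eta = expR (ln (cc * eta)) by rewrite lnK.
  rewrite -!expRD -[LHS](lnK (x := l)) ?posrE //.
  by congr expR; rewrite tE; ring.
have hz2 : expR (A * X + A * Y) <= 2.
  have := expR_ge1Dx (- (A * X + A * Y)); rewrite expRN => h.
  have p0 := expR_gt0 (A * X + A * Y).
  rewrite -lef_pV2 ?posrE //; apply: le_trans h; clear - AX AY; lra.
rewrite [leLHS]hz; have -> : 2 * cc * eta * expR t = expR t * (cc * eta) * 2 by ring.
by apply: ler_wpM2l hz2; rewrite mulr_ge0 // ?expR_ge0 // ltW.
Qed.

(** The origin of [cc = sg / 200]: with [l <= 2 * cc * eta] the gradients of the terms added to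
    [ln |x - y|], including the cutoff term of size [1 / eta], are at most the fraction [sg / 8] of
    the gradient [e / l]. *)
Lemma shifted_gradient_bounds (l A cc eta sg : R) gx gy ev :
  0 < sg -> cc = sg / 200 -> 0 < eta -> eta <= 5 / 4 -> 0 < l -> l <= 2 * cc * eta ->
  0 <= A -> A <= 8^-1 -> dot gx gx <= 4 -> dot gy gy <= 4 -> enorm ev <= 3 ->
  l * enorm (- A *: gx) <= sg / 8 /\
  l * enorm (- A *: gy - eta^-1 *: ev) <= sg / 8.
Proof.
move=> sg0 ccE eta0 eta54 l0 hl A0 A8 hGx hGy hev.
have cc0 : 0 < cc by rewrite ccE divr_gt0 ?ltr0n.
have ngx : enorm gx <= 2 by apply: enorm_le_of_dot; lra.
have ngy : enorm gy <= 2 by apply: enorm_le_of_dot; lra.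
have lcc : l <= 5 / 2 * cc.
  apply: le_trans hl _; clear - eta54 cc0 eta0; nra.
have le2 : l / eta <= 2 * cc by rewrite ler_pdivrMr.
have An u : dot u u <= 4 -> enorm u <= 2 -> enorm (- A *: u) <= 4^-1.
  move=> _ h; rewrite enormZ normrN ger0_norm //.
  have : A * enorm u <= 8^-1 * 2 by apply: ler_pM.
  by clear; lra.
have lA u : enorm u <= 4^-1 -> l * enorm u <= 5 / 8 * cc.
  move=> h; have : l * enorm u <= 5 / 2 * cc * 4^-1 by apply: ler_pM => //; exact: ltW.
  by clear; lra.
split; first by apply: le_trans (lA _ (An _ hGx ngx)) _; rewrite ccE; clear - sg0; lra.
apply: (@le_trans _ _ (l * (enorm (- A *: gy) + eta^-1 * enorm ev))).
  apply: ler_wpM2l; first exact: ltW.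
  apply: le_trans (enormB _ _) _; rewrite [enorm (_^-1 *: _)]enormZ ger0_norm //.
  by rewrite invr_ge0 ltW.
rewrite mulrDr.
have h1 := lA _ (An _ hGy ngy).
have h2 : l / eta * enorm ev <= 2 * cc * 3.
  by apply: ler_pM => //; rewrite divr_ge0 // ltW.
rewrite mulrA; apply: le_trans (lerD h1 h2) _; rewrite ccE; clear - sg0; lra.
Qed.

(** The inequalities for [dot (x - y) gx] and [dot (x - y) gy] are Taylor expansions of [d] between
    the two points; [dot y gy <= d y + k] comes from comparing [y] with the origin, where [d] is
    positive. Once [gU1] and [gU2] are eliminated, the lower bound of [trace_lower_bound] meets the
    upper bound of the coupling in [profile_contradiction]. *)
Lemma no_interior_maximum d U1 U2 x y gx gy Hx Hy gU1 gU2 (HU1 HU2 : 'M[R]_N)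
    (k A sg cc M : R) :
  (2 <= N)%N -> sg = (2 * N%:R + 2)^-1 -> cc = sg / 200 -> M = 12 * (N%:R + 1) ->
  0 <= k -> k <= 64^-1 -> A = 8 * k -> x != y ->
  J2 d x gx Hx -> J2 d y gy Hy ->
  4^-1 <= dot gx gx <= 4 -> 4^-1 <= dot gy gy <= 4 ->
  `|\tr Hx| <= k -> `|\tr Hy| <= k -> 0 < d x -> 0 < d y ->
  4 * A * d x <= 1 -> 4 * A * d y <= 1 ->
  dot (x - y) gx <= d x - d y + k * dot (x - y) (x - y) ->
  d x - d y - k * dot (x - y) (x - y) <= dot (x - y) gy ->
  dot y gy <= d y + k ->
  J2 U1 x gU1 HU1 -> 0 < U1 x -> - 2^-1 * U1 x <= \tr HU1 ->
  J2 U2 y gU2 HU2 -> 0 < U2 y -> \tr HU2 <= 2^-1 * U2 y ->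
  0 < cutoff A d y ->
  lognorm (x - y) + - A * d x + (- A * d y + -1 * ln (cc * cutoff A d y)) < 0 ->
  (forall u v, \forall t \near (0 : R),
     (ln (U1 (x + t *: u)) + -1 * ln (d (x + t *: u)) + A * d (x + t *: u)) -
     (ln (U2 (y + t *: v)) + -1 * ln (d (y + t *: v)) + - A * d (y + t *: v)) -
       profile M (lognorm (x - y + t *: (u - v)) + - A * d (x + t *: u)
         + (- A * d (y + t *: v) + -1 * ln (cc * cutoff A d (y + t *: v))))
     <= (ln (U1 x) + -1 * ln (d x) + A * d x) -
        (ln (U2 y) + -1 * ln (d y) + - A * d y)
         - profile M (lognorm (x - y) + - A * d x
         + (- A * d y + -1 * ln (cc * cutoff A d y)))) ->
  False.
Proof.
move=> N2 sgE ccE ME k0 k1 AE xy hdx hdy hGx hGy hLx hLy dx0 dy0 Adx Ady ht1 ht2 hty.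
move=> hU1 U1x0 hT1 hU2 U2y0 hT2 eta0 tau0 hmax.
set eta := cutoff A d y in eta0 tau0.
set tau := lognorm _ + _ + _ in tau0.
have n2 : (2 : R) <= N%:R by rewrite ler_nat.
have sg0 : 0 < sg by rewrite sgE invr_gt0; lra.
have nsg : (N%:R + 1) * sg = 2^-1 by rewrite sgE; field; lra.
have Msg : M * sg = 6 by rewrite ME -mulrA nsg; field.
have sg6 : sg <= 6^-1 by clear - n2 nsg sg0; nra.
have M36 : 36 <= M by rewrite ME; lra.
have cc0 : 0 < cc by rewrite ccE divr_gt0 ?ltr0n.
have ce0 : 0 < cc * eta by rewrite mulr_gt0.
set a := 1 - sg.
have hJ1 := J2_add (J2_add (J2_comp hU1 (D2_ln U1x0))
   (J2_scale (-1) (J2_comp hdx (D2_ln dx0)))) (J2_scale A hdx).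
have hJ2 := J2_add (J2_add (J2_comp hU2 (D2_ln U2y0))
   (J2_scale (-1) (J2_comp hdy (D2_ln dy0)))) (J2_scale (- A) hdy).
have hf1 := J2_scale (- A) hdx.
have hf2 := J2_add (J2_scale (- A) hdy) (J2_scale (-1)
  (J2_comp (J2_scale cc (J2_cutoff A hdy)) (D2_ln ce0))).
have hphi := D2_profile M tau0.
set s := expR _ in hphi; set Y := s / (1 - s) in hphi.
have := doubling_trace_inequality a xy hJ1 hJ2 hf1 hf2 hphi hmax.
set l := enorm (x - y); set e := l^-1 *: (x - y).
set b := M * Y / 2; set c := M * Y * (1 + Y) / 4.
set g1 := (U1 x)^-1 *: gU1 + _ + _; set g2 := (U2 y)^-1 *: gU2 + _ + _.
set h1 := - A *: gx; set ev := - 2 *: y + A *: gy.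
have -> : - A *: gy + -1 *: ((cc * eta)^-1 *: (cc *: ev)) = - A *: gy - eta^-1 *: ev.
  rewrite scaleN1r scalerA; congr (_ - _ *: _); field.
  by rewrite !gt_eqF.
set h2 := - A *: gy - _.
rewrite !mxtraceD !mxtraceZ !mxtraceD !mxtraceZ !tr_outer !mxtraceD !mxtraceZ mxtrace_scalar.
case=> e1 g1E g2E.
clear hmax hJ1 hJ2 hf1 hf2 hphi hdx hdy hU1 hU2.
have l0 : 0 < l by rewrite enorm_gt0 subr_eq0.
have ln0 : l != 0 by rewrite gt_eqF.
have zE : x - y = l *: e by rewrite /e scalerA mulfV // scale1r.
have l2E : dot (x - y) (x - y) = l ^+ 2 by rewrite -enorm_sqr.
have ht1' : l * dot gx e <= d x - d y + k * l ^+ 2.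
  by rewrite -dotZr -zE -l2E dotC.
have ht2' : d x - d y - k * l ^+ 2 <= l * dot gy e.
  by rewrite -dotZr -zE -l2E [dot gy _]dotC.
clearbody e.
have ene : enorm e = 1 by rewrite enormE e1 sqrtr1.
have [/andP[hGx1 hGx2] /andP[hGy1 hGy2]] := (hGx, hGy).
have [A0 A8 eta54 enz] := cutoff_gradient_bound k0 k1 AE hGy2 Ady eta0.
rewrite -/eta in eta54.
set T := expR tau.
have s0 : 0 < s by exact: expR_gt0.
have s1 : s < 1 by rewrite /s expR_lt1 pmulr_rlt0.
have Y0 : 0 < Y by rewrite divr_gt0 // subr_gt0.
have T0 : 0 < T by exact: expR_gt0.
have T1 : T <= 1 by rewrite /T expR_le1 ltW.
have TE : T = s ^+ 2 by rewrite /T /s -expRM_natl; congr expR; field.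
have sY : s <= Y by rewrite /Y ler_pdivlMr ?subr_gt0 //; clear - s0 s1; nra.
have TY : T <= Y by apply: le_trans sY; rewrite TE; clear - s0 s1; nra.
have hl : l <= 2 * cc * eta * T.
  by apply: (distance_le_cutoff l0 ce0 Adx Ady); rewrite /tau lognormE // subr_eq0.
have hl' : l <= 2 * cc * eta.
  by apply: le_trans hl _; rewrite ler_piMr // -mulrA mulr_ge0 // ltW.
have b0 : 0 < b by rewrite /b divr_gt0 // mulr_gt0 //; clear - M36; lra.
have [lh1 lh2] := shifted_gradient_bounds sg0 ccE eta0 eta54 l0 hl' A0 A8 hGx2 hGy2 enz.
have [hw hQ] := coupling_gradient_bounds sg0 sg6 b0 l0 (erefl a) e1 lh1 lh2.
rewrite -/h1 -/h2 -g1E -g2E in hw hQ.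
have a01 : 0 <= a <= 1 by clear - sg0 sg6; rewrite /a; apply/andP; split; lra.
have hr : A * dot gy gy - 2 * d y - 2 * k <= dot gy ev.
  by rewrite /ev !dotE [dot gy y]dotC; clear - hty; lra.
rewrite -/ev in enz; clearbody ev.
have dg1 : dot g1 gx = b * (dot gx e / l - A * dot gx gx).
  by rewrite g1E /h1 !dotE [dot e gx]dotC; ring.
have dg2 : dot g2 gy = b * (dot gy e / l + A * dot gy gy + dot gy ev / eta).
  by rewrite g2E /h2 !dotE [dot e gy]dotC [dot ev gy]dotC; ring.
(* [grad ln U] is expressed by the gradient at the maximum and by [grad d]; squaring it below
   produces the drift term [dot g1 gx / d x]. *)
have p1 : (U1 x)^-1 *: gU1 = g1 + ((d x)^-1 - A) *: gx.
  rewrite /g1 scaleN1r scalerBl; apply/matrixP => i j; rewrite !mxE; ring.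
have p2 : (U2 y)^-1 *: gU2 = g2 + ((d y)^-1 + A) *: gy.
  rewrite /g2 scaleN1r scalerDl; apply/matrixP => i j; rewrite !mxE; ring.
clearbody g1 g2.
have pp1 : (U1 x) ^- 2 * dot gU1 gU1 = dot g1 g1 + 2 * ((d x)^-1 - A) * dot g1 gx
    + ((d x)^-1 - A) ^+ 2 * dot gx gx.
  have -> : (U1 x) ^- 2 * dot gU1 gU1 = dot ((U1 x)^-1 *: gU1) ((U1 x)^-1 *: gU1).
    by rewrite !dotE -exprVn; ring.
  by rewrite p1 !dotE [dot gx g1]dotC; ring.
have pp2 : (U2 y) ^- 2 * dot gU2 gU2 = dot g2 g2 + 2 * ((d y)^-1 + A) * dot g2 gy
    + ((d y)^-1 + A) ^+ 2 * dot gy gy.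
  have -> : (U2 y) ^- 2 * dot gU2 gU2 = dot ((U2 y)^-1 *: gU2) ((U2 y)^-1 *: gU2).
    by rewrite !dotE -exprVn; ring.
  by rewrite p2 !dotE [dot gy g2]dotC; ring.
rewrite !mulNr pp1 pp2 dg1 dg2 !mul1r.
set TH1 := _ + A * \tr Hx; set TH2 := _ - A * \tr Hy.
have cs1 : `|dot gx e| <= 2.
  apply: le_trans (cauchy_schwarz _ _) _; rewrite ene mulr1.
  by apply: enorm_le_of_dot; clear - hGx2; lra.
have ngy : enorm gy <= 2 by apply: enorm_le_of_dot; clear - hGy2; lra.
have cs2 : `|dot gy e| <= 2 by apply: le_trans (cauchy_schwarz _ _) _; rewrite ene mulr1.
have cs3 : `|dot gy ev| <= 6.
  apply: le_trans (cauchy_schwarz _ _) _; have -> : (6 : R) = 2 * 3 by ring.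
  by apply: ler_pM.
have T1ge : - 2^-1 <= (U1 x)^-1 * \tr HU1 by rewrite mulrC ler_pdivlMr.
have T2le : (U2 y)^-1 * \tr HU2 <= 2^-1 by rewrite mulrC ler_pdivrMr.
have eq1 : TH1 = (U1 x)^-1 * \tr HU1 - dot g1 g1 -
    2 * (b * (dot gx e / l - A * dot gx gx)) * (1 / d x - A)
      - dot gx gx * (A ^+ 2 - 2 * A / d x) - \tr Hx / d x + A * \tr Hx.
  by rewrite /TH1; field; rewrite !gt_eqF.
have eq2 : TH2 = (U2 y)^-1 * \tr HU2 - dot g2 g2 -
    2 * (b * (dot gy e / l + A * dot gy gy + dot gy ev / eta)) * (1 / d y + A)
      - dot gy gy * (A ^+ 2 + 2 * A / d y) - \tr Hy / d y - A * \tr Hy.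
  by rewrite /TH2; field; rewrite !gt_eqF.
have hTL := @trace_lower_bound _ a b (d x) (d y) (dot gx e) (dot gy e) (dot gx gx)
  (dot gy gy) A k (dot gy ev) l eta _ _ (dot g1 g1) (dot g2 g2) (\tr Hx) (\tr Hy) TH1 TH2
  dx0 dy0 l0 eta0 a01 (ltW b0) ht1' ht2' AE k0 hGx hGy hr cs3 cs1 cs2 hLx hLy T1ge T2le
  eq1 eq2.
move=> /(le_trans hTL) H.
apply: (@profile_contradiction _ N%:R sg cc M a l eta A k T Y b c _
  n2 nsg Msg (erefl a) ccE l0 eta0 eta54 hl TY T1 A0 A8 k0 k1 Y0 (erefl b) (erefl c)
  (enorm_ge0 _) hw).
apply: (@le_trans _ _ ((dot g2 g2 - a ^+ 2 * dot g1 g1) - 1 - 4 * A ^+ 2 - 2 * A * k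
  - 2 * b * ((1 - a) ^+ 2 / l ^+ 2 + 2 / eta)
  - 2 * b * A * (4 / l + 6 / eta + 4 * A))).
  by rewrite !lerD2r.
apply: le_trans H _; rewrite lerD2l; apply: ler_wpM2l; first exact: ltW.
move/ler_normlP: hLx => [lx1 lx2]; move/ler_normlP: hLy => [ly1 ly2].
have kA : 0 <= A * k by apply: mulr_ge0.
have z1 : - (A * \tr Hx) <= A * k by rewrite -mulrN; apply: ler_wpM2l.
have z2 : - (A * \tr Hy) <= A * k by rewrite -mulrN; apply: ler_wpM2l.
apply: lerD.
  rewrite lerD2l; apply: (@le_trans _ _ (a ^+ 2 * (A * k))).
    by apply: ler_wpM2l => //; exact: sqr_ge0.
  by rewrite ler_piMl // expr_le1 //; case/andP: a01.
have -> : - (A * \tr Hy) - ((cc * eta)^-1 * (cc * (- 2 *+ N + A * \tr Hy)) -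
     (cc * eta) ^- 2 * dot (cc *: ev) (cc *: ev)) =
  - (A * \tr Hy) + (2 * N%:R + - (A * \tr Hy)) / eta + dot ev ev / eta ^+ 2.
  by rewrite !dotE -[- 2 *+ N]mulr_natr; field; rewrite !gt_eqF.
apply: lerD; first (apply: lerD => //; rewrite ler_pM2r ?invr_gt0 // lerD2l //).
rewrite ler_pM2r ?invr_gt0 ?exprn_gt0 // -enorm_sqr.
have -> : (9 : R) = 3 ^+ 2 by ring.
by rewrite ler_sqr ?nnegrE.
Qed.

End NoInteriorMaximum.

(** * Compactness, pointwise continuity and the positive part *)

Section Compactness.
Context {R : realType}.

Lemma compact_max_continuous_at (T : topologicalType) (f : T -> R) (K : set T) p0 :
  compact K -> K p0 -> (forall p, K p -> {for p, continuous f}) ->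
  exists2 p, K p & forall q, K q -> f q <= f p.
Proof.
move=> cK Kp0 cf.
have [||p] := compact_EVT_max (f := f) _ cK; first by exists p0.
  by apply: continuous_in_subspaceT => x; rewrite inE => /cf.
by rewrite inE => Kp hp; exists p => // q Kq; apply: hp; rewrite inE.
Qed.

(** Continuity of [f] is known only at the points of [K], so the argument uses cluster points: one
    that lies in [K] inherits the inequality by continuity there. *)
Lemma compact_superlevel (T : topologicalType) (f : T -> R) (K : set T) a :
  compact K -> (forall p, K p -> {for p, continuous f}) ->
  compact [set p | K p /\ a <= f p].
Proof.
move=> cK cf F PF FK.
have FK' : F K by apply: filterS FK => x [].
have [p [Kp cp]] := cK F PF FK'.
exists p; split=> //; split=> //; rewrite leNgt; apply/negP => fpa.
have hn : nbhs p [set q | f q < a] by exact: (cf p Kp) (lt_nbhsl fpa).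
by have [q [[_ h1] /= h2]] := cp _ _ FK hn; move: h2; rewrite ltNge h1.
Qed.

Section PointwiseContinuity.
Context {T : topologicalType} (x : T).
Implicit Types (f g : T -> R) (c : R).

Lemma cont_cst c : {for x, continuous (fun _ : T => c)}.
Proof. exact: cvg_cst. Qed.

Lemma cont_mul f g : {for x, continuous f} -> {for x, continuous g} ->
  {for x, continuous (fun y => f y * g y)}.
Proof. by move=> cf cg; exact: (cvgM cf cg). Qed.

Lemma cont_add f g : {for x, continuous f} -> {for x, continuous g} ->
  {for x, continuous (fun y => f y + g y)}.
Proof. by move=> cf cg; exact: (cvgD cf cg). Qed.

Lemma cont_scale c f : {for x, continuous f} -> {for x, continuous (fun y => c * f y)}.
Proof. by move=> cf; apply: cont_mul => //; exact: cont_cst. Qed.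

Lemma cont_opp f : {for x, continuous f} -> {for x, continuous (fun y => - f y)}.
Proof. by move=> cf; exact: (cvgN cf). Qed.

Lemma cont_sub f g : {for x, continuous f} -> {for x, continuous g} ->
  {for x, continuous (fun y => f y - g y)}.
Proof. by move=> cf cg; exact: (cont_add cf (cont_opp cg)). Qed.

Lemma cont_inv f : f x != 0 -> {for x, continuous f} ->
  {for x, continuous (fun y => (f y)^-1)}.
Proof. by move=> fx cf; exact: (cvgV fx cf). Qed.

Lemma cont_comp (phi : R -> R) f : {for x, continuous f} -> {for f x, continuous phi} ->
  {for x, continuous (fun y => phi (f y))}.
Proof. by move=> cf cphi; exact: (continuous_comp cf cphi). Qed.

Lemma cont_exp f : {for x, continuous f} -> {for x, continuous (fun y => expR (f y))}.
Proof. by move=> cf; apply: cont_comp => //; exact: continuous_expR. Qed.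

End PointwiseContinuity.

(** It lets [coupling] vanish, instead of losing its meaning, where [U1 <= 0] or where the two
    points are too far apart. *)
Definition posp (t : R) : R := (t + `|t|) / 2.

Lemma posp_pos t : 0 <= t -> posp t = t.
Proof. by move=> h; rewrite /posp ger0_norm //; field. Qed.

Lemma posp_neg t : t <= 0 -> posp t = 0.
Proof. by move=> h; rewrite /posp ler0_norm // subrr mul0r. Qed.

Lemma posp_ge0 t : 0 <= posp t.
Proof. by have [t0|/ltW/posp_neg ->] := lerP 0 t; rewrite ?posp_pos. Qed.

Lemma posp_gt0 t : 0 < posp t -> 0 < t.
Proof. by have [//|/posp_neg ->] := ltrP 0 t; rewrite ltxx. Qed.

Lemma posp_le1 t : t <= 1 -> posp t <= 1.
Proof. by have [t0|/ltW/posp_neg ->] := lerP 0 t; rewrite ?posp_pos. Qed.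

Lemma cont_posp (T : topologicalType) (x : T) (f : T -> R) :
  {for x, continuous f} -> {for x, continuous (fun y => posp (f y))}.
Proof.
move=> cf; apply: cont_mul; last exact: cont_cst.
by apply: cont_add => //; exact: (cvg_norm cf).
Qed.

Lemma near_pair_enorm {N : nat} (P : 'rV[R]_N * 'rV[R]_N -> Prop) (z w : 'rV[R]_N) :
  (\forall p \near (z, w), P p) ->
  exists2 e : R, 0 < e & forall x y : 'rV[R]_N, enorm (x - z) < e -> enorm (y - w) < e -> P (x, y).
Proof.
move=> [[A B] /= [/nbhs_enormP[a a0 hA] /nbhs_enormP[b b0 hB]] hP].
exists (Num.min a b); first by rewrite lt_min a0.
move=> x y; rewrite !lt_min => /andP[xa _] /andP[_ yb]; apply: hP; split => /=.
  exact: hA.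
exact: hB.
Qed.

Lemma closed_eball_compact {N : nat} (r : R) : compact [set x : 'rV[R]_N | enorm x <= r].
Proof.
apply: (@closed_ebounded_compact _ _ _ r) => //.
have -> : [set x : 'rV[R]_N | enorm x <= r] = enorm @^-1` [set t | t <= r] by [].
apply: closed_comp; last exact: closed_le.
by move=> x _; exact: enorm_continuous.
Qed.

End Compactness.

(** * The doubled function in exponential form *)

Section CouplingFunction.
Context {R : realType} {N : nat}.
Notation V := 'rV[R]_N.
Implicit Types (x y z : V) (d U : V -> R) (A cc : R) (m : nat).

Definition closeness d A cc x y : R :=
  enorm (x - y) * expR (- (A * d x) - A * d y) / (cc * cutoff A d y).

Definition first_factor U d A x : R := posp (U x) / d x * expR (A * d x).

Definition second_factor U d A y : R := d y / U y * expR (A * d y).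

(** The exponential of the doubled function of [no_interior_maximum]; the penalty becomes the power
    [m]. Unlike the logarithm it remains continuous where the first factor or the penalty vanishes,
    so compactness applies to it. *)
Definition coupling d A cc m U1 U2 (p : V * V) : R :=
  first_factor U1 d A p.1 * second_factor U2 d A p.2 *
  posp (1 - Num.sqrt (closeness d A cc p.1 p.2)) ^+ m.

Lemma first_factor_continuous U d A x : d x != 0 ->
  {for x, continuous U} -> {for x, continuous d} ->
  {for x, continuous (first_factor U d A)}.
Proof.
move=> dx cU cd; apply: cont_mul; last by apply: cont_exp; exact: cont_scale.
by apply: cont_mul; [exact: cont_posp|exact: cont_inv].
Qed.

Lemma second_factor_continuous U d A y : U y != 0 ->
  {for y, continuous U} -> {for y, continuous d} ->
  {for y, continuous (second_factor U d A)}.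
Proof.
move=> dx cU cd; apply: cont_mul; last by apply: cont_exp; exact: cont_scale.
by apply: cont_mul => //; exact: cont_inv.
Qed.

Lemma cont_dot y : {for y, continuous (fun y : V => dot y y)}.
Proof.
have -> : (fun y : V => dot y y) = (fun y => enorm y * enorm y).
  by apply/funext => z; rewrite -enorm_sqr expr2.
by apply: cont_mul; exact: enorm_continuous.
Qed.

Lemma cutoff_continuous d A y : {for y, continuous d} ->
  {for y, continuous (cutoff A d)}.
Proof.
move=> cd; apply: cont_add; last exact: cont_scale.
by apply: cont_sub; [exact: cont_cst|exact: cont_dot].
Qed.

Lemma enorm_sub_continuous x y :
  {for (x, y), continuous (fun p : V * V => enorm (p.1 - p.2))}.
Proof.
apply/(@cvgrPdist_lt _ _ _ (nbhs (x, y))) => e e0.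
exists ([set z | enorm (z - x) < e / 2], [set z | enorm (z - y) < e / 2]).
  by split; apply/nbhs_enormP; exists (e / 2); rewrite ?divr_gt0.
move=> [p q] /= [h1 h2].
have h : enorm ((x - y) - (p - q)) < e.
  have -> : (x - y) - (p - q) = (x - p) - (y - q).
    by apply/matrixP => i j; rewrite !mxE; ring.
  apply: le_lt_trans (enormB _ _) _; rewrite enormC [enorm (y - q)]enormC; lra.
apply: le_lt_trans h; rewrite ler_norml; apply/andP; split.
  by have := enorm_le_sub (p - q) (x - y); rewrite [enorm (p - q - _)]enormC; lra.
by have := enorm_le_sub (x - y) (p - q); lra.
Qed.

Lemma cont_fst (f : V -> R) x y : {for x, continuous f} ->
  {for (x, y), continuous (fun p : V * V => f p.1)}.
Proof.
move=> cf B hB; exists ([set z | B (f z)], setT); last by move=> [p q] [].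
by split; [exact: cf|exact: filterT].
Qed.

Lemma cont_snd (f : V -> R) x y : {for y, continuous f} ->
  {for (x, y), continuous (fun p : V * V => f p.2)}.
Proof.
move=> cf B hB; exists (setT, [set z | B (f z)]); last by move=> [p q] [].
by split; [exact: filterT|exact: cf].
Qed.

Lemma coupling_continuous d A cc m U1 U2 x y : 0 < cc ->
  d x != 0 -> U2 y != 0 -> cutoff A d y != 0 ->
  {for x, continuous d} -> {for y, continuous d} ->
  {for x, continuous U1} -> {for y, continuous U2} ->
  {for (x, y), continuous (coupling d A cc m U1 U2)}.
Proof.
move=> cc0 dx Uy ey cdx cdy cU1 cU2.
have c1 (f : V -> R) := @cont_fst f x y; have c2 (f : V -> R) := @cont_snd f x y.
apply: cont_mul; first apply: cont_mul.
- by apply: c1; exact: first_factor_continuous.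
- by apply: c2; exact: second_factor_continuous.
apply: (@cont_comp _ _ _ (fun t => t ^+ m)); last exact: exprn_continuous.
apply: cont_posp; apply: cont_sub; first exact: cont_cst.
apply: (@cont_comp _ _ _ Num.sqrt); last exact: sqrt_continuous.
apply: cont_mul.
  apply: cont_mul.
    exact: enorm_sub_continuous.
  apply: cont_exp; apply: cont_sub; last by apply: cont_scale; exact: c2.
  by apply: cont_opp; apply: cont_scale; exact: c1.
apply: cont_inv; first by rewrite mulf_neq0 // gt_eqF.
by apply: cont_scale; apply: (c2 (cutoff A d)); exact: cutoff_continuous.
Qed.

Definition log_closeness d A cc x y : R :=
  lognorm (x - y) + - A * d x + (- A * d y + -1 * ln (cc * cutoff A d y)).

Lemma closenessE d A cc x y : x != y -> 0 < cc * cutoff A d y ->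
  closeness d A cc x y = expR (log_closeness d A cc x y).
Proof.
move=> xy ce; rewrite /log_closeness lognormE ?subr_eq0 //.
have -> : ln (enorm (x - y)) + - A * d x + (- A * d y + -1 * ln (cc * cutoff A d y)) =
  ln (enorm (x - y)) + (- (A * d x) - A * d y) - ln (cc * cutoff A d y) by ring.
have lp : 0 < enorm (x - y) by rewrite enorm_gt0 subr_eq0.
by rewrite expRD expRN expRD !lnK ?posrE.
Qed.

Lemma sqrt_expR (t : R) : Num.sqrt (expR t) = expR (2^-1 * t).
Proof.
rewrite -[RHS]ger0_norm ?expR_ge0 // -sqrtr_sqr -expRM_natl.
by congr (Num.sqrt (expR _)); field.
Qed.

Lemma log_coupling d A cc m U1 U2 x y : x != y -> 0 < cc -> 0 < cutoff A d y ->
  0 < d x -> 0 < d y -> 0 < U1 x -> 0 < U2 y -> closeness d A cc x y < 1 ->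
  0 < coupling d A cc m U1 U2 (x, y) /\
  ln (coupling d A cc m U1 U2 (x, y)) =
  (ln (U1 x) + -1 * ln (d x) + A * d x) - (ln (U2 y) + -1 * ln (d y) + - A * d y)
  - profile m%:R (log_closeness d A cc x y).
Proof.
move=> xy cc0 e0 dx dy u1 u2 c1.
have ce : 0 < cc * cutoff A d y by rewrite mulr_gt0.
have s1 : 0 < 1 - Num.sqrt (closeness d A cc x y).
  by rewrite subr_gt0 -sqrtr1 ltr_sqrt.
have e := closenessE xy ce.
rewrite /coupling /first_factor /second_factor /= !posp_pos ?(ltW s1) ?(ltW u1) //.
have pm : 0 < (1 - Num.sqrt (closeness d A cc x y)) ^+ m by rewrite exprn_gt0.
split.
  by rewrite !mulr_gt0 // ?invr_gt0 ?expR_gt0.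
rewrite !lnM ?posrE ?mulr_gt0 ?invr_gt0 ?expR_gt0 // lnXn // !expRK !lnV ?posrE //.
rewrite e sqrt_expR /profile -mulr_natl; ring.
Qed.

End CouplingFunction.

(** * The upper bound 4 for the coupling *)

Section CouplingBound.
Context {R : realType} {N : nat}.
Notation V := 'rV[R]_N.

(** Compactness in threshold form: one threshold near each point yields one threshold for the whole
    closed ball. *)
Lemma near_covering_ball (r : R) (P : R -> V -> Prop) :
  (forall z, enorm z <= r -> exists2 e : R, 0 < e &
     forall x i, enorm (x - z) < e -> 0 < i -> i < e -> P i x) ->
  exists2 i : R, 0 < i & forall x, enorm x <= r -> P i x.
Proof.
move=> h.
have hc := (compact_near_coveringP _).1 (@closed_eball_compact R N r).
have := hc R (0^'+) P _ _.
case/(_ _).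
  move=> z /= /h[e e0 he].
  exists ([set x | enorm (x - z) < e], [set i | 0 < i < e]) => /=.
    split; first by apply/nbhs_enormP; exists e.
    near=> i; apply/andP; split; near: i; first exact: nbhs_right_gt.
    exact: nbhs_right_lt.
  by move=> [x i] /= [h1 /andP[h2 h3]]; exact: he.
move=> e e0 he; exists (e / 2); first by rewrite divr_gt0.
move=> x hx; apply: (he (e / 2)) => //=; last by rewrite divr_gt0.
rewrite sub0r normrN gtr0_norm ?divr_gt0 // ltr_pdivrMr //; move: e0 => /=; lra.
Unshelve. all: by end_near. Qed.

Lemma expR_half_le2 (t : R) : t <= 2^-1 -> expR t <= 2.
Proof.
move=> t2; have := expR_ge1Dx (- t); rewrite expRN => h.
have p0 := expR_gt0 t.
rewrite -lef_pV2 ?posrE //; apply: le_trans h; lra.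
Qed.

Context (d : V -> R) (Gd : V -> V) (Hd : V -> 'M[R]_N).
Context (k A sg cc : R) (m : nat).
Context (N2 : (2 <= N)%N) (sgE : sg = (2 * N%:R + 2)^-1) (ccE : cc = sg / 200).
Context (mE : m = (12 * N.+1)%N) (k0 : 0 <= k) (k1 : k <= 64^-1) (AE : A = 8 * k).
Context (hd : forall x, enorm x < 2 -> J2 d x (Gd x) (Hd x)).
Context (cd : forall x, enorm x < 2 -> {for x, continuous d}).
Context (dG : forall x, enorm x < 2 -> 4^-1 <= dot (Gd x) (Gd x) <= 4).
Context (dH : forall x v, enorm x < 2 -> `|dot (v *m Hd x) v| <= k / 2 * dot v v).
Context (dT : forall x, enorm x < 2 -> `|\tr (Hd x)| <= k).
Context (dA : forall x, enorm x < 2 -> 4 * A * d x <= 1).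
Context (d00 : 0 < d 0).

Context (U1 U2 : V -> R) (G1 G2 : V -> V) (H1 H2 : V -> 'M[R]_N) (c0 : R).
Context (hU1 : forall x, enorm x < 2 -> 0 < d x -> J2 U1 x (G1 x) (H1 x)).
Context (hU2 : forall x, enorm x < 2 -> 0 < d x -> J2 U2 x (G2 x) (H2 x)).
Context (cU1 : forall x, enorm x < 2 -> 0 < d x -> {for x, continuous U1}).
Context (cU2 : forall x, enorm x < 2 -> 0 < d x -> {for x, continuous U2}).
Context (U12 : forall x, enorm x < 2 -> 0 < d x -> U1 x <= U2 x).
Context (c00 : 0 < c0) (U2c : forall x, enorm x < 2 -> 0 < d x -> c0 <= U2 x).
Context (T1 : forall x, enorm x < 2 -> 0 < d x -> 0 < U1 x -> - 2^-1 * U1 x <= \tr (H1 x)).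
Context (T2 : forall x, enorm x < 2 -> 0 < d x -> \tr (H2 x) <= 2^-1 * U2 x).
Context (U1b : forall z, enorm z < 2 -> d z = 0 -> \forall x \near z, 0 < d x -> U1 x <= 0).

Let P1 := first_factor U1 d A.
Let P2 := second_factor U2 d A.
Let cpl := coupling d A cc m U1 U2.

Lemma ball32_lt2 (x : V) : enorm x <= 3 / 2 -> enorm x < 2.
Proof. by move=> h; apply: le_lt_trans h _; lra. Qed.

Lemma U2_gt0 x : enorm x < 2 -> 0 < d x -> 0 < U2 x.
Proof. by move=> hx dx; apply: lt_le_trans c00 (U2c hx dx). Qed.

Lemma P1_ge0 x : 0 < d x -> 0 <= P1 x.
Proof. by move=> dx; rewrite mulr_ge0 ?expR_ge0 // divr_ge0 ?posp_ge0 ?ltW. Qed.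

Lemma P2_ge0 x : enorm x < 2 -> 0 < d x -> 0 <= P2 x.
Proof.
by move=> hx dx; rewrite mulr_ge0 ?expR_ge0 // divr_ge0 ?ltW // U2_gt0.
Qed.

Lemma diagonal_le2 x : enorm x < 2 -> 0 < d x -> P1 x * P2 x <= 2.
Proof.
move=> hx dx; have u2 := U2_gt0 hx dx.
have -> : P1 x * P2 x = posp (U1 x) / U2 x * expR (A * d x + A * d x).
  by rewrite /P1 /P2 /first_factor /second_factor expRD; field; rewrite !gt_eqF.
have -> : (2 : R) = 1 * 2 by ring.
apply: ler_pM.
- by rewrite divr_ge0 ?posp_ge0 ?(ltW u2).
- exact: expR_ge0.
- rewrite ler_pdivrMr // mul1r.
  have [t0|/ltW/posp_neg ->] := lerP 0 (U1 x); last exact: ltW.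
  by rewrite posp_pos // U12.
- by apply: expR_half_le2; have := dA hx; lra.
Qed.

Lemma coupling_le_factors x y : enorm y < 2 -> 0 < d x -> 0 < d y ->
  0 <= closeness d A cc x y -> cpl (x, y) <= P1 x * P2 y.
Proof.
move=> hy dx dy c; rewrite -[leRHS]mulr1; apply: ler_wpM2l.
  by rewrite mulr_ge0 ?P1_ge0 ?P2_ge0.
rewrite -[leRHS](expr1n _ m); apply: lerXn2r; rewrite ?nnegrE ?posp_ge0 //.
by apply: posp_le1; rewrite gerBl sqrtr_ge0.
Qed.

Lemma closeness_ge0 x y : 0 < cutoff A d y -> 0 < cc -> 0 <= closeness d A cc x y.
Proof.
by move=> h1 h2; rewrite divr_ge0 ?mulr_ge0 ?expR_ge0 // ltW.
Qed.

Lemma boundary_threshold_first :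
  exists2 i : R, 0 < i & forall x, enorm x <= 3 / 2 -> 0 < d x -> d x <= i -> U1 x <= 0.
Proof.
apply: near_covering_ball => z hz; have hz2 := ball32_lt2 hz.
have [dz|dz|dz] := ltrgtP (d z) 0.
- have /nbhs_enormP[e e0 he] : \forall x \near z, d x < 0 by exact: (cd hz2) (lt_nbhsl dz).
  by exists e => // x i hx _ _ dx; have := he x hx; lra.
- have dz2 : d z / 2 < d z by lra.
  have /nbhs_enormP[e e0 he] : \forall x \near z, d z / 2 < d x by exact: (cd hz2) (lt_nbhsr dz2).
  exists (Num.min e (d z / 2)); first by rewrite lt_min e0 divr_gt0.
  move=> x i; rewrite !lt_min => /andP[hx _] i0 /andP[_ iz] dx di.
  by have := he x hx; lra.
- have /nbhs_enormP[e e0 he] := U1b hz2 dz.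
  by exists e => // x i hx _ _ dx _; exact: he.
Qed.

Lemma first_factor_bounded (i : R) : 0 < i ->
  exists2 b : R, 0 < b & forall x, enorm x <= 3 / 2 -> i <= d x -> P1 x <= b.
Proof.
move=> i0.
(* The bound is sought as [j^-1], which brings the claim into the form required by
   [near_covering_ball], a property of all small [j]. *)
have [j j0 hj] : exists2 j : R, 0 < j & forall x, enorm x <= 3 / 2 -> i <= d x -> P1 x <= j^-1.
  apply: near_covering_ball => z hz; have hz2 := ball32_lt2 hz.
  have [dz|dz] := ltrP (d z) i.
    have /nbhs_enormP[e e0 he] : \forall x \near z, d x < i by exact: (cd hz2) (lt_nbhsl dz).
    by exists e => // x j hx _ _ dx; have := he x hx; lra.
  have dz0 : 0 < d z by apply: lt_le_trans dz.
  have cP : {for z, continuous P1}.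
    by apply: first_factor_continuous; [rewrite gt_eqF|exact: cU1|exact: cd].
  have b0 : 0 < P1 z + 1 by rewrite ltr_wpDl ?P1_ge0.
  have /nbhs_enormP[e e0 he] : \forall x \near z, P1 x < P1 z + 1.
    have b1 : P1 z < P1 z + 1 by rewrite ltrDl.
    exact: cP (lt_nbhsl b1).
  exists (Num.min e (P1 z + 1)^-1); first by rewrite lt_min e0 invr_gt0.
  move=> x j; rewrite !lt_min => /andP[hx _] j0 /andP[_ jz] dx.
  apply: le_trans (ltW (he x hx)) _.
  by rewrite -[leLHS]invrK lef_pV2 ?posrE ?invr_gt0 // ltW.
by exists j^-1; rewrite ?invr_gt0.
Qed.

(** On the diagonal the product is at most 2, because [U1 <= U2] and the exponentials contribute at
    most 2. Continuity, made uniform away from the boundary, leaves room up to 4. *)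
Lemma near_diagonal_le4 (i : R) : 0 < i ->
  exists2 r : R, 0 < r & forall x, enorm x <= 3 / 2 -> i <= d x ->
    forall y, enorm (y - x) < r -> P1 x * P2 y <= 4.
Proof.
move=> i0.
apply: near_covering_ball => z hz; have hz2 := ball32_lt2 hz.
have [dz|dz] := ltrP (d z) i.
  have /nbhs_enormP[e e0 he] : \forall x \near z, d x < i by exact: (cd hz2) (lt_nbhsl dz).
  by exists e => // x j hx _ _ dx; have := he x hx; lra.
have dz0 : 0 < d z by apply: lt_le_trans dz.
have cP1 : {for z, continuous P1}.
  by apply: first_factor_continuous; [rewrite gt_eqF|exact: cU1|exact: cd].
have cP2 : {for z, continuous P2}.
  by apply: second_factor_continuous; [rewrite gt_eqF // U2_gt0|exact: cU2|exact: cd].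
have p1 := P1_ge0 dz0; have p2 := P2_ge0 hz2 dz0; have p12 := diagonal_le2 hz2 dz0.
(* With this [t <= 1] the product [(P1 z + t) * (P2 z + t)] is at most [P1 z * P2 z + 1 <= 3]. *)
pose t := (P1 z + P2 z + 1)^-1.
have s0 : 0 < P1 z + P2 z + 1 by rewrite ltr_wpDl // addr_ge0.
have t0 : 0 < t by rewrite invr_gt0.
have /nbhs_enormP[e1 e10 he1] : \forall x \near z, P1 x < P1 z + t.
  have b1 : P1 z < P1 z + t by rewrite ltrDl.
  exact: cP1 (lt_nbhsl b1).
have /nbhs_enormP[e2 e20 he2] : \forall x \near z, P2 x < P2 z + t.
  have b1 : P2 z < P2 z + t by rewrite ltrDl.
  exact: cP2 (lt_nbhsl b1).
have /nbhs_enormP[e3 e30 he3] : \forall x \near z, 0 < d x by exact: (cd hz2) (lt_nbhsr dz0).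
exists (Num.min e1 (Num.min e3 (e2 / 2))).
  by rewrite !lt_min e10 e30 divr_gt0.
move=> x j; rewrite !lt_min => /andP[hx1 /andP[hx3 hx2]] j0 /andP[_ /andP[_ j2]] dx y yx.
have hy : enorm (y - z) < e2.
  by apply: le_lt_trans (enorm_triangle y x z) _; lra.
have q1 := ltW (he1 x hx1); have q2 := ltW (he2 y hy).
have q0 : 0 <= P1 x := P1_ge0 (he3 x hx3).
apply: (@le_trans _ _ ((P1 z + t) * (P2 z + t))).
  apply: (@le_trans _ _ (P1 x * (P2 z + t))); first exact: ler_wpM2l.
  by apply: ler_wpM2r => //; rewrite addr_ge0 // ltW.
have -> : (P1 z + t) * (P2 z + t) = P1 z * P2 z + t * (P1 z + P2 z + t) by ring.
have t1 : t <= 1 by rewrite /t invf_le1 // lerDr addr_ge0.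
have : t * (P1 z + P2 z + t) <= t * (P1 z + P2 z + 1).
  by apply: ler_wpM2l; [exact: ltW|rewrite lerD2l].
by rewrite /t mulVf ?gt_eqF // -/t; lra.
Qed.

Lemma sg_gt0 : 0 < sg.
Proof. by rewrite sgE invr_gt0; have : (0 : R) <= N%:R by []; lra. Qed.

Lemma cc_gt0 : 0 < cc.
Proof. by rewrite ccE divr_gt0 ?sg_gt0 ?ltr0n. Qed.

Lemma cc_le : cc <= 200^-1.
Proof.
have : sg <= 1.
  by rewrite sgE invf_le1; have : (0 : R) <= N%:R by []; lra.
by rewrite ccE; lra.
Qed.

Lemma distance_le x y : enorm x < 2 -> enorm y < 2 -> 0 < cutoff A d y ->
  closeness d A cc x y < 1 -> enorm (x - y) <= 2 * cc * cutoff A d y.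
Proof.
move=> hx hy e0; have ce : 0 < cc * cutoff A d y by rewrite mulr_gt0 // cc_gt0.
rewrite /closeness ltr_pdivrMr // mul1r => h.
have h2 : expR (A * d x + A * d y) <= 2.
  by apply: expR_half_le2; have := dA hx; have := dA hy; lra.
have p0 := expR_gt0 (A * d x + A * d y).
rewrite -opprD expRN ltr_pdivrMr // in h.
apply: le_trans (ltW h) _.
have -> : 2 * cc * cutoff A d y = (cc * cutoff A d y) * 2 by ring.
by apply: ler_wpM2l => //; exact: ltW.
Qed.

(** A value above 4 keeps the pair away from the boundary, from the zero set of the cutoff and from
    the diagonal. The superlevel set therefore lies in a compact region where logarithms may be
    taken. *)
Lemma coupling_thresholds : exists del tau : R, [/\ 0 < del, 0 < tau &
  forall x y, enorm x <= 3 / 2 -> enorm y <= 3 / 2 -> 0 < d x -> 0 < d y ->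
    0 < cutoff A d y -> 4 < cpl (x, y) ->
  [/\ del < d x /\ del < d y, tau < cutoff A d y, closeness d A cc x y < 1,
      0 < U1 x & x != y]].
Proof.
have [i1 i10 hi1] := boundary_threshold_first.
have [b b0 hb] := first_factor_bounded i10.
have [r r0 hr] := near_diagonal_le4 i10.
have cp := cc_gt0.
(* Closer to the boundary than [i1] the function [U1] is nonpositive; [P2 y <= 2 * d y / c0] forces
   [d y > c0 / b]; and a cutoff of at most [r / (4 * cc)] would bring the points closer than [r],
   where the product is at most 4. *)
exists (Num.min i1 (c0 / b)), (r / (4 * cc)); split.
- by rewrite lt_min i10 divr_gt0.
- by rewrite divr_gt0 // mulr_gt0.
move=> x y hx hy dx dy ey h4.
have hx2 := ball32_lt2 hx; have hy2 := ball32_lt2 hy.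
have u1 : 0 < U1 x.
  apply: posp_gt0; rewrite lt_def posp_ge0 andbT; apply: contraTneq h4 => e.
  by rewrite /cpl /coupling /first_factor /= e !mul0r -leNgt.
have dxi : i1 < d x.
  by rewrite ltNge; apply: contraTN u1 => /(hi1 x hx dx); rewrite leNgt.
have c1 : closeness d A cc x y < 1.
  rewrite ltNge; apply: contraTN h4 => c1.
  rewrite /cpl /coupling /= [posp (1 - _)]posp_neg ?expr0n ?mE ?mulr0 -?leNgt //.
  by rewrite subr_le0 -sqrtr1 ler_wsqrtr.
have cle := coupling_le_factors hy2 dx dy (closeness_ge0 x ey cp).
have hPP : 4 < P1 x * P2 y by apply: lt_le_trans cle.
have hdist : r <= enorm (y - x).
  by rewrite leNgt; apply: contraTN hPP => /(hr x hx (ltW dxi)); rewrite leNgt.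
split=> //.
- split; first by rewrite gt_min dxi.
  rewrite gt_min; apply/orP; right; rewrite ltr_pdivrMr //.
  have h1 : P1 x * P2 y <= b * (d y / c0 * 2).
    have u2 := U2_gt0 hy2 dy.
    apply: ler_pM; [exact: P1_ge0|exact: P2_ge0|exact: hb (ltW dxi)|].
    apply: ler_pM; [by rewrite divr_ge0 ?(ltW dy) ?(ltW u2)|exact: expR_ge0| |].
      by rewrite ler_pM2l // lef_pV2 ?posrE // U2c.
    by apply: expR_half_le2; have := dA hy2; lra.
  have := lt_le_trans hPP h1.
  have -> : b * (d y / c0 * 2) = (2 * (d y * b)) / c0 by field; rewrite gt_eqF.
  by rewrite ltr_pdivlMr //; have := c00; lra.
- have := distance_le hx2 hy2 ey c1; rewrite enormC => h.
  rewrite ltr_pdivrMr ?mulr_gt0 //.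
  have := le_trans hdist h; have : 0 < cutoff A d y * cc by rewrite mulr_gt0.
  lra.
- by apply: contraTneq hdist => ->; rewrite subrr enorm0 -ltNge.
Qed.

Lemma d_taylor x y : enorm x <= 3 / 2 -> enorm y <= 3 / 2 ->
  `|d x - d y - dot (x - y) (Gd y)| <= k / 2 * dot (x - y) (x - y).
Proof.
move=> hx hy.
apply: (@J2_taylor _ _ d Gd Hd [set z | enorm z < 2]) => //.
  have -> : [set z : V | enorm z < 2] = enorm @^-1` [set t | t < 2] by [].
  apply: open_comp; last exact: open_lt.
  by move=> z _; exact: enorm_continuous.
move=> t /andP[t0 t1] z.
have hz : enorm z < 2.
  apply: ball32_lt2; have -> : z = (1 - t) *: y + t *: x.
    by apply/matrixP => i j; rewrite !mxE; ring.
  apply: le_trans (enormD _ _) _; rewrite !enormZ !ger0_norm ?subr_ge0 //.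
  have h1 : (1 - t) * enorm y <= (1 - t) * (3 / 2) by apply: ler_wpM2l; rewrite ?subr_ge0.
  have h2 : t * enorm x <= t * (3 / 2) by apply: ler_wpM2l.
  lra.
by split=> //; exact: dH.
Qed.

(** A value above 4 would produce a maximum over the compact set cut out by the thresholds. The
    thresholds hold strictly at that maximum, so it is interior, and [no_interior_maximum] excludes
    it. *)
Lemma coupling_le4 x0 y0 : enorm x0 <= 3 / 2 -> enorm y0 <= 3 / 2 ->
  0 < d x0 -> 0 < d y0 -> 0 < cutoff A d y0 -> cpl (x0, y0) <= 4.
Proof.
move=> hx0 hy0 dx0 dy0 ey0; rewrite leNgt; apply/negP => h0.
have [del [tau [del0 tau0 thr]]] := coupling_thresholds.
have cp := cc_gt0; have cl := cc_le.
pose B := [set x : V | enorm x <= 3 / 2].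
have cB : compact B := @closed_eball_compact R N (3 / 2).
have hB z : B z -> enorm z < 2 by exact: ball32_lt2.
have cK1 : compact [set p | (B `*` B) p /\ del <= d p.1].
  apply: (@compact_superlevel _ _ (fun p => d p.1)); first exact: compact_setX.
  by move=> [p q] /= [hp _]; apply: cont_fst; apply: cd; exact: hB.
have cK2 : compact [set p | ([set p | (B `*` B) p /\ del <= d p.1]) p /\ del <= d p.2].
  apply: (@compact_superlevel _ _ (fun p => d p.2)) => //.
  by move=> [p q] /= [[_ hq] _]; apply: cont_snd; apply: cd; exact: hB.
have cK3 := @compact_superlevel R _ (fun p => cutoff A d p.2) _ tau cK2.
have {}cK3 : compact [set p | ([set p | ([set p | (B `*` B) p /\ del <= d p.1]) p /\ del <= d p.2]) p /\ tau <= cutoff A d p.2].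
  apply: cK3 => -[p q] /= [[[_ hq] _] _]; apply: (@cont_snd _ _ (cutoff A d)).
  by apply: cutoff_continuous; apply: cd; exact: hB.
have [[t1 t2] t3 t4 t5 t6] := thr _ _ hx0 hy0 dx0 dy0 ey0 h0.
have [] := @compact_max_continuous_at R _ cpl _ (x0, y0) cK3.
- by split; [split; [split; [split|exact: ltW]|exact: ltW]|exact: ltW].
- move=> [p q] /= [[[[hp hq] dp] dq] eq].
  have dp0 : 0 < d p by apply: lt_le_trans dp.
  have dq0 : 0 < d q by apply: lt_le_trans dq.
  apply: coupling_continuous; rewrite ?gt_eqF //; try exact: cd (hB _ _).
  + exact: U2_gt0 (hB _ hq) dq0.
  + by apply: lt_le_trans eq.
  + exact: cU1 (hB _ hp) dp0.
  + exact: cU2 (hB _ hq) dq0.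
move=> [x y] /= [[[[hx hy] dx] dy] ey] hmax.
have h4 : 4 < cpl (x, y).
  apply: lt_le_trans h0 _; apply: hmax.
  by split; [split; [split; [split|exact: ltW]|exact: ltW]|exact: ltW].
have {}dx : 0 < d x by apply: lt_le_trans dx.
have {}dy : 0 < d y by apply: lt_le_trans dy.
have {}ey : 0 < cutoff A d y by apply: lt_le_trans ey.
have [[s1 s2] s3 s4 s5 s6] := thr _ _ hx hy dx dy ey h4.
have hx2 := hB _ hx; have hy2 := hB _ hy.
have dist := distance_le hx2 hy2 ey s4.
have A0 : 0 <= A by rewrite AE; have := k0; lra.
have Ady := dA hy2.
(* A positive cutoff gives [|y| <= 9 / 8], and [|x - y|] is tiny, so both points are interior to the
   ball of radius [3 / 2]. *)
have e54 : cutoff A d y <= 5 / 4.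
  by rewrite /cutoff; have := dot_ge0 y; lra.
have y98 : enorm y <= 9 / 8.
  apply: enorm_le_of_dot; first by lra.
  by move: ey; rewrite /cutoff; lra.
have x32 : enorm x < 3 / 2.
  have h := enorm_le_sub x y.
  have : cc * cutoff A d y <= 200^-1 * (5 / 4) by apply: ler_pM => //; exact: ltW.
  by lra.
have y32 : enorm y < 3 / 2 by lra.
have M0 : m%:R = 12 * (N%:R + 1) :> R by rewrite mE natrM -[N.+1%:R]natr1.
have Tyx := d_taylor hy hx; have Txy := d_taylor hx hy.
have h00 : enorm (0 : V) <= 3 / 2 by rewrite enorm0; lra.
have T0y := d_taylor h00 hy.
have dyx : dot (y - x) (y - x) = dot (x - y) (x - y).
  by rewrite -opprB dotNl dotNr opprK.
have dd0 := dot_ge0 (x - y).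
have kd0 : 0 <= k * dot (x - y) (x - y) by apply: mulr_ge0.
apply: (@no_interior_maximum R N d U1 U2 x y (Gd x) (Gd y) (Hd x) (Hd y)
  (G1 x) (G2 y) (H1 x) (H2 y) k A sg cc m%:R N2 sgE ccE M0 k0 k1 AE s6
  (hd hx2) (hd hy2) (dG hx2) (dG hy2) (dT hx2) (dT hy2) dx dy (dA hx2) Ady).
- move: Tyx => /ler_normlP[q1 q2]; move: q1 q2; rewrite dyx -[y - x]opprB dotNl.
  by lra.
- by move: Txy => /ler_normlP[q1 q2]; lra.
- move: T0y => /ler_normlP[]; rewrite sub0r !dotNl dotNr opprK => q1 q2.
  have : dot y y <= 2 by move: ey; rewrite /cutoff; lra.
  move=> h; have : k * dot y y <= k * 2 by apply: ler_wpM2l.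
  by have := d00; lra.
- exact: hU1.
- exact: s5.
- exact: T1.
- exact: hU2.
- exact: U2_gt0.
- exact: T2.
- exact: ey.
- have ce : 0 < cc * cutoff A d y by rewrite mulr_gt0.
  by move: s4; rewrite closenessE // expR_lt1.
move=> u v.
have [e e0 he] : exists2 e : R, 0 < e & forall x' y' : V, enorm (x' - x) < e ->
    enorm (y' - y) < e -> 4 < cpl (x', y').
  apply: (@near_pair_enorm R N (fun p => 4 < cpl p)).
  have cc' : {for (x, y), continuous cpl}.
    apply: coupling_continuous; rewrite ?gt_eqF //; try exact: cd.
    - exact: U2_gt0.
    - exact: cU1.
    - exact: cU2.
  exact: cc' (lt_nbhsr h4).
have nx : \forall x' \near x, [/\ enorm (x' - x) < e, enorm x' < 3 / 2 & 0 < d x'].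
  near=> x'; split; near: x'.
  - by apply/nbhs_enormP; exists e.
  - exact: enorm_continuous (lt_nbhsl x32).
  - exact: (cd hx2) (lt_nbhsr dx).
have ny : \forall y' \near y, [/\ enorm (y' - y) < e, enorm y' < 3 / 2, 0 < d y' & 0 < cutoff A d y'].
  near=> y'; split; near: y'.
  - by apply/nbhs_enormP; exists e.
  - exact: enorm_continuous (lt_nbhsl y32).
  - exact: (cd hy2) (lt_nbhsr dy).
  - exact: (cutoff_continuous (cd hy2)) (lt_nbhsr ey).
have lx := near_line u nx; have ly := near_line v ny.
near=> t.
have [ax1 ax2 ax3] : [/\ enorm (x + t *: u - x) < e, enorm (x + t *: u) < 3 / 2 & 0 < d (x + t *: u)].
  by near: t.
have [ay1 ay2 ay3 ay4] : [/\ enorm (y + t *: v - y) < e, enorm (y + t *: v) < 3 / 2,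
   0 < d (y + t *: v) & 0 < cutoff A d (y + t *: v)] by near: t.
have h4' := he _ _ ax1 ay1.
have [[w1 w2] w3 w4 w5 w6] := thr _ _ (ltW ax2) (ltW ay2) ax3 ay3 ay4 h4'.
have [g1 <-] := @log_coupling R N d A cc m U1 U2 x y s6 cp ey dx dy s5 (U2_gt0 hy2 dy) s4.
have := @log_coupling R N d A cc m U1 U2 _ _ w6 cp ay4 ax3 ay3 w5
  (U2_gt0 (ball32_lt2 (ltW ay2)) ay3) w4.
rewrite /log_closeness.
have -> : x + t *: u - (y + t *: v) = x - y + t *: (u - v).
  by apply/matrixP => i j; rewrite !mxE; ring.
move=> [g2 <-].
rewrite ler_ln ?posrE //; apply: hmax.
by split; [split; [split; [split; exact: ltW|exact: ltW]|exact: ltW]|exact: ltW].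
Unshelve. all: by end_near. Qed.

End CouplingBound.

(** * Boundary Harnack inequality *)

Section BoundaryHarnack.
Context {R : realType} {N : nat}.
Notation V := 'rV[R]_N.

(** One eighth of [cc]: at this distance from the centre the closeness is at most 1/8, so the
    penalty factor is at least [2 ^- m] with [m = 12 * N.+1]. The factor 4 in [harnack_const] is the
    bound of [coupling_le4]. *)
Definition harnack_radius : R := (2 * N%:R + 2)^-1 / 200 / 8.

Definition harnack_const : R := 4 * 2 ^+ (12 * N.+1).

Lemma harnack_radius_gt0 : 0 < harnack_radius.
Proof. by rewrite !divr_gt0 // invr_gt0; have : (0 : R) <= N%:R by []; lra. Qed.

Lemma harnack_const_ge1 : 1 <= harnack_const.
Proof.
rewrite /harnack_const.
have h : (1 : R) <= 2 ^+ (12 * N.+1) by rewrite exprn_ege1 //; lra.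
lra.
Qed.

Lemma le_of_forall_eps (a b c : R) : 0 <= c ->
  (forall e, 0 < e -> a <= b + e * c) -> a <= b.
Proof.
move=> c0 h; apply/ler_addgt0Pr => e e0.
have c1 : 0 < c + 1 by lra.
apply: le_trans (h (e / (c + 1)) _) _; first by rewrite divr_gt0.
rewrite lerD2l mulrAC ler_pdivrMr // ler_pM2l //; lra.
Qed.

Lemma coupling_lower_bound (d U1 U2 : V -> R) (A cc : R) m (x : V) :
  0 <= A -> 0 < cc -> 0 < d x -> 0 < d 0 -> 0 < U1 x -> 0 < U2 0 ->
  enorm x <= cc / 8 ->
  coupling d A cc m U1 U2 (x, 0) <= 4 ->
  U1 x * d 0 <= 4 * 2 ^+ m * (U2 0 * d x).
Proof.
move=> A0 cc0 dx d0 u1 u2 hx.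
set c := closeness d A cc x 0.
have ct1 : 1 <= cutoff A d 0.
  by rewrite /cutoff dot0l subr0 lerDl mulr_ge0 // ltW.
have c0 : 0 <= c.
  by rewrite divr_ge0 ?mulr_ge0 ?expR_ge0 // ltW //; apply: lt_le_trans ct1.
have c8 : c <= 8^-1.
  rewrite /c /closeness subr0 ler_pdivrMr; last first.
    by rewrite mulr_gt0 //; apply: lt_le_trans ct1.
  apply: (@le_trans _ _ (cc / 8)).
    apply: le_trans hx; rewrite ler_piMr // expR_le1 -opprD oppr_le0.
    by rewrite addr_ge0 // mulr_ge0 // ltW.
  have : cc * 1 <= cc * cutoff A d 0 by apply: ler_wpM2l => //; exact: ltW.
  lra.
have s2 : Num.sqrt c <= 2^-1.
  rewrite -[leRHS]ger0_norm ?invr_ge0 // -sqrtr_sqr ler_wsqrtr //; lra.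
rewrite /coupling /first_factor /second_factor /= -/c !posp_pos ?(ltW u1) //; last by lra.
move=> h.
have p1 : 1 <= expR (A * d x) by rewrite -expR0 ler_expR mulr_ge0 // ltW.
have p2 : 1 <= expR (A * d 0) by rewrite -expR0 ler_expR mulr_ge0 // ltW.
have pm : (2^-1) ^+ m <= (1 - Num.sqrt c) ^+ m.
  by apply: lerXn2r; rewrite ?nnegrE; lra.
have q : U1 x / d x * (d 0 / U2 0) * (2^-1) ^+ m <= 4.
  apply: le_trans h.
  have a1 : 0 <= U1 x / d x by rewrite divr_ge0 // ltW.
  have a2 : 0 <= d 0 / U2 0 by rewrite divr_ge0 // ltW.
  have b1 : U1 x / d x <= U1 x / d x * expR (A * d x) by rewrite ler_peMr.
  have b2 : d 0 / U2 0 <= d 0 / U2 0 * expR (A * d 0) by rewrite ler_peMr.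
  apply: ler_pM; [by rewrite mulr_ge0|by apply: exprn_ge0; rewrite invr_ge0| |by []].
  by apply: ler_pM.
have m0 : (0 : R) < 2 ^+ m by rewrite exprn_gt0.
have -> : U1 x * d 0 = (U1 x / d x * (d 0 / U2 0) * 2^-1 ^+ m) * (2 ^+ m * (U2 0 * d x)).
  by rewrite exprVn; field; rewrite !gt_eqF.
rewrite -[4 * _ * _]mulrA; apply: ler_wpM2r => //.
by rewrite !mulr_ge0 // ltW.
Qed.

(** [V1] is controlled at the boundary only in the limit, and [V2] may vanish. The coupling is
    therefore applied to [V1 - kap * zeta], nonpositive near the boundary, and to [V2 + kap * zeta],
    which is at least [kap]; then [kap] tends to 0. *)
Lemma unit_boundary_harnack (d : V -> R) (Gd : V -> V) (Hd : V -> 'M[R]_N) (k : R)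
    (V1 V2 q : V -> R) (G1 G2 : V -> V) (H1 H2 : V -> 'M[R]_N) :
  (2 <= N)%N -> 0 <= k -> k <= 64^-1 ->
  (forall x, enorm x < 2 -> J2 d x (Gd x) (Hd x)) ->
  (forall x, enorm x < 2 -> {for x, continuous d}) ->
  (forall x, enorm x < 2 -> 4^-1 <= dot (Gd x) (Gd x) <= 4) ->
  (forall x v, enorm x < 2 -> `|dot (v *m Hd x) v| <= k / 2 * dot v v) ->
  (forall x, enorm x < 2 -> `|\tr (Hd x)| <= k) ->
  (forall x, enorm x < 2 -> 32 * k * d x <= 1) ->
  0 < d 0 ->
  (forall x, enorm x < 2 -> 0 < d x -> J2 V1 x (G1 x) (H1 x)) ->
  (forall x, enorm x < 2 -> 0 < d x -> J2 V2 x (G2 x) (H2 x)) ->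
  (forall x, enorm x < 2 -> 0 < d x -> {for x, continuous V1}) ->
  (forall x, enorm x < 2 -> 0 < d x -> {for x, continuous V2}) ->
  (forall x, enorm x < 2 -> 0 < d x -> V1 x <= V2 x) ->
  (forall x, enorm x < 2 -> 0 < d x -> 0 <= V2 x) ->
  (forall x, enorm x < 2 -> 0 < d x -> `|q x| <= 2^-1) ->
  (forall x, enorm x < 2 -> 0 < d x -> q x * V1 x <= \tr (H1 x)) ->
  (forall x, enorm x < 2 -> 0 < d x -> \tr (H2 x) <= q x * V2 x) ->
  (forall z, enorm z < 2 -> d z = 0 -> forall e, 0 < e ->
     \forall x \near z, 0 < d x -> V1 x <= e) ->
  forall x, enorm x <= harnack_radius -> 0 < d x ->
    V1 x * d 0 <= harnack_const * (V2 0 * d x).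
Proof.
move=> N2 k0 k1 hd cd dG dH dT dA d0 hV1 hV2 cV1 cV2 V12 V20 hq T1 T2 bd x hx dx.
have n2 : (2 : R) <= N%:R by rewrite ler_nat.
have C1 := harnack_const_ge1.
have sg1 : (2 * N%:R + 2)^-1 <= (1 : R) by rewrite invf_le1; lra.
have hr1 : harnack_radius <= 1 by rewrite /harnack_radius; lra.
have e02 : enorm (0 : V) < 2 by rewrite enorm0.
apply: (@le_of_forall_eps _ _ (2 * d 0 + harnack_const * (2 * d x))).
  by rewrite addr_ge0 ?mulr_ge0 ?(ltW d0) ?(ltW dx) //; lra.
move=> kap kap0.
(* [zeta] lies between 1 and 2 and has Laplacian [- N / 2 <= - 1]; this compensates the term
   [q * kap * zeta], whose modulus is at most [kap]. *)
pose zeta (y : V) : R := 2 + (- 4^-1) * dot y y.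
have hz y : enorm y < 2 -> 1 <= zeta y <= 2.
  move=> hy; have := dot_ge0 y.
  have : dot y y <= 2 ^+ 2 by rewrite -enorm_sqr ler_sqr ?nnegrE // ltW.
  by rewrite /zeta => h1 h2; apply/andP; split; lra.
have Jz y : J2 zeta y (- 2^-1 *: y) ((- 2^-1)%:M).
  have := J2_add (J2_cst 2 y) (J2_scale (- 4^-1) (J2_sqnorm y)).
  move=> /J2_eq; apply; first by rewrite add0r scalerA; congr (_ *: _); field.
  by rewrite add0r -scalemx1 scalerA scalemx1; congr (_%:M); field.
have cz y : {for y, continuous zeta}.
  by apply: cont_add; [exact: cont_cst|apply: cont_scale; exact: cont_dot].
pose U1 y := V1 y + (- kap) * zeta y; pose U2 y := V2 y + kap * zeta y.
have zk y : enorm y < 2 -> kap <= kap * zeta y <= 2 * kap.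
  move=> /hz/andP[z1 z2]; apply/andP; split; first by rewrite ler_peMr // ltW.
  by rewrite mulrC; apply: ler_wpM2r => //; exact: ltW.
have [z0a z0b] := andP (zk _ e02).
have hx2 : enorm x < 2 by lra.
have [zxa zxb] := andP (zk _ hx2).
have u2 : 0 < U2 0 by rewrite /U2; have := V20 0 e02 d0; lra.
have concl : U1 x * d 0 <= harnack_const * (U2 0 * d x) ->
  V1 x * d 0 <= harnack_const * (V2 0 * d x) +
    kap * (2 * d 0 + harnack_const * (2 * d x)).
  have a1 : kap * zeta x * d 0 <= 2 * kap * d 0 by apply: ler_wpM2r => //; exact: ltW.
  have a2 : harnack_const * (kap * zeta 0 * d x) <= harnack_const * (2 * kap * d x).
    by apply: ler_wpM2l; [lra|apply: ler_wpM2r => //; exact: ltW].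
  rewrite /U1 /U2; lra.
apply: concl.
have [u1|u1] := lerP (U1 x) 0.
  apply: (@le_trans _ _ 0); first by rewrite mulr_le0_ge0 // ltW.
  by rewrite !mulr_ge0 ?(ltW dx) ?(ltW u2) //; lra.
apply: (@coupling_lower_bound d U1 U2 (8 * k) ((2 * N%:R + 2)^-1 / 200) _ x) => //.
  by rewrite mulr_ge0.
have k8 : 8 * k = 8 * k by [].
have dA' y : enorm y < 2 -> 4 * (8 * k) * d y <= 1.
  by move=> /dA; have -> : 4 * (8 * k) * d y = 32 * k * d y by ring.
have hU1 y : enorm y < 2 -> 0 < d y -> J2 U1 y (G1 y + - kap *: (- 2^-1 *: y)) (H1 y + - kap *: (- 2^-1)%:M).
  by move=> h1 h2; apply: J2_add (hV1 y h1 h2) _; exact: J2_scale.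
have hU2 y : enorm y < 2 -> 0 < d y -> J2 U2 y (G2 y + kap *: (- 2^-1 *: y)) (H2 y + kap *: (- 2^-1)%:M).
  by move=> h1 h2; apply: J2_add (hV2 y h1 h2) _; exact: J2_scale.
have cU1 y : enorm y < 2 -> 0 < d y -> {for y, continuous U1}.
  by move=> h1 h2; apply: cont_add; [exact: cV1|exact: cont_scale].
have cU2 y : enorm y < 2 -> 0 < d y -> {for y, continuous U2}.
  by move=> h1 h2; apply: cont_add; [exact: cV2|exact: cont_scale].
have U12 y : enorm y < 2 -> 0 < d y -> U1 y <= U2 y.
  move=> h1 h2; rewrite /U1 /U2; have := V12 y h1 h2; have /andP[] := zk y h1; lra.
have U2c y : enorm y < 2 -> 0 < d y -> kap <= U2 y.
  move=> h1 h2; rewrite /U2; have := V20 y h1 h2; have /andP[] := zk y h1; lra.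
have qz y : enorm y < 2 -> 0 < d y -> - kap <= q y * (kap * zeta y) /\ `|q y| <= 2^-1.
  move=> h1 h2; split; last exact: hq.
  have /andP[z1 z2] := zk y h1.
  have : `|q y * (kap * zeta y)| <= 2^-1 * (2 * kap).
    rewrite normrM; apply: ler_pM => //; first exact: hq.
    by rewrite ger0_norm //; lra.
  by move=> /ler_normlP[]; lra.
have TU1 y : enorm y < 2 -> 0 < d y -> 0 < U1 y ->
    - 2^-1 * U1 y <= \tr (H1 y + - kap *: (- 2^-1)%:M).
  move=> h1 h2 h3; rewrite mxtraceD mxtraceZ mxtrace_scalar -[_ *+ N]mulr_natr.
  have t1 := T1 y h1 h2; have [t2 /ler_normlP[t3 t4]] := qz y h1 h2.
  have t5 : - 2^-1 * U1 y <= q y * U1 y by apply: ler_wpM2r; [exact: ltW|lra].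
  have t6 : kap * 2 <= kap * N%:R by apply: ler_wpM2l => //; exact: ltW.
  have t7 : q y * V1 y = q y * U1 y + q y * (kap * zeta y) by rewrite /U1; ring.
  apply: le_trans t5 _.
  have -> : - kap * (- 2^-1 * N%:R) = 2^-1 * (kap * N%:R) by ring.
  lra.
have TU2 y : enorm y < 2 -> 0 < d y -> \tr (H2 y + kap *: (- 2^-1)%:M) <= 2^-1 * U2 y.
  move=> h1 h2; rewrite mxtraceD mxtraceZ mxtrace_scalar -[_ *+ N]mulr_natr.
  have t1 := T2 y h1 h2; have [t2 /ler_normlP[t3 t4]] := qz y h1 h2.
  have u0 : 0 <= U2 y by apply: le_trans (U2c y h1 h2); exact: ltW.
  have t5 : q y * U2 y <= 2^-1 * U2 y by apply: ler_wpM2r.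
  have t6 : kap * 2 <= kap * N%:R by apply: ler_wpM2l => //; exact: ltW.
  have t7 : q y * V2 y = q y * U2 y - q y * (kap * zeta y) by rewrite /U2; ring.
  apply: le_trans t5.
  have -> : kap * (- 2^-1 * N%:R) = - 2^-1 * (kap * N%:R) by ring.
  lra.
have bU z : enorm z < 2 -> d z = 0 -> \forall y \near z, 0 < d y -> U1 y <= 0.
  move=> h1 h2; have hb := bd z h1 h2 kap kap0.
  have hz2 : \forall y \near z, enorm y < 2 by exact: enorm_continuous (lt_nbhsl h1).
  near=> y => dy.
  have b1 : V1 y <= kap by move: dy; near: y.
  have b2 : enorm y < 2 by near: y.
  by have /andP[] := zk y b2; rewrite /U1; lra.
have ct : 0 < cutoff (8 * k) d 0.
  rewrite /cutoff dot0l subr0 ltr_pwDl // mulr_ge0 ?(ltW d0) // mulr_ge0 //.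
apply: (@coupling_le4 R N d Gd Hd k (8 * k) (2 * N%:R + 2)^-1 _ _ N2 erefl erefl erefl k0 k1 k8
   hd cd dG dH dT dA' d0 U1 U2 _ _ _ _ kap hU1 hU2 cU1 cU2 U12 kap0 U2c TU1 TU2 bU) => //.
  lra.
by rewrite enorm0; lra.
Unshelve. all: by end_near. Qed.

(** The substitution [x = z + r y], with [d] replaced by [d / r], keeps [grad d] and multiplies the
    Hessian of [d] by [r], hence [k = 2 * (K * r)]. The potential acquires the factor [r ^+ 2]. *)
Lemma scaled_boundary_harnack (d : V -> R) (Gd : V -> V) (Hd : V -> 'M[R]_N) (K r : R) (z : V)
    (V1 V2 q : V -> R) (G1 G2 : V -> V) (H1 H2 : V -> 'M[R]_N) :
  (2 <= N)%N -> 0 <= K -> 0 < r -> 128 * (K * r) <= 1 ->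
  let B := [set x | enorm (x - z) < 2 * r] in
  (forall x, B x -> J2 d x (Gd x) (Hd x)) ->
  (forall x, B x -> {for x, continuous d}) ->
  (forall x, B x -> 4^-1 <= dot (Gd x) (Gd x) <= 4) ->
  (forall x v, B x -> `|dot (v *m Hd x) v| <= K * dot v v) ->
  (forall x, B x -> `|\tr (Hd x)| <= K) ->
  (forall x, B x -> 64 * K * d x <= 1) ->
  0 < d z ->
  (forall x, B x -> 0 < d x -> J2 V1 x (G1 x) (H1 x)) ->
  (forall x, B x -> 0 < d x -> J2 V2 x (G2 x) (H2 x)) ->
  (forall x, B x -> 0 < d x -> {for x, continuous V1}) ->
  (forall x, B x -> 0 < d x -> {for x, continuous V2}) ->
  (forall x, B x -> 0 < d x -> V1 x <= V2 x) ->
  (forall x, B x -> 0 < d x -> 0 <= V2 x) ->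
  (forall x, B x -> 0 < d x -> r ^+ 2 * `|q x| <= 2^-1) ->
  (forall x, B x -> 0 < d x -> q x * V1 x <= \tr (H1 x)) ->
  (forall x, B x -> 0 < d x -> \tr (H2 x) <= q x * V2 x) ->
  (forall y, B y -> d y = 0 -> forall e, 0 < e ->
     \forall x \near y, 0 < d x -> V1 x <= e) ->
  forall x, enorm (x - z) <= harnack_radius * r -> 0 < d x ->
    V1 x * d z <= harnack_const * (V2 z * d x).
Proof.
move=> N2 K0 r0 Kr B hd cd dG dH dT dA d0 hV1 hV2 cV1 cV2 V12 V20 hq T1 T2 bd x hx dx.
have rn : r != 0 by rewrite gt_eqF.
pose f (y : V) := z + r *: y.
have cf : continuous f.
  move=> y A /nbhs_enormP[e e0 he]; apply/nbhs_enormP.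
  exists (e / r); first by rewrite divr_gt0.
  move=> w; rewrite ltr_pdivlMr // => hw; apply: he.
  rewrite /f opprD addrACA subrr add0r -scalerBr enormZ gtr0_norm // mulrC.
  exact: hw.
have fB y : enorm y < 2 -> B (f y).
  by move=> hy; rewrite /B /f /= addrC addKr enormZ gtr0_norm // mulrC ltr_pM2r.
have f0 : f 0 = z by rewrite /f scaler0 addr0.
have r2 : 0 <= r ^+ 2 by exact: sqr_ge0.
have ir : 0 < r^-1 by rewrite invr_gt0.
pose df y := r^-1 * d (f y).
have dfp y : (0 < df y) = (0 < d (f y)) by rewrite /df pmulr_rgt0.
have cc y (g : V -> R) : {for f y, continuous g} -> {for y, continuous (fun y => g (f y))}.
  by move=> cg; exact: (@continuous_comp _ _ _ f g y (cf y) cg).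
have fx : f (r^-1 *: (x - z)) = x by rewrite /f scalerA mulfV // scale1r addrC subrK.
have := @unit_boundary_harnack df (fun y => r^-1 *: (r *: Gd (f y)))
  (fun y => r^-1 *: (r ^+ 2 *: Hd (f y))) (2 * (K * r))
  (fun y => V1 (f y)) (fun y => V2 (f y)) (fun y => r ^+ 2 * q (f y))
  (fun y => r *: G1 (f y)) (fun y => r *: G2 (f y))
  (fun y => r ^+ 2 *: H1 (f y)) (fun y => r ^+ 2 *: H2 (f y)) N2.
have Gs y : r^-1 *: (r *: Gd (f y)) = Gd (f y) by rewrite scalerA mulVf // scale1r.
have Hs y : r^-1 *: (r ^+ 2 *: Hd (f y)) = r *: Hd (f y).
  by rewrite scalerA; congr (_ *: _); field.
move=> h.
have {}h : forall y, enorm y <= harnack_radius -> 0 < df y ->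
    V1 (f y) * df 0 <= harnack_const * (V2 (f 0) * df y).
  apply: h.
  - by rewrite !mulr_ge0 // ltW.
  - lra.
  - by move=> y /fB hy; apply: J2_scale; apply: J2_affine; exact: hd.
  - by move=> y /fB hy; apply: cont_scale; apply: cc; exact: cd.
  - by move=> y /fB hy; rewrite Gs; exact: dG.
  - move=> y v /fB hy; rewrite Hs -scalemxAr dotZl normrM gtr0_norm //.
    have -> : 2 * (K * r) / 2 * dot v v = r * (K * dot v v) by field.
    by apply: ler_wpM2l; [exact: ltW|exact: dH].
  - move=> y /fB hy; rewrite Hs mxtraceZ normrM gtr0_norm //.
    apply: (@le_trans _ _ (r * K)); first by apply: ler_wpM2l; [exact: ltW|exact: dT].
    have : 0 <= K * r by rewrite mulr_ge0 // ltW.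
    lra.
  - move=> y /fB hy; have -> : 32 * (2 * (K * r)) * df y = 64 * K * d (f y).
      by rewrite /df; field.
    exact: dA.
  - by rewrite dfp f0.
  - by move=> y /fB hy; rewrite dfp => dy; apply: J2_affine; exact: hV1.
  - by move=> y /fB hy; rewrite dfp => dy; apply: J2_affine; exact: hV2.
  - by move=> y /fB hy; rewrite dfp => dy; apply: cc; exact: cV1.
  - by move=> y /fB hy; rewrite dfp => dy; apply: cc; exact: cV2.
  - by move=> y /fB hy; rewrite dfp; exact: V12.
  - by move=> y /fB hy; rewrite dfp; exact: V20.
  - by move=> y /fB hy; rewrite dfp => dy; rewrite normrM ger0_norm //; exact: hq.
  - move=> y /fB hy; rewrite dfp => dy; rewrite mxtraceZ -mulrA.
    by apply: ler_wpM2l => //; exact: T1.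
  - move=> y /fB hy; rewrite dfp => dy; rewrite mxtraceZ -mulrA.
    by apply: ler_wpM2l => //; exact: T2.
  - move=> y /fB hy dy e e0.
    have dfy : d (f y) = 0.
      by move/eqP: dy; rewrite /df mulf_eq0 invr_eq0 (negbTE rn) => /eqP.
    have hb : \forall w \near y, 0 < d (f w) -> V1 (f w) <= e := cf y _ (bd _ hy dfy e e0).
    by apply: filterS hb => w; rewrite dfp.
have := h (r^-1 *: (x - z)); rewrite fx f0 dfp fx /df fx f0.
rewrite enormZ gtr0_norm // mulrC ler_pdivrMr // => /(_ hx dx) {}h.
rewrite -(ler_pM2l ir).
have -> : r^-1 * (V1 x * d z) = V1 x * (r^-1 * d z) by ring.
by have -> : r^-1 * (harnack_const * (V2 z * d x)) = harnack_const * (V2 z * (r^-1 * d x)) by ring.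
Qed.

End BoundaryHarnack.

(** * Comparison principle and barriers *)

Section Comparison.
Context {R : realType} {N : nat}.
Notation V := 'rV[R]_N.

Lemma J2_sub (f g : V -> R) x u v (H K : 'M[R]_N) : J2 f x u H -> J2 g x v K ->
  J2 (fun y => f y - g y) x (u - v) (H - K).
Proof.
move=> hf hg; have := J2_add hf (J2_scale (-1) hg); rewrite !scaleN1r.
by congr (J2 _ _ _ _); apply/funext => y; rewrite mulN1r.
Qed.

Lemma compact_annulus (r1 r2 : R) :
  compact [set x : V | enorm x <= r2 /\ r1 <= enorm x].
Proof.
apply: (compact_superlevel (f := enorm)); first exact: closed_eball_compact.
by move=> p _; exact: enorm_continuous.
Qed.

Lemma comparison_principle (d S u Z q : V -> R) (GS Gu GZ : V -> V)
    (HS Hu HZ : V -> 'M[R]_N) (R0 r1 r2 C Q c0 : R) :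
  0 < r1 -> r2 < R0 -> 0 < c0 -> 0 <= Q ->
  (forall x, 0 < enorm x < R0 -> {for x, continuous d}) ->
  let A x := r1 <= enorm x <= r2 /\ 0 < d x in
  (forall x, A x -> J2 S x (GS x) (HS x)) ->
  (forall x, A x -> J2 u x (Gu x) (Hu x)) ->
  (forall x, A x -> J2 Z x (GZ x) (HZ x)) ->
  (forall x, A x -> {for x, continuous S}) ->
  (forall x, A x -> {for x, continuous u}) ->
  (forall x, A x -> {for x, continuous Z}) ->
  (forall x, A x -> `|q x| <= Q) ->
  (forall x, A x -> q x * S x <= \tr (HS x)) ->
  (forall x, A x -> \tr (Hu x) <= q x * u x) ->
  (forall x, A x -> 0 < Z x) ->
  (forall x, A x -> \tr (HZ x) <= q x * Z x - c0) ->
  (forall x, A x -> 0 <= u x) ->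
  (forall x, A x -> S x <= C * d x) ->
  (forall x, A x -> enorm x = r1 -> S x <= u x) ->
  (forall x, A x -> enorm x = r2 -> S x <= u x) ->
  forall x, A x -> S x <= u x.
Proof.
move=> r10 r2R c00 Q0 cd A jS ju jZ cS cu cZ hq LS Lu Z0 LZ u0 SC b1 b2 x0 Ax0.
rewrite leNgt; apply/negP => Su0.
(* [Z] may tend to 0 at the boundary; adding [kap] bounds the denominator from below, and
   [kap * Q < c0] keeps [Z + kap] a strict supersolution. *)
pose kap := c0 / (Q + 1).
have Q1 : 0 < Q + 1 by lra.
have kap0 : 0 < kap by rewrite divr_gt0.
have kapQ : kap * Q < c0.
  have -> : kap * Q = c0 - kap by rewrite /kap; field; rewrite gt_eqF.
  lra.
pose f x := (S x - u x) / (Z x + kap).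
have Zk x : A x -> 0 < Z x + kap by move=> /Z0; lra.
have f0 : 0 < f x0 by rewrite divr_gt0 ?Zk // subr_gt0.
have C0 : 0 < C.
  have [_ dx0] := Ax0; have := SC _ Ax0; have := u0 _ Ax0 => h1 h2.
  by rewrite -(pmulr_lgt0 _ dx0); lra.
pose del := f x0 * kap / C.
have del0 : 0 < del by rewrite divr_gt0 // mulr_gt0.
have hdel x : A x -> f x0 <= f x -> del <= d x.
  move=> Ax h; rewrite ler_pdivrMr // mulrC.
  have h1 : f x0 * (Z x + kap) <= S x - u x by rewrite -ler_pdivlMr ?Zk.
  have h2 : 0 <= f x0 * Z x by rewrite mulr_ge0 // ltW // Z0.
  have := SC _ Ax; have := u0 _ Ax; lra.
have cK : compact [set x | (enorm x <= r2 /\ r1 <= enorm x) /\ del <= d x].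
  apply: (compact_superlevel (f := d)); first exact: compact_annulus.
  by move=> p /= [p2 p1]; apply: cd; rewrite (lt_le_trans r10) //= (le_lt_trans p2).
have [/andP[x01 x02] dx0] := Ax0.
have KA p : (enorm p <= r2 /\ r1 <= enorm p) /\ del <= d p -> A p.
  by move=> [[p2 p1] pd]; split; [apply/andP|exact: lt_le_trans pd].
have [||p Kp hmax] := @compact_max_continuous_at R _ f _ x0 cK.
- by split=> //; exact: hdel.
- move=> p /KA Ap; apply: cont_mul; first by apply: cont_sub; [exact: cS|exact: cu].
  apply: cont_inv; first by rewrite gt_eqF ?Zk.
  by apply: cont_add; [exact: cZ|exact: cont_cst].
have Ap := KA _ Kp.
have fp : f x0 <= f p by apply: hmax; split=> //; exact: hdel.
have Sup : u p < S p.
  rewrite ltNge; apply/negP => h; have : f p <= 0.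
    by rewrite mulr_le0_ge0 ?subr_le0 // invr_ge0 ltW // Zk.
  lra.
have [/andP[p1 p2] dp] := Ap.
have p1' : r1 < enorm p.
  by rewrite lt_neqAle p1 andbT; apply: contraTneq Sup => e; rewrite -leNgt b1.
have p2' : enorm p < r2.
  by rewrite lt_neqAle p2 andbT; apply: contraTneq Sup => e; rewrite -leNgt b2.
have pR : 0 < enorm p < R0 by apply/andP; split; lra.
pose M := f p.
have M0 : 0 < M by rewrite /M; lra.
have J := J2_sub (J2_sub (jS _ Ap) (ju _ Ap))
  (J2_scale M (J2_add (jZ _ Ap) (J2_cst kap p))).
have fpE : S p - u p = M * (Z p + kap) by rewrite /M /f mulfVK // gt_eqF ?Zk.
have := J2_local_max J _.
case/(_ _)/Wrap => [|hT].
  rewrite /= fpE subrr.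
  near=> y.
  have Ay : A y.
    split; last by near: y; exact: (cd _ pR) (lt_nbhsr dp).
    apply/andP; split; apply: ltW; near: y.
      exact: enorm_continuous (lt_nbhsr p1').
    exact: enorm_continuous (lt_nbhsl p2').
  rewrite subr_le0 -ler_pdivrMr ?Zk // -/(f y).
  have [h|h] := lerP (f x0) (f y); last by apply: ltW; apply: lt_le_trans fp.
  by apply: hmax; have [/andP[y1 y2] dy] := Ay; split=> //; exact: hdel.
move: hT; rewrite !mxtraceD !linearN /= mxtraceZ mxtraceD mxtrace0 addr0 => hT.
have := ler_wpM2l (ltW M0) (LZ _ Ap).
have := LS _ Ap; have := Lu _ Ap; have := hq _ Ap => /ler_normlP[q1 q2].
have e1 : q p * S p - q p * u p = q p * (M * (Z p + kap)) by rewrite -fpE; ring.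
have e2 : M * kap * - q p <= M * kap * Q.
  by apply: ler_wpM2l => //; rewrite mulr_ge0 // ltW.
have e3 : M * (kap * Q) < M * c0 by rewrite ltr_pM2l.
lra.
Unshelve. all: by end_near. Qed.

End Comparison.

(** * Laplacians of products of [d] with radial functions *)

Section Barriers.
Context {R : realType} {N : nat}.
Notation V := 'rV[R]_N.
Implicit Types (x : V) (d f : V -> R).

Definition lap f x (l : R) :=
  exists gH : V * 'M[R]_N, J2 f x gH.1 gH.2 /\ \tr gH.2 = l.

Lemma lap_eq f x l l' : lap f x l -> l = l' -> lap f x l'.
Proof. by move=> h <-. Qed.

Lemma lap_add f f' x l l' : lap f x l -> lap f' x l' -> lap (fun y => f y + f' y) x (l + l').
Proof.
move=> [[g H] /= [h <-]] [[g' H'] /= [h' <-]].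
by exists (g + g', H + H'); split; [exact: J2_add|rewrite mxtraceD].
Qed.

Lemma lap_scale c f x l : lap f x l -> lap (fun y => c * f y) x (c * l).
Proof.
move=> [[g H] /= [h <-]].
by exists (c *: g, c *: H); split; [exact: J2_scale|rewrite mxtraceZ].
Qed.

Lemma lap_sub f f' x l l' : lap f x l -> lap f' x l' -> lap (fun y => f y - f' y) x (l - l').
Proof.
move=> [[g H] /= [h <-]] [[g' H'] /= [h' <-]].
by exists (g - g', H - H'); split; [exact: J2_sub|rewrite linearB].
Qed.

Lemma lap_jets f (A : set V) (L : V -> R) : (forall x, A x -> lap f x (L x)) ->
  exists (G : V -> V) (H : V -> 'M[R]_N), forall x, A x ->
    J2 f x (G x) (H x) /\ \tr (H x) = L x.
Proof.
move=> h.
have : forall x, exists gH : V * 'M[R]_N, A x -> J2 f x gH.1 gH.2 /\ \tr gH.2 = L x.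
  move=> x; have [Ax|nAx] := pselect (A x); last by exists (0, 0).
  by have [gH hgH] := h x Ax; exists gH.
by move=> /choice[F hF]; exists (fun x => (F x).1), (fun x => (F x).2).
Qed.

(** For a linear [d] one has [\tr H = 0] and [dot x G = d x], and the right-hand side becomes
    [d x * (g2 + N%:R * g1) / dot x x]. This is the source of the exponent equation
    [mu = p ^+ 2 + N p]. *)
Lemma lap_radial d (g : R -> R) x (G : V) (H : 'M[R]_N) g1 g2 :
  x != 0 -> J2 d x G H -> D2 g (lognorm x) g1 g2 ->
  lap (fun y => d y * g (lognorm y)) x
    (\tr H * g (lognorm x) + (d x * (g1 * (N%:R - 2) + g2) + 2 * g1 * dot x G) / dot x x).
Proof.
move=> x0 hd hg; have n0 := lt0r_neq0 (dot_gt0 x0).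
have J := J2_mul hd (J2_comp (J2_lognorm x0) hg).
eexists (_, _); split; first exact: J.
rewrite /= !mxtraceD !mxtraceZ mxtraceD !mxtraceZ !tr_outer linearB /= mxtraceZ mxtrace1.
rewrite tr_outer !dotE [dot G x]dotC; field; exact: n0.
Qed.

Lemma lap_sqr_radial d (g : R -> R) x (G : V) (H : 'M[R]_N) g1 g2 :
  x != 0 -> J2 d x G H -> D2 g (lognorm x) g1 g2 ->
  lap (fun y => d y * d y * g (lognorm y)) x
    ((2 * dot G G + 2 * d x * \tr H) * g (lognorm x) +
     (d x ^+ 2 * (g1 * (N%:R - 2) + g2) + 4 * d x * g1 * dot x G) / dot x x).
Proof.
move=> x0 hd hg; have n0 := lt0r_neq0 (dot_gt0 x0).
have := lap_radial x0 (J2_mul hd hd) hg => /lap_eq; apply.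
rewrite !mxtraceD !mxtraceZ !tr_outer !dotE; field; exact: n0.
Qed.

Lemma D2_exp_linear (p t : R) :
  D2 (fun t => expR (p * t)) t (p * expR (p * t)) (p ^+ 2 * expR (p * t)).
Proof.
have h := D2_comp (D2_affine 0 p t) (D2_expR _).
have e : (fun t0 => expR (0 + t0 * p)) = (fun t => expR (p * t)).
  by apply/funext => r; rewrite add0r mulrC.
by rewrite e add0r [t * p]mulrC in h; apply: (D2_eq h); ring.
Qed.

Lemma D2_id_exp_linear (p t : R) :
  D2 (fun t => - t * expR (p * t)) t (- (1 + p * t) * expR (p * t))
    (- (2 * p + p ^+ 2 * t) * expR (p * t)).
Proof.
have h := D2_mul (D2_affine 0 (-1) t) (D2_exp_linear p t).
have e : (fun t0 => (0 + t0 * -1) * expR (p * t0)) = (fun t => - t * expR (p * t)).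
  by apply/funext => r; rewrite add0r mulrN1.
by rewrite e in h; apply: (D2_eq h); ring.
Qed.

(* The sign condition [0 < X] says that [|x|^p' d] is a strict super- (or sub-)
   solution in a half space; the term [- A d^2] absorbs the curvature of the
   boundary, where [d] is small. *)
Lemma barrier_estimate (n mu p p' s X A K c0 sg D t w2 G2 r th E xG : R) :
  0 < r -> 0 < E -> 0 <= n -> 0 <= K -> K * r <= 1 -> 0 < A ->
  X = sg * (mu - p' ^+ 2 - n * p') -> s = p' - 1 ->
  c0 * (mu - p ^+ 2 - n * p) = 0 -> 0 <= c0 <= 1 -> -1 <= sg <= 1 ->
  A * (2 * (`|s| * (n + 2) + s ^+ 2) + 12 * `|s| + 2 * `|mu| + 2) <= X ->
  0 <= D <= 2 -> `|t| <= K -> `|w2| <= K -> 3 / 4 <= G2 ->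
  0 <= th -> r <= th -> 
  th * (K * (2 + 2 * `|p| + 2 * `|p'|)) <= A / 2 ->
  xG = D * r + w2 * r ^+ 2 ->
  c0 * (t * (th * E) + (D * r * (p * (th * E) * (n - 2) + p ^+ 2 * (th * E)) + 2 * (p * (th * E)) * xG) / r ^+ 2)
  + sg * (t * (r * E) + (D * r * (p' * (r * E) * (n - 2) + p' ^+ 2 * (r * E)) + 2 * (p' * (r * E)) * xG) / r ^+ 2)
  - A * ((2 * G2 + 2 * (D * r) * t) * E +
      ((D * r) ^+ 2 * (s * E * (n - 2) + s ^+ 2 * E) + 4 * (D * r) * (s * E) * xG) / r ^+ 2)
  <= mu / r ^+ 2 * (c0 * (D * r * (th * E)) + sg * (D * r * (r * E)) - A * ((D * r) * (D * r) * E))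
     - A * E.
Proof.
move=> r0 E0 n0 K0 Kr A0 XE sE c0E c01 sg1 AX D2' tK wK G34 th0 rth hth xGE.
have rn : r != 0 by rewrite gt_eqF.
rewrite -subr_ge0.
set lhs := (X in 0 <= X).
have c0E' : c0 * mu = c0 * (p ^+ 2 + n * p) by lra.
(* The last line collects the leading part of the [c0] term and vanishes by [c0E]. Of the rest,
   [X * D] pays for the losses proportional to [A * D], while [2 * A * G2 >= 3 / 2 * A] pays for [A]
   and for the errors of size [th]. *)
have -> : lhs = E * (- (c0 * th * (t + 2 * p * w2)) + X * D - sg * r * (t + 2 * p' * w2)
   + A * (2 * G2 + 2 * D * r * t + D ^+ 2 * (s * (n - 2) + s ^+ 2)
      + 4 * s * D * (D + w2 * r) - mu * D ^+ 2) - A)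
   + (c0 * mu - c0 * (p ^+ 2 + n * p)) * (D * th * E / r).
  by rewrite /lhs xGE XE; field.
rewrite c0E' subrr mul0r addr0; apply: mulr_ge0; first exact: ltW.
have [/andP[c00 c011] /andP[sgl sgr] /andP[D0 DD2]] := And3 c01 sg1 D2'.
have ap : 0 <= `|p| := normr_ge0 p; have ap' : 0 <= `|p'| := normr_ge0 p'.
have as' : 0 <= `|s| := normr_ge0 s; have am : 0 <= `|mu| := normr_ge0 mu.
have e1 (v : R) : `|t + 2 * v * w2| <= K * (1 + 2 * `|v|).
  apply: le_trans (ler_normD _ _) _; rewrite !normrM ger0_norm //.
  have : `|v| * `|w2| <= `|v| * K by apply: ler_wpM2l.
  lra.
have f1 : c0 * th * (t + 2 * p * w2) <= th * (K * (1 + 2 * `|p|)).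
  apply: le_trans (ler_norm _) _; rewrite normrM ger0_norm ?mulr_ge0 //.
  by apply: ler_pM; rewrite ?mulr_ge0 // ler_piMl.
have f2 : sg * r * (t + 2 * p' * w2) <= th * (K * (1 + 2 * `|p'|)).
  apply: le_trans (ler_norm _) _; rewrite normrM [`|sg * r|]normrM (gtr0_norm r0).
  apply: ler_pM; rewrite ?mulr_ge0 ?(ltW r0) //.
  by apply: le_trans rth; rewrite ler_piMl ?(ltW r0) // ler_norml sgr andbT; clear -sgl; lra.
have wr : `|w2 * r| <= 1.
  rewrite normrM (gtr0_norm r0); apply: le_trans Kr; apply: ler_wpM2r => //; exact: ltW.
have g1 : - (2 * D) <= 2 * D * r * t.
  have : `|2 * D * r * t| <= 2 * D * 1.
    rewrite -[2 * D * r * t]mulrA normrM ger0_norm ?mulr_ge0 //.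
    apply: ler_wpM2l; first by rewrite mulr_ge0.
    rewrite normrM (gtr0_norm r0) mulrC; apply: le_trans Kr.
    by apply: ler_wpM2r => //; exact: ltW.
  by rewrite mulr1 => /lerNnormlW.
have DD : D ^+ 2 <= 2 * D by rewrite expr2; apply: ler_wpM2r.
have D20 : 0 <= D ^+ 2 := sqr_ge0 D.
have g2 : - (D * (2 * (`|s| * (n + 2) + s ^+ 2))) <= D ^+ 2 * (s * (n - 2) + s ^+ 2).
  have : `|D ^+ 2 * (s * (n - 2) + s ^+ 2)| <= 2 * D * (`|s| * (n + 2) + s ^+ 2).
    rewrite normrM (ger0_norm D20); apply: ler_pM => //.
    apply: le_trans (ler_normD _ _) _; rewrite normrM (ger0_norm (sqr_ge0 s)) lerD2r.
    by apply: ler_wpM2l => //; rewrite ler_norml; apply/andP; clear -n0; split; lra.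
  by move=> /lerNnormlW; rewrite [2 * D]mulrC -mulrA.
have g3 : - (D * (12 * `|s|)) <= 4 * s * D * (D + w2 * r).
  have : `|4 * s * D * (D + w2 * r)| <= (4 * `|s| * D) * 3.
    rewrite normrM; apply: ler_pM => //.
      by rewrite !normrM (ger0_norm D0) ger0_norm.
    by apply: le_trans (ler_normD _ _) _; rewrite (ger0_norm D0); clear -wr DD2; lra.
  have -> : D * (12 * `|s|) = 4 * `|s| * D * 3 by ring.
  exact: lerNnormlW.
have g4 : mu * D ^+ 2 <= D * (2 * `|mu|).
  apply: le_trans (ler_norm _) _; rewrite normrM (ger0_norm D20).
  have : `|mu| * D ^+ 2 <= `|mu| * (2 * D) by apply: ler_wpM2l.
  lra.
have h1 : D * (A * (2 * (`|s| * (n + 2) + s ^+ 2) + 12 * `|s| + 2 * `|mu| + 2)) <= D * X.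
  by apply: ler_wpM2l.
have h2 : A * (3 / 2 - D * (2 * (`|s| * (n + 2) + s ^+ 2) + 12 * `|s| + 2 * `|mu| + 2)) <=
  A * (2 * G2 + 2 * D * r * t + D ^+ 2 * (s * (n - 2) + s ^+ 2)
      + 4 * s * D * (D + w2 * r) - mu * D ^+ 2).
  by apply: ler_wpM2l; [exact: ltW|clear -G34 g1 g2 g3 g4; lra].
clear -f1 f2 h1 h2 hth; lra.
Qed.

(* [d g(ln |x|)] with [g] in the kernel of the half space operator. *)
Lemma radial_defect (n mu g g1 g2 D t w r2 K : R) : 0 < r2 ->
  mu * g - g2 - n * g1 = 0 -> `|t| <= K -> `|w| <= K * r2 ->
  `|t * g + (D * (g1 * (n - 2) + g2) + 2 * g1 * (D + w)) / r2 - mu / r2 * (D * g)|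
  <= K * (`|g| + 2 * `|g1|).
Proof.
move=> r0 hg tK wK.
have -> : t * g + (D * (g1 * (n - 2) + g2) + 2 * g1 * (D + w)) / r2 - mu / r2 * (D * g) =
  t * g + 2 * g1 * (w / r2) - (mu * g - g2 - n * g1) * (D / r2).
  by field; rewrite gt_eqF.
rewrite hg mul0r subr0; apply: le_trans (ler_normD _ _) _; rewrite !normrM normr_nat.
have h1 : `|t| * `|g| <= K * `|g| by apply: ler_wpM2r.
have h2 : `|w| * `|r2^-1| <= K.
  have -> : `|r2^-1| = r2^-1 by apply: gtr0_norm; rewrite invr_gt0.
  by rewrite ler_pdivrMr.
have h3 : `|g1| * (`|w| * `|r2^-1|) <= `|g1| * K by apply: ler_wpM2l.
lra.
Qed.

End Barriers.

Section BarrierFunctions.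
Context {R : realType} {N : nat}.
Notation V := 'rV[R]_N.
Implicit Types (x : V) (d f : V -> R).

(** For [mu > mu1] it is used with [c0 = 0], [sg = 1]. In the critical case every exponent other
    than [p] has the sign of a subsolution, so [c0 = 1], [sg = -1] is used: [d |x|^p] keeps the
    function positive and is still [o(h)] thanks to the logarithm in [h]. *)
Definition barrier d (c0 sg A p p' : R) (y : V) : R :=
  c0 * (d y * expR (p * lognorm y)) + sg * (d y * expR (p' * lognorm y))
  - A * (d y * d y * expR ((p' - 1) * lognorm y)).

Definition barrier_constant (mu p' : R) : R :=
  2 * (`|p' - 1| * (N%:R + 2) + (p' - 1) ^+ 2) + 12 * `|p' - 1| + 2 * `|mu| + 2.

Lemma barrier_lap d x (G : V) (H : 'M[R]_N) (K mu p p' be A c0 sg : R) :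
  x != 0 -> J2 d x G H -> 0 <= K -> K * enorm x <= 1 -> 0 < A ->
  c0 * (mu - p ^+ 2 - N%:R * p) = 0 -> 0 <= c0 <= 1 -> -1 <= sg <= 1 ->
  A * barrier_constant mu p' <= sg * (mu - p' ^+ 2 - N%:R * p') ->
  p' = p + be -> 0 <= be -> lognorm x <= 0 ->
  0 < d x <= 2 * enorm x -> `|\tr H| <= K -> 3 / 4 <= dot G G ->
  `|dot x G - d x| <= K * dot x x ->
  expR ((1 - be) * lognorm x) * (K * (2 + 2 * `|p| + 2 * `|p'|)) <= A / 2 ->
  exists l, lap (barrier d c0 sg A p p') x l /\
    l <= mu / dot x x * barrier d c0 sg A p p' x - A * expR ((p' - 1) * lognorm x).
Proof.
move=> x0 hd K0 Kr A0 c0E c01 sg1 AX p'E be0 lam0 /andP[dx0 dx2] tK G34 wK hth.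
set s := p' - 1; set lam := lognorm x in lam0 hth *.
have hlap := lap_sub (lap_add (lap_scale c0 (lap_radial x0 hd (D2_exp_linear p lam)))
   (lap_scale sg (lap_radial x0 hd (D2_exp_linear p' lam))))
   (lap_scale A (lap_sqr_radial x0 hd (D2_exp_linear s lam))).
eexists; split; first exact: hlap.
set r := enorm x in Kr dx2 *.
have r0 : 0 < r by rewrite enorm_gt0.
have r2 : dot x x = r ^+ 2 by rewrite enorm_sqr.
have rE : r = expR lam by rewrite /lam lognormE // lnK.
set E := expR (s * lam).
have E0 : 0 < E by exact: expR_gt0.
set th := expR ((1 - be) * lam) in hth.
have eE1 : expR (p * lam) = th * E.
  by rewrite -expRD; congr expR; rewrite /s p'E; ring.
have eE2 : expR (p' * lam) = r * E.
  by rewrite rE -expRD; congr expR; rewrite /s; ring.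
have rth : r <= th.
  rewrite rE ler_expR mulrBl mul1r lerDl oppr_ge0; exact: mulr_ge0_le0.
pose D := d x / r.
have dE : d x = D * r by rewrite /D mulfVK // gt_eqF.
have D02 : 0 <= D <= 2 by rewrite divr_ge0 ?(ltW dx0) ?(ltW r0) //= ler_pdivrMr.
clearbody D; pose w2 := (dot x G - d x) / r ^+ 2.
have w2K : `|w2| <= K.
  rewrite normrM normfV (ger0_norm (sqr_ge0 r)) ler_pdivrMr ?exprn_gt0 //.
  by rewrite -r2.
have xGE : dot x G = D * r + w2 * r ^+ 2.
  by rewrite /w2 mulfVK ?expf_neq0 ?gt_eqF // -dE addrC subrK.
have AX' : A * (2 * (`|s| * (N%:R + 2) + s ^+ 2) + 12 * `|s| + 2 * `|mu| + 2) <=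
  sg * (mu - p' ^+ 2 - N%:R * p') by exact: AX.
have n0 : (0 : R) <= N%:R by [].
have := barrier_estimate r0 E0 n0 K0 Kr A0 erefl erefl c0E c01 sg1 AX' D02 tK w2K G34
  (expR_ge0 _) rth hth xGE.
rewrite /barrier -/lam eE1 eE2 -/s -/E r2 dE.
exact.
Qed.

Lemma profile_lap d x (G : V) (H : 'M[R]_N) (K mu : R) (g : R -> R) g1 g2 :
  x != 0 -> J2 d x G H -> `|\tr H| <= K -> `|dot x G - d x| <= K * dot x x ->
  D2 g (lognorm x) g1 g2 -> mu * g (lognorm x) - g2 - N%:R * g1 = 0 ->
  exists l, lap (fun y => d y * g (lognorm y)) x l /\
    `|l - mu / dot x x * (d x * g (lognorm x))| <= K * (`|g (lognorm x)| + 2 * `|g1|).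
Proof.
move=> x0 hd tK wK hg hE; eexists; split; first exact: lap_radial x0 hd hg.
have := radial_defect (d x) (dot_gt0 x0) hE tK wK.
by rewrite [d x + _]addrC subrK.
Qed.

(** The smaller root of [p ^+ 2 + N p = mu]; it equals [alpha_minus N mu - 1]. *)
Definition critical_exponent (mu : R) : R :=
  - (N%:R / 2) - Num.sqrt (mu + N%:R ^+ 2 / 4).

(** The radial factor of [h] in the variable [t = ln |x|]; the factor [- t] appears when the two
    roots of the exponent equation coincide. *)
Definition main_profile (mu t : R) : R :=
  (if mu == mu1 N then - t else 1) * expR (critical_exponent mu * t).

Lemma critical_exponentE (mu : R) : mu1 N <= mu ->
  mu - critical_exponent mu ^+ 2 - N%:R * critical_exponent mu = 0.
Proof.
rewrite /mu1 /critical_exponent => h.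
have h2 : 0 <= mu + N%:R ^+ 2 / 4 by lra.
have := sqr_sqrtr h2; move: (Num.sqrt _) => s hs.
have -> : mu = s ^+ 2 - N%:R ^+ 2 / 4 by rewrite hs; ring.
by field.
Qed.

Lemma main_profile_gt0 (mu t : R) : t < 0 -> 0 < main_profile mu t.
Proof. by move=> t0; rewrite mulr_gt0 ?expR_gt0 //; case: ifP => // _; lra. Qed.

(** Serves the annuli of the Harnack chain, where radii differ by a factor of at most 4 and their
    logarithms by at most 2. With [t < - 4] the logarithmic factor at most doubles. *)
Lemma main_profile_doubling (mu : R) : exists2 C : R, 1 <= C &
  forall t t', t < - 4 -> `|t' - t| <= 2 -> main_profile mu t' <= C * main_profile mu t.
Proof.
set p := critical_exponent mu.
exists (2 * expR (2 * `|p|)).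
  have : 1 <= expR (2 * `|p|) by rewrite -expR0 ler_expR mulr_ge0.
  lra.
move=> t t' t4 /ler_normlP[h1 h2].
have e1 : expR (p * t') <= expR (2 * `|p|) * expR (p * t).
  rewrite -expRD ler_expR -lerBlDr -mulrBr; apply: le_trans (ler_norm _) _.
  rewrite normrM mulrC; apply: ler_wpM2r => //; rewrite ler_norml; apply/andP; split; lra.
have e2 : (if mu == mu1 N then - t' else 1) <= 2 * (if mu == mu1 N then - t else 1).
  by case: ifP => _; lra.
rewrite /main_profile -/p.
have -> : 2 * expR (2 * `|p|) * ((if mu == mu1 N then - t else 1) * expR (p * t)) =
  (2 * (if mu == mu1 N then - t else 1)) * (expR (2 * `|p|) * expR (p * t)) by ring.
by apply: ler_pM; rewrite ?expR_ge0 //; case: ifP => _; lra.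
Qed.

Lemma le_exp_quarter (t : R) : - t <= 4 * expR (- (t / 4)).
Proof. by have := expR_ge1Dx (- (t / 4)); lra. Qed.

(** The defect of [h] is of order [|x|^p], possibly with a logarithm, whereas the corrector gains
    [|x|^(p + be - 1)]. Since [be <= 1/2], half a power of [|x|] is to spare: one quarter absorbs
    the logarithm, the other remains as a small factor. *)
Lemma main_profile_lap d x (G : V) (H : 'M[R]_N) (K mu be : R) :
  x != 0 -> J2 d x G H -> 0 <= K -> `|\tr H| <= K -> `|dot x G - d x| <= K * dot x x ->
  mu1 N <= mu -> lognorm x <= 0 -> 0 <= be <= 2^-1 ->
  let p := critical_exponent mu in
  exists l, lap (fun y => d y * main_profile mu (lognorm y)) x l /\
    `|l - mu / dot x x * (d x * main_profile mu (lognorm x))| <=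
    K * (6 + 8 * `|p|) * (expR (4^-1 * lognorm x) * expR ((p + be - 1) * lognorm x)).
Proof.
move=> x0 hd K0 tK wK hmu lam0 /andP[be0 be2] p.
set lam := lognorm x in lam0 *.
have pE := critical_exponentE hmu; rewrite -/p in pE.
have ap : 0 <= `|p| := normr_ge0 p.
have Ep0 : 0 < expR (p * lam) by exact: expR_gt0.
have q4 : 0 < expR (4^-1 * lam) by exact: expR_gt0.
have q4' : expR (4^-1 * lam) <= 1 by rewrite expR_le1 pmulr_rle0.
have EpE : expR (p * lam) <= expR (2^-1 * lam) * expR ((p + be - 1) * lam).
  rewrite -expRD ler_expR.
  have -> : 2^-1 * lam + (p + be - 1) * lam = p * lam + (2^-1 - be) * - lam by field.
  by rewrite lerDl; apply: mulr_ge0; lra.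
have q2 : expR (2^-1 * lam) = expR (4^-1 * lam) * expR (4^-1 * lam).
  by rewrite -expRD; congr expR; field.
set F := expR ((p + be - 1) * lam) in EpE *.
have F0 : 0 < F by exact: expR_gt0.
have EpE' : expR (p * lam) <= expR (4^-1 * lam) * F.
  apply: le_trans EpE _; apply: ler_wpM2r; first exact: ltW.
  by rewrite q2 ler_piMl // ltW.
have [mu1E|mu1N] := eqVneq mu (mu1 N).
  have -> : main_profile mu = (fun t => - t * expR (p * t)).
    by apply/funext => t; rewrite /main_profile mu1E eqxx -mu1E.
  have s0 : p = - (N%:R / 2).
    by rewrite /p /critical_exponent mu1E /mu1 mulNr addNr sqrtr0 subr0.
  have hk : mu * (- lam * expR (p * lam)) - - (2 * p + p ^+ 2 * lam) * expR (p * lam)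
     - N%:R * (- (1 + p * lam) * expR (p * lam)) = 0.
    have -> : mu = p ^+ 2 + N%:R * p by lra.
    by rewrite s0; field.
  have [l [hl hb]] := profile_lap x0 hd tK wK (D2_id_exp_linear p lam) hk.
  exists l; split=> //; apply: le_trans hb _; rewrite -/lam -mulrA.
  apply: ler_wpM2l => //.
  have lq : - lam * expR (4^-1 * lam) <= 4.
    have := ler_wpM2r (ltW q4) (le_exp_quarter lam).
    have -> : 4 * expR (- (lam / 4)) * expR (4^-1 * lam) = 4.
      rewrite -mulrA -expRD (_ : - (lam / 4) + _ = 0) ?expR0 ?mulr1 //.
      by field.
    by [].
  have lE : - lam * expR (p * lam) <= 4 * (expR (4^-1 * lam) * F).
    apply: (@le_trans _ _ (- lam * (expR (2^-1 * lam) * F))).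
      by apply: ler_wpM2l => //; lra.
    rewrite q2.
    have -> : - lam * (expR (4^-1 * lam) * expR (4^-1 * lam) * F) =
      (- lam * expR (4^-1 * lam)) * (expR (4^-1 * lam) * F) by ring.
    by apply: ler_wpM2r => //; rewrite mulr_ge0 // ltW.
  have b1 : `|- lam * expR (p * lam)| = - lam * expR (p * lam).
    by rewrite ger0_norm // mulr_ge0 ?(ltW Ep0) //; lra.
  have b2 : `|- (1 + p * lam) * expR (p * lam)| <= expR (p * lam) + `|p| * (- lam * expR (p * lam)).
    rewrite normrM normrN (gtr0_norm Ep0).
    have : `|1 + p * lam| <= 1 + `|p| * - lam.
      apply: le_trans (ler_normD _ _) _; rewrite normr1 normrM lerD2l.
      by rewrite (ler0_norm lam0).
    move=> /(ler_wpM2r (ltW Ep0)) /le_trans; apply.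
    by rewrite le_eqVlt; apply/orP; left; apply/eqP; ring.
  have b3 : `|p| * (- lam * expR (p * lam)) <= `|p| * (4 * (expR (4^-1 * lam) * F)).
    by apply: ler_wpM2l.
  rewrite b1; lra.
have -> : main_profile mu = (fun t => expR (p * t)).
  by apply/funext => t; rewrite /main_profile (negbTE mu1N) mul1r.
have hk : mu * expR (p * lam) - p ^+ 2 * expR (p * lam) - N%:R * (p * expR (p * lam)) = 0.
  have -> : mu = p ^+ 2 + N%:R * p by lra.
  by ring.
have [l [hl hb]] := profile_lap x0 hd tK wK (D2_exp_linear p lam) hk.
exists l; split=> //; apply: le_trans hb _; rewrite -/lam -mulrA.
apply: ler_wpM2l => //; rewrite normrM (gtr0_norm Ep0).
have : `|p| * expR (p * lam) <= `|p| * (expR (4^-1 * lam) * F) by apply: ler_wpM2l.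
have : 0 <= expR (4^-1 * lam) * F by rewrite mulr_ge0 // ltW.
have : 0 <= `|p| * (expR (4^-1 * lam) * F) by rewrite mulr_ge0 // mulr_ge0 // ltW.
lra.
Qed.

End BarrierFunctions.

(** * Defining functions of the boundary *)

Section Collar.
Context {R : realType} {N : nat}.
Notation V := 'rV[R]_N.
Implicit Types (x y v : V) (H : 'M[R]_N).

Lemma cont_sum (T : topologicalType) (I : Type) (s : seq I) (F : I -> T -> R) (p : T) :
  (forall i, {for p, continuous (F i)}) ->
  {for p, continuous (fun q : T => \sum_(i <- s) F i q)}.
Proof.
move=> cF; elim: s => [|i s IH].
  have -> : (fun q : T => \sum_(i <- [::]) F i q) = (fun=> 0).
    by apply/funext => q; rewrite big_nil.
  exact: cont_cst.
have -> : (fun q : T => \sum_(j <- i :: s) F j q) = (fun q : T => F i q + \sum_(j <- s) F j q).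
  by apply/funext => q; rewrite big_cons.
exact: cont_add.
Qed.

Definition entry_sum H : R := \sum_i \sum_j `|H i j|.

Lemma tr_le_entry_sum H : `|\tr H| <= entry_sum H.
Proof.
apply: le_trans (ler_norm_sum _ _ _) _; apply: ler_sum => i _.
by rewrite (bigD1 i) //= lerDl sumr_ge0.
Qed.

Lemma quad_le_entry_sum H v : `|dot (v *m H) v| <= entry_sum H * dot v v.
Proof.
have -> : dot (v *m H) v = \sum_i \sum_j v ord0 i * H i j * v ord0 j.
  rewrite exchange_big; apply: eq_bigr => j _; rewrite mxE mulr_suml.
  by apply: eq_bigr => i _.
apply: le_trans (ler_norm_sum _ _ _) _; rewrite mulr_suml; apply: ler_sum => i _.
apply: le_trans (ler_norm_sum _ _ _) _; rewrite mulr_suml; apply: ler_sum => j _.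
rewrite !normrM [`|_| * `|H i j|]mulrC -mulrA -enorm_sqr expr2.
by apply: ler_wpM2l => //; apply: ler_pM => //; exact: coord_le_enorm.
Qed.

Record collar (d : V -> R) (G : V -> V) (H : V -> 'M[R]_N) (r K : R) (nu : V) : Prop := {
  collar_radius : 0 < r;
  collar_const_ge0 : 0 <= K;
  collar_small : 512 * (K * r) <= 1;
  collar_normal : dot nu nu = 1;
  collar_jet x : enorm x < r -> J2 d x (G x) (H x);
  collar_continuous x : enorm x < r -> {for x, continuous d};
  collar_grad x : enorm x < r -> 3 / 4 <= dot (G x) (G x) <= 4;
  collar_grad_normal x : enorm x < r -> 2^-1 <= dot (G x) nu;
  collar_hess x v : enorm x < r -> `|dot (v *m H x) v| <= K * dot v v;
  collar_trace x : enorm x < r -> `|\tr (H x)| <= K;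
  collar_linear x : enorm x < r -> `|d x - dot x nu| <= K * dot x x;
  collar_euler x : enorm x < r -> `|dot x (G x) - d x| <= K * dot x x;
  collar_le x : enorm x < r -> d x <= 2 * enorm x;
  collar_grad_near e : 0 < e -> exists2 s, 0 < s <= r &
    forall x, enorm x < s -> enorm (G x - nu) <= e }.

Lemma collar_rotate d (G : V -> V) (H : V -> 'M[R]_N) r K nu (Q : 'M[R]_N) : Q *m Q^T = 1%:M ->
  collar d G H r K nu ->
  collar (fun x => d (x *m Q)) (fun x => G (x *m Q) *m Q^T)
    (fun x => Q *m H (x *m Q) *m Q^T) r K (nu *m Q^T).
Proof.
move=> QQ c; have QQ' : Q^T *m Q = 1%:M by apply: mulmx1C.
have dq x y : dot (x *m Q^T) (y *m Q^T) = dot x y.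
  by rewrite dot_mulmx trmxK -mulmxA QQ' mulmx1.
have dx x y : dot x (y *m Q^T) = dot (x *m Q) y by rewrite dot_mulmx.
have dxx x y : dot (x *m Q) (y *m Q) = dot x y by rewrite dot_mulmx -mulmxA QQ mulmx1.
have nq x : enorm (x *m Q) = enorm x by rewrite !enormE dxx.
split.
- exact: collar_radius c.
- exact: collar_const_ge0 c.
- exact: collar_small c.
- by rewrite dq; exact: collar_normal c.
- by move=> x hx; apply: J2_linear; apply: (collar_jet c); rewrite nq.
- move=> x hx; have cq : continuous (fun y : V => y *m Q).
    move=> y A /nbhs_enormP[e e0 he]; apply/nbhs_enormP; exists e => // z hz.
    by apply: he; rewrite /= -mulmxBl nq.
  apply: (@continuous_comp _ _ _ (fun y : V => y *m Q) d); first exact: cq.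
  by apply: (collar_continuous c); rewrite nq.
- by move=> x; rewrite dq -{1}nq; exact: (collar_grad c).
- by move=> x; rewrite dq -{1}nq; exact: (collar_grad_normal c).
- move=> x v; rewrite -nq !mulmxA dot_mulmx trmxK -{1}(dxx v v); exact: (collar_hess c).
- by move=> x; rewrite -nq mxtrace_mulC mulmxA QQ' mul1mx; exact: (collar_trace c).
- by move=> x; rewrite dx -{1}nq -{1}(dxx x x); exact: (collar_linear c).
- by move=> x; rewrite dx -{1}nq -{1}(dxx x x); exact: (collar_euler c).
- by move=> x; rewrite -nq; exact: (collar_le c).
- move=> e e0; have [s hs h] := collar_grad_near c e0; exists s => // x hx.
  rewrite -mulmxBl enormE dq -enormE; apply: h; by rewrite nq.
Qed.

Lemma small_multiple (c K : R) : 0 < c -> 0 <= K -> exists2 q, 0 < q & c * (K * q) <= 1.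
Proof.
move=> c0 K0; have K1 : 0 < K + 1 by lra.
exists (c * (K + 1))^-1; first by rewrite invr_gt0 mulr_gt0.
rewrite mulrA ler_pdivrMr ?mulr_gt0 // mul1r; apply: ler_wpM2l; first exact: ltW.
by rewrite lerDl.
Qed.

(** Continuity of the jet at the origin fixes the radius: the absolute values of the Hessian entries
    keep a sum of at most [K], and the gradient stays within 1/8 of [nu], which gives the bounds
    [3 / 4], [4] and [1 / 2]. *)
Lemma collar_of_jets d (G : V -> V) (H : V -> 'M[R]_N) :
  (forall x, J2 d x (G x) (H x)) -> (forall x, {for x, continuous d}) ->
  (forall i, {for 0, continuous (fun x => G x ord0 i)}) ->
  (forall i j, {for 0, continuous (fun x => H x i j)}) ->
  d 0 = 0 -> dot (G 0) (G 0) = 1 ->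
  exists r K, collar d G H r K (G 0).
Proof.
move=> hd cd cG cH d0 G01; set nu := G 0.
have n1 : enorm nu = 1 by rewrite enormE G01 sqrtr1.
pose K := entry_sum (H 0) + 1.
have K0 : 0 <= K by rewrite addr_ge0 // sumr_ge0 // => i _; rewrite sumr_ge0.
have cS : {for 0, continuous (fun x => entry_sum (H x))}.
  by apply: cont_sum => i; apply: cont_sum => j; exact: (cvg_norm (@cH i j)).
have cD : {for 0, continuous (fun x => dot (G x - nu) (G x - nu))}.
  have -> : (fun x => dot (G x - nu) (G x - nu)) =
      (fun x => \sum_i (G x ord0 i - nu ord0 i) * (G x ord0 i - nu ord0 i)).
    by apply/funext => x; apply: eq_bigr => i _; rewrite !mxE.
  apply: cont_sum => i; apply: cont_mul; apply: cont_sub => //; exact: cont_cst.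
have /nbhs_enormP[r1 r10 h1] : \forall x \near (0 : V), entry_sum (H x) < K.
  have e : entry_sum (H 0) < K by rewrite /K ltrDl.
  exact: (cS _ (lt_nbhsl e)).
have hG e : 0 < e -> exists2 s, 0 < s & forall x, enorm x < s -> enorm (G x - nu) <= e.
  move=> e0; have /nbhs_enormP[s s0 h] : \forall x \near (0 : V), dot (G x - nu) (G x - nu) < e ^+ 2.
    have h : dot (G 0 - nu) (G 0 - nu) < e ^+ 2 by rewrite subrr dot0l exprn_gt0.
    exact: (cD _ (lt_nbhsl h)).
  exists s => // x hx; rewrite -ler_sqr ?nnegrE ?(ltW e0) // enorm_sqr.
  by apply: ltW; apply: h; rewrite subr0.
have [|r2 r20 h2] := hG 8^-1; first by rewrite invr_gt0.
have [q q0 Kq] := small_multiple (ltr0n R 512) K0.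
pose r := Num.min r1 (Num.min r2 q).
have r0 : 0 < r by rewrite !lt_min r10 r20.
have Kr : 512 * (K * r) <= 1.
  have rq : K * r <= K * q by apply: ler_wpM2l; rewrite ?K0 // !ge_min lexx !orbT.
  exact: le_trans (ler_wpM2l (ler0n R 512) rq) Kq.
have rr1 x : enorm x < r -> entry_sum (H x) <= K.
  by rewrite lt_min => /andP[hx _]; apply: ltW; apply: h1; rewrite subr0.
have Gn x : enorm x < r -> enorm (G x - nu) <= 8^-1.
  by rewrite !lt_min => /and3P[_ hx _]; exact: h2.
have quad x v : enorm x < r -> `|dot (v *m H x) v| <= K * dot v v.
  move=> hx; apply: le_trans (quad_le_entry_sum _ _) _.
  by apply: ler_wpM2r; [exact: dot_ge0|exact: rr1].
have seg x t : enorm x < r -> 0 <= t <= 1 -> enorm (t *: x) < r.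
  move=> hx /andP[t0 t1]; apply: le_lt_trans hx; rewrite enormZ ger0_norm //.
  by rewrite ler_piMl.
have oT : open [set: V] by exact: openT.
have lin x : enorm x < r -> `|d x - dot x nu| <= K * dot x x.
  move=> hx; have := @J2_taylor _ _ d G H setT x 0 (K * dot x x) oT (fun z _ => hd z).
  rewrite d0 !subr0; apply=> t t01; rewrite /= add0r; split=> //.
  by apply: quad; exact: seg.
have eul x : enorm x < r -> `|dot x (G x) - d x| <= K * dot x x.
  move=> hx; have := @J2_taylor _ _ d G H setT 0 x (K * dot x x) oT (fun z _ => hd z).
  rewrite d0 !sub0r dotNl opprK [- d x + _]addrC; apply=> t /andP[t0 t1] /=; split=> //.
  rewrite mulNmx dotNl dotNr opprK; apply: quad.
  have -> : x + t *: - x = (1 - t) *: x by rewrite scalerN scalerBl scale1r.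
  by apply: seg; rewrite // subr_ge0 t1 gerBl.
have dnu x : enorm x < r -> `|dot (G x - nu) nu| <= 8^-1.
  move=> hx; apply: le_trans (cauchy_schwarz _ _) _; rewrite n1 mulr1; exact: Gn.
exists r, K; split=> //.
- move=> x hx; have g1 := enorm_le_sub (G x) nu; have g2 := enorm_le_sub nu (G x).
  rewrite n1 (enormC nu) in g1 g2; have g3 := Gn x hx.
  have a1 : 7 / 8 <= enorm (G x) by lra.
  have a2 : enorm (G x) <= 9 / 8 by lra.
  rewrite -enorm_sqr expr2; move: (enorm (G x)) a1 a2 => e a1 a2.
  by apply/andP; split; nra.
- move=> x hx; have /ler_normlP[a1 a2] := dnu x hx.
  by move: a1; rewrite dotDl dotNl G01; lra.
- by move=> x hx; apply: le_trans (tr_le_entry_sum _) _; exact: rr1.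
- move=> x hx; have /ler_normlP[_ a1] := lin x hx.
  have a2 := dot_le x nu; rewrite n1 mulr1 in a2.
  have e0 := enorm_ge0 x.
  have a3 : K * dot x x <= 1 * enorm x.
    rewrite -enorm_sqr expr2 mulrA; apply: ler_wpM2r => //.
    have : K * enorm x <= K * r by apply: ler_wpM2l => //; exact: ltW.
    lra.
  lra.
- move=> e e0; have [s s0 h] := hG e e0.
  exists (Num.min s r); first by rewrite lt_min s0 r0 ge_min lexx orbT.
  by move=> x; rewrite lt_min => /andP[hx _]; exact: h.
Qed.

End Collar.

(** * Construction of the corrector *)

Section BarrierExistence.
Context {R : realType} {N : nat}.
Notation V := 'rV[R]_N.
Implicit Types x y : V.

Lemma shifted_exponent (mu be : R) : mu1 N <= mu ->
  let p := critical_exponent (N := N) mu in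
  mu - (p + be) ^+ 2 - N%:R * (p + be) =
  be * (2 * Num.sqrt (mu + N%:R ^+ 2 / 4) - be).
Proof.
move=> hmu p; have := critical_exponentE hmu; rewrite -/p => pE.
have -> : mu - (p + be) ^+ 2 - N%:R * (p + be) =
  (mu - p ^+ 2 - N%:R * p) + be * (- 2 * p - N%:R - be) by ring.
rewrite pE add0r; have -> // : - 2 * p - N%:R = 2 * Num.sqrt (mu + N%:R ^+ 2 / 4).
by rewrite /p /critical_exponent; field.
Qed.

(* [Z] is small compared with [h = d * main_profile], and both corrections [h + Z] and
   [h - Z] have a signed defect, although [h] itself has none. *)
Record barriers (d : V -> R) (mu : R) (Z : V -> R) (gz : R -> R) (lh lZ : V -> R)
    (a b rs : R) : Prop := {
  barriers_gt0 : 0 < a;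
  barriers_radius : 0 < rs;
  barriers_small e : 0 < e ->
    exists t0, forall t, t < t0 -> gz t <= e * main_profile (N := N) mu t;
  barriers_profile_gt0 t : 0 < gz t;
  barriers_lap_main x : 0 < enorm x < rs -> 0 < d x ->
    lap (fun y => d y * main_profile (N := N) mu (lognorm y)) x (lh x);
  barriers_lap x : 0 < enorm x < rs -> 0 < d x -> lap Z x (lZ x);
  barriers_continuous x : 0 < enorm x < rs -> 0 < d x -> {for x, continuous Z};
  barriers_between x : 0 < enorm x < rs -> 0 < d x ->
    2^-1 * (d x * gz (lognorm x)) <= Z x <= d x * gz (lognorm x);
  barriers_supersolution x : 0 < enorm x < rs -> 0 < d x ->
    lh x + lZ x <= mu / dot x x * (d x * main_profile (N := N) mu (lognorm x) + Z x);
  barriers_subsolution x : 0 < enorm x < rs -> 0 < d x ->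
    mu / dot x x * (d x * main_profile (N := N) mu (lognorm x) - Z x) <= lh x - lZ x;
  barriers_strict x : 0 < enorm x < rs -> 0 < d x ->
    lZ x <= mu / dot x x * Z x - a * expR (b * lognorm x);
  barriers_lognorm x : 0 < enorm x < rs -> 0 < d x -> lognorm x < 0 }.

Lemma barrier_signs (q hx zx l lz E : R) :
  `|l - q * hx| <= E -> lz <= q * zx - E ->
  l + lz <= q * (hx + zx) /\ q * (hx - zx) <= l - lz.
Proof. by move=> /ler_normlP[h1 h2] h3; split; lra. Qed.

Lemma choice_in (P : V -> Prop) (Q : V -> R -> Prop) :
  (forall x, P x -> exists l, Q x l) -> exists L, forall x, P x -> Q x (L x).
Proof.
move=> h; have /choice[L hL] : forall x, exists l, P x -> Q x l; last by exists L.
move=> x; have [Px|nPx] := pselect (P x); last by exists 0.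
by have [l hl] := h x Px; exists l.
Qed.

(** For [|x| < ep ^+ 4] every power of [|x|] with exponent at least 1/4 is at most [ep]. *)
Lemma log_small (ep lam be : R) : 0 < ep <= 3^-1 -> 0 < be <= 2^-1 -> lam < 4 * ln ep ->
  [/\ lam < 0, expR (4^-1 * lam) <= ep, expR lam <= ep, expR ((1 - be) * lam) <= ep &
      expR (2^-1 * lam) <= ep].
Proof.
move=> /andP[e0 e3] /andP[b0 b2] h.
have ln0 : ln ep < 0 by apply: ln_lt0; rewrite e0 /=; lra.
have l0 : lam < 0 by lra.
have hs (s : R) : 4^-1 <= s -> expR (s * lam) <= ep.
  move=> s4; rewrite -[leRHS](lnK (x := ep)) ?posrE // ler_expR.
  apply: (@le_trans _ _ (4^-1 * lam)); last lra.
  by rewrite ler_nM2r.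
split=> //; [exact: hs| |apply: hs; lra|apply: hs; lra].
by rewrite -[lam]mul1r; apply: hs; lra.
Qed.

Lemma barrier_between (crit : bool) (E1 E2 W : R) :
  0 < E1 -> 0 < E2 -> 0 <= W <= 2^-1 * E2 -> (crit -> E2 <= 3^-1 * E1) ->
  2^-1 * (if crit then E1 else E2) <=
    (if crit then 1 else 0) * E1 + (if crit then -1 else 1) * E2 - W <=
    (if crit then E1 else E2).
Proof.
move=> E10 E20 /andP[W0 W2]; case: crit => h; last by apply/andP; split; lra.
by have h3 := h isT; apply/andP; split; lra.
Qed.

(** By [shifted_exponent] the sign is that of [2 * s0 - be], where [s0] is the square root in the
    critical exponent: positive for [be <= s0], negative for [s0 = 0], which is the critical case.
    The bound [1/2] on [be] is the room needed by [main_profile_lap]. *)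
Lemma barrier_exponent_gain (mu : R) : mu1 N <= mu ->
  let crit := mu == mu1 N in
  let p := critical_exponent (N := N) mu in
  exists be : R, [/\ 0 < be <= 2^-1, crit -> be = 2^-1 &
    0 < (if crit then -1 else 1) * (mu - (p + be) ^+ 2 - N%:R * (p + be))].
Proof.
move=> hmu crit p.
have hs0 : 0 <= mu + N%:R ^+ 2 / 4 by move: hmu; rewrite /mu1; lra.
set s0 := Num.sqrt (mu + N%:R ^+ 2 / 4).
have s00 : 0 <= s0 by exact: sqrtr_ge0.
have s0E : crit = (s0 == 0).
  rewrite /crit /s0 sqrtr_eq0 /mu1; apply/eqP/idP => [->|h0]; first by lra.
  by move: h0 hs0; lra.
have [s0z|s0n] := eqVneq s0 0; rewrite s0E ?s0z ?eqxx ?(negbTE s0n).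
  exists 2^-1; split; [by rewrite lexx invr_gt0 ltr0n|by []|].
  by rewrite shifted_exponent // -/s0 s0z; lra.
have s0p : 0 < s0 by rewrite lt_def s0n.
exists (Num.min 2^-1 s0); split; [by rewrite lt_min s0p invr_gt0 ltr0n ge_min lexx|by []|].
rewrite shifted_exponent // -/s0 mul1r mulr_gt0 //; first by rewrite lt_min s0p invr_gt0 ltr0n.
have : Num.min 2^-1 s0 <= s0 by rewrite ge_min lexx orbT.
lra.
Qed.

Lemma barrier_small_constants (A K ap ap' : R) : 0 < A -> A <= 4^-1 -> 0 <= K -> 0 <= ap -> 0 <= ap' ->
  exists2 ep, 0 < ep <= 3^-1 & [/\ K * ep <= 1, ep * (K * (2 + 2 * ap + 2 * ap')) <= A / 2 &
    K * (6 + 8 * ap) * ep <= A].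
Proof.
move=> A0 A4 K0 a0 a0'.
pose C := K * (8 + 8 * ap + 2 * ap').
have C0 : 0 <= C by rewrite mulr_ge0 //; lra.
have C1 : 0 < 2 * (C + 1) by lra.
pose ep := Num.min 3^-1 (A / (2 * (C + 1))).
have ep0 : 0 < ep by rewrite lt_min invr_gt0 ltr0n divr_gt0.
have h : ep * C <= A / 2.
  have h1 : ep * (2 * (C + 1)) <= A by rewrite -ler_pdivlMr // ge_min lexx orbT.
  lra.
have le_C t : t <= 8 + 8 * ap + 2 * ap' -> ep * (K * t) <= ep * C.
  by move=> ht; apply: ler_wpM2l; [exact: ltW|apply: ler_wpM2l].
exists ep; first by rewrite ep0 ge_min lexx.
split.
- by rewrite -[K]mulr1 mulrC; apply: le_trans (le_C 1 _) _; lra.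
- by apply: le_trans (le_C _ _) h; lra.
- by rewrite mulrC; apply: le_trans (le_C _ _) _; lra.
Qed.

Lemma barriers_exist (d : V -> R) (G : V -> V) (H : V -> 'M[R]_N) (r K mu : R) (nu : V) :
  collar d G H r K nu -> mu1 N <= mu ->
  exists (Z : V -> R) (gz : R -> R) (lh lZ : V -> R) (a b rs : R),
    rs <= r /\ barriers d mu Z gz lh lZ a b rs.
Proof.
move=> c hmu.
set p := critical_exponent (N := N) mu.
have pE := critical_exponentE hmu; rewrite -/p in pE.
have [be [be02 be_crit]] := barrier_exponent_gain hmu.
move: be_crit; rewrite -/p; set crit := mu == mu1 N => be_crit X0.
have [be0 be2] := andP be02.
pose c0 : R := if crit then 1 else 0.
pose sg : R := if crit then -1 else 1.
have c0E : c0 * (mu - p ^+ 2 - N%:R * p) = 0 by rewrite pE mulr0.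
have c01 : 0 <= c0 <= 1 by rewrite /c0; case: (crit); rewrite ?lexx ?ler01.
have sg1 : -1 <= sg <= 1 by rewrite /sg; case: (crit); rewrite lexx ?andbT; lra.
pose p' := p + be.
pose X := sg * (mu - p' ^+ 2 - N%:R * p').
(* The leading radial factor of [Z / d]: the first term of the barrier in the critical case, the
   second one otherwise. *)
pose gz t := if crit then expR (p * t) else expR (p' * t).
pose C := barrier_constant (N := N) mu p'.
have C0 : 0 < C.
  have a1 : 0 <= `|p' - 1| * (N%:R + 2) by apply: mulr_ge0 => //; apply: addr_ge0.
  have a2 := sqr_ge0 (p' - 1); have a3 := normr_ge0 mu; have a4 := normr_ge0 (p' - 1).
  by rewrite /C /barrier_constant; lra.
(* [X / C] is what [barrier_lap] allows; [1/4] makes the quadratic term at most half of [d |x|^p'],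
   as [d <= 2 |x|]. *)
pose A := Num.min 4^-1 (X / C).
have A0 : 0 < A by rewrite lt_min invr_gt0 ltr0n divr_gt0.
have A4 : A <= 4^-1 by rewrite ge_min lexx.
have AX : A * C <= X by rewrite -ler_pdivlMr // ge_min lexx orbT.
have K0 := collar_const_ge0 c.
have [ep ep03 [Kep epK epK']] :=
  barrier_small_constants A0 A4 K0 (normr_ge0 p) (normr_ge0 p').
have [ep0 ep3] := andP ep03.
pose h y := d y * main_profile (N := N) mu (lognorm y).
pose Z := barrier d c0 sg A p p'.
pose rs := Num.min r (expR (4 * ln ep)).
pose P x := 0 < enorm x < rs /\ 0 < d x.
have rs0 : 0 < rs by rewrite lt_min (collar_radius c) expR_gt0.
have PR x : P x -> [/\ x != 0, enorm x < r & 0 < d x <= 2 * enorm x].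
  move=> [/andP[x0 xr] dx]; have xR : enorm x < r by apply: lt_le_trans xr _; rewrite ge_min lexx.
  by split=> //; [rewrite -enorm_gt0|rewrite dx (collar_le c)].
have rE x : x != 0 -> enorm x = expR (lognorm x).
  by move=> x0; rewrite lognormE // lnK // posrE enorm_gt0.
have lam4 x : P x -> lognorm x < 4 * ln ep.
  move=> Px; have [x0 _ _] := PR x Px; rewrite -ltr_expR -rE //.
  by case: Px => /andP[_ xr] _; apply: lt_le_trans xr _; rewrite ge_min lexx orbT.
have hl x (Px : P x) := log_small ep03 be02 (lam4 x Px).
have hh x : P x -> exists l, lap h x l /\
    `|l - mu / dot x x * h x| <= A * expR ((p' - 1) * lognorm x).
  move=> Px; have [x0 xR _] := PR x Px; have [l0 l4 _ _ _] := hl x Px.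
  have b02 : 0 <= be <= 2^-1 by rewrite (ltW be0).
  have [l [h1 h2]] := main_profile_lap x0 (collar_jet c xR) K0 (collar_trace c xR)
    (collar_euler c xR) hmu (ltW l0) b02.
  exists l; split=> //; apply: le_trans h2 _; rewrite -/p -/p' mulrA.
  apply: ler_wpM2r; first exact: expR_ge0.
  apply: le_trans epK'; apply: ler_wpM2l; last exact: l4.
  by apply: mulr_ge0; [exact: K0|apply: addr_ge0 => //; exact: mulr_ge0].
have hZ x : P x -> exists l, lap Z x l /\
    l <= mu / dot x x * Z x - A * expR ((p' - 1) * lognorm x).
  move=> Px; have [x0 xR dx] := PR x Px; have [l0 l4 l1 lb _] := hl x Px.
  have Kr : K * enorm x <= 1.
    by apply: le_trans Kep; apply: ler_wpM2l => //; rewrite rE.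
  have hth : expR ((1 - be) * lognorm x) * (K * (2 + 2 * `|p| + 2 * `|p'|)) <= A / 2.
    apply: le_trans epK; apply: ler_wpM2r => //.
    by rewrite mulr_ge0 // !addr_ge0 // mulr_ge0.
  have /andP[G34 _] := collar_grad c xR.
  exact: (barrier_lap x0 (collar_jet c xR) K0 Kr A0 c0E c01 sg1 AX erefl (ltW be0) (ltW l0)
    dx (collar_trace c xR) G34 (collar_euler c xR) hth).
have [lh hlh] := choice_in hh; have [lZ hlZ] := choice_in hZ.
exists Z, gz, lh, lZ, A, (p' - 1), rs; split; first by rewrite ge_min lexx.
have sgn x (Px : P x) : lh x + lZ x <= mu / dot x x * (h x + Z x) /\
    mu / dot x x * (h x - Z x) <= lh x - lZ x.
  have [_ a1] := hlh x Px; have [_ a2] := hlZ x Px; exact: barrier_signs a1 a2.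
split.
- exact: A0.
- exact: rs0.
- move=> e e0; rewrite /gz /main_profile -/crit -/p; case: (crit).
    exists (- e^-1) => t ht; rewrite mulrA.
    have : 1 <= e * - t by rewrite -ler_pdivrMl // mulr1 lerNr ltW.
    by move=> /(ler_wpM2r (expR_ge0 (p * t))); rewrite mul1r.
  exists (ln e / be) => t ht; rewrite mul1r /p' mulrDl expRD mulrC.
  apply: ler_wpM2r; first exact: expR_ge0.
  rewrite -[leRHS](lnK (x := e)) ?posrE // ler_expR mulrC -ler_pdivlMr //.
  exact: ltW.
- by move=> t; rewrite /gz; case: (crit); exact: expR_gt0.
- by move=> x hx dx; have [] := hlh x (conj hx dx).
- by move=> x hx dx; have [] := hlZ x (conj hx dx).
- move=> x hx dx; have [x0 xR _] := PR x (conj hx dx).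
  have cl : {for x, continuous (@lognorm R N)}.
    apply: cont_scale; apply: cont_comp; first exact: cont_dot.
    by apply: continuous_ln; exact: dot_gt0.
  have ce s : {for x, continuous (fun y : V => expR (s * lognorm y))}.
    by apply: cont_exp; exact: cont_scale.
  have cdx := collar_continuous c xR.
  apply: cont_sub; last by apply: cont_scale; apply: cont_mul; [exact: cont_mul|exact: ce].
  by apply: cont_add; apply: cont_scale; apply: cont_mul => //; exact: ce.
- move=> x hx dx0; have Px : P x := conj hx dx0.
  have [x0 xR /andP[_ d2]] := PR x Px; have [_ _ _ _ l2] := hl x Px.
  set lam := lognorm x in l2 *.
  have eE2 : expR (p' * lam) = enorm x * expR ((p' - 1) * lam).
    by rewrite rE // -expRD; congr expR; rewrite -/lam; ring.
  have ZE : Z x = d x * (c0 * expR (p * lam) + sg * expR (p' * lam)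
              - A * d x * expR ((p' - 1) * lam)).
    by rewrite /Z /barrier -/lam; ring.
  have W1 : 0 <= A * d x * expR ((p' - 1) * lam).
    by apply: mulr_ge0; [apply: mulr_ge0; exact: ltW|exact: expR_ge0].
  have W2 : A * d x * expR ((p' - 1) * lam) <= 2^-1 * expR (p' * lam).
    rewrite eE2 [leRHS]mulrA; apply: ler_wpM2r; first exact: expR_ge0.
    apply: (@le_trans _ _ (4^-1 * (2 * enorm x))).
      by apply: ler_pM => //; exact: ltW.
    by move: (enorm x) (enorm_ge0 x); clear => q q0; lra.
  have hcr : crit -> expR (p' * lam) <= 3^-1 * expR (p * lam).
    move=> hc; rewrite /p' mulrDl expRD mulrC; apply: ler_wpM2r; first exact: expR_ge0.
    by apply: le_trans ep3; rewrite be_crit.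
  have W12 : 0 <= A * d x * expR ((p' - 1) * lam) <= 2^-1 * expR (p' * lam) by rewrite W1.
  have /andP[z1 z2] := barrier_between (expR_gt0 _) (expR_gt0 _) W12 hcr.
  rewrite ZE mulrCA; apply/andP; split; apply: ler_wpM2l; rewrite ?(ltW dx0) //.
- by move=> x hx dx; have [] := sgn x (conj hx dx).
- by move=> x hx dx; have [] := sgn x (conj hx dx).
- by move=> x hx dx; have [] := hlZ x (conj hx dx).
- by move=> x hx dx; have [] := hl x (conj hx dx).
Qed.

End BarrierExistence.

(** * Limit of the quotient *)

Section HarnackChain.
Context {R : realType} {N : nat}.
Notation V := 'rV[R]_N.
Implicit Types x y z : V.

(** The last fraction [1 / n.+1] of the segment is one Harnack step; the remaining part has length
    at most [n%:R * del]. *)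
Lemma harnack_chain (f : V -> R) (A : set V) (C E del : R) (n : nat) x y :
  1 <= C -> 0 <= E ->
  (forall z x, A z -> A x -> enorm (x - z) <= del -> f x <= C * f z + E) ->
  (forall t, 0 <= t <= 1 -> A (y + t *: (x - y))) ->
  enorm (x - y) <= n%:R * del ->
  f x <= C ^+ n * (f y + n%:R * E).
Proof.
move=> C1 E0 hf; elim: n x => [|n IH] x hA hn.
  have -> : x = y.
    apply/eqP; rewrite -subr_eq0 -enorm_eq0 eq_le enorm_ge0 andbT.
    by move: hn; rewrite mul0r.
  by rewrite expr0 mul1r mul0r addr0.
pose s : R := n%:R / n.+1%:R; pose x' := y + s *: (x - y).
have n10 : (0 : R) < n.+1%:R by rewrite ltr0n.
have s01 : 0 <= s <= 1 by rewrite divr_ge0 //= ler_pdivrMr // mul1r ler_nat.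
have e1 : x' - y = s *: (x - y) by rewrite /x' addrC addKr.
have e2 : x - x' = n.+1%:R^-1 *: (x - y).
  have -> : n.+1%:R^-1 = 1 - s by rewrite /s -natr1; field; rewrite natr1 gt_eqF.
  by rewrite /x'; apply/matrixP => i j; rewrite !mxE; ring.
have h1 : f x' <= C ^+ n * (f y + n%:R * E).
  apply: IH => [t /andP[t0 t1]|].
    rewrite e1 scalerA; apply: hA; case/andP: s01 => s0 s1.
    by rewrite mulr_ge0 //= mulr_ile1.
  rewrite e1 enormZ ger0_norm; last by case/andP: s01.
  by rewrite /s mulrAC ler_pdivrMr // -mulrA; apply: ler_wpM2l => //; rewrite mulrC.
have h2 : f x <= C * f x' + E.
  apply: hf; first exact: hA.
    have := hA 1; rewrite scale1r addrC subrK; apply; by rewrite ler01 lexx.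
  by rewrite e2 enormZ gtr0_norm ?invr_gt0 // mulrC ler_pdivrMr // mulrC.
apply: le_trans h2 _.
have Cn : 1 <= C ^+ n.+1 by apply: exprn_ege1.
have h3 : C * f x' <= C * (C ^+ n * (f y + n%:R * E)) by apply: ler_wpM2l => //; lra.
have h4 : E <= C ^+ n.+1 * E by rewrite ler_peMl.
have -> : C ^+ n.+1 * (f y + n.+1%:R * E) = C * (C ^+ n * (f y + n%:R * E)) + C ^+ n.+1 * E.
  by rewrite exprS -natr1; ring.
by apply: lerD.
Qed.

Lemma three_steps (a b c e M F : R) :
  a <= M * (b + F) -> b <= M * (c + F) -> c <= M * (e + F) -> 1 <= M -> 0 <= F ->
  a <= M ^+ 3 * (e + 3 * F).
Proof.
move=> s1 s2 s3 M1 F0.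
have M0 : 0 <= M by lra.
have h2 : M * (b + F) <= M * (M * (c + F) + F) by apply: ler_wpM2l => //; lra.
have h3 : M * (M * (c + F)) <= M * (M * (M * (e + F) + F)).
  apply: ler_wpM2l => //; apply: ler_wpM2l => //; lra.
have h4 : M * F <= M ^+ 3 * F.
  by apply: ler_wpM2r => //; rewrite exprSr ler_peMl // exprn_ege1.
have h5 : M * (M * F) <= M ^+ 3 * F.
  by rewrite mulrA; apply: ler_wpM2r => //; rewrite -expr2 [M ^+ 3]exprSr ler_peMr ?sqr_ge0.
have -> : M ^+ 3 * (e + 3 * F) = M * (M * (M * (e + F))) + 2 * (M ^+ 3 * F) by ring.
lra.
Qed.

(* Two points at distance [r] from the origin are joined inside the annulus by pushing
   both of them inwards by [r *: nu]. *)
Lemma harnack_path (d : V -> R) (G : V -> V) (H : V -> 'M[R]_N) (r0 K r : R) (nu : V)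
    (f : V -> R) (C E del : R) (n : nat) x y :
  collar d G H r0 K nu -> 0 < r -> 2 * r < r0 -> 10 * (K * r) <= 1 ->
  1 <= C -> 0 <= E -> 2 * r <= n%:R * del ->
  let A := [set w | r / 2 <= enorm w <= 3 * r /\ 0 < d w] in
  (forall z x, A z -> A x -> enorm (x - z) <= del -> f x <= C * f z + E) ->
  enorm x = r -> enorm y = r -> 0 < d x -> 0 < d y ->
  f x <= (C ^+ n) ^+ 3 * (f y + 3 * (n%:R * E)).
Proof.
move=> c r_gt0 rR Kr C1 E0 hn A hf ex ey dx dy.
have K0 := collar_const_ge0 c; have nu1 := collar_normal c.
have en : enorm (r *: nu) = r.
  by rewrite enormZ enormE nu1 sqrtr1 mulr1 gtr0_norm.
have Krr : K * r * r <= 10^-1 * r by apply: ler_wpM2r; [exact: ltW|lra].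
(* A point of the domain lies at most slightly below the tangent plane, since
   [dot w nu >= d w - K |w|^2]. *)
have mnu w : enorm w = r -> 0 < d w -> - (10^-1 * r) <= dot w nu.
  move=> ew dw; have /(collar_linear c) : enorm w < r0 by lra.
  rewrite -enorm_sqr ew => /ler_normlP[_ h1]; rewrite expr2 in h1; lra.
(* Pushing along [nu] does not lower [d], whose slope along [nu] is at least 1/2, and cannot bring
   the point inside radius [r / 2], because [dot w nu] is hardly negative. *)
have up w t : enorm w = r -> 0 < d w -> 0 <= t <= 1 -> A (w + t *: (r *: nu)).
  move=> ew dw /andP[t0 t1]; set v := w + _.
  have tn s : 0 <= s <= 1 -> enorm (s *: (r *: nu)) <= r.
    by move=> /andP[s0 s1]; rewrite enormZ en ger0_norm // ler_piMl // ltW.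
  have n2 s : 0 <= s <= 1 -> enorm (w + s *: (r *: nu)) <= 2 * r.
    by move=> hs; have := enormD w (s *: (r *: nu)); have := tn s hs; lra.
  split.
    have v2 := n2 t; rewrite t0 t1 in v2; have {}v2 := v2 isT.
    apply/andP; split; last lra.
    rewrite -ler_sqr ?nnegrE ?divr_ge0 ?(ltW r_gt0) // enorm_sqr /v.
    rewrite dotDl !dotDr !dotZl !dotZr nu1 -enorm_sqr ew [dot nu w]dotC.
    have m := mnu w ew dw.
    have h1 : - (10^-1 * r) * (t * r) <= dot w nu * (t * r).
      by apply: ler_wpM2r => //; rewrite mulr_ge0 // ltW.
    have h2 : t * (r * r) <= r * r by rewrite ler_piMl // mulr_ge0 // ltW.
    have h3 : 0 <= t * (r * (t * (r * 1))) by rewrite !mulr_ge0 // ltW.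
    have r2 : 0 < r * r by rewrite mulr_gt0.
    rewrite !expr2.
    have -> : r / 2 * (r / 2) = 4^-1 * (r * r) by field.
    lra.
  have [|s s01] := @J2_mean_value _ _ d G H v w.
    move=> s /andP[s0 s1]; apply: (collar_jet c).
    have -> : v - w = t *: (r *: nu) by rewrite /v addrC addKr.
    rewrite scalerA; apply: le_lt_trans rR; apply: n2.
    by rewrite mulr_ge0 //= mulr_ile1.
  have ev : v - w = t *: (r *: nu) by rewrite /v addrC addKr.
  rewrite ev !dotZl [dot nu _]dotC.
  have h1 : 2^-1 <= dot (G (w + s *: (t *: (r *: nu)))) nu.
    apply: (collar_grad_normal c); rewrite scalerA; apply: le_lt_trans rR; apply: n2.
    by case/andP: s01 => s0 s1; rewrite mulr_ge0 //= mulr_ile1.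
  have h2 : 0 <= t * (r * dot (G (w + s *: (t *: (r *: nu)))) nu).
    by rewrite mulr_ge0 // mulr_ge0 ?(ltW r_gt0) //; lra.
  by move=> e; rewrite -e in h2; lra.
(* Between the two pushed points every height above the tangent plane is at least [9 r / 10], more
   than the curvature error [4 K r^2 <= 4 r / 10]. *)
have across t : 0 <= t <= 1 -> A (y + r *: nu + t *: (x + r *: nu - (y + r *: nu))).
  move=> /andP[t0 t1]; pose v := (1 - t) *: y + t *: x.
  have -> : y + r *: nu + t *: (x + r *: nu - (y + r *: nu)) = r *: nu + v.
    by apply/matrixP => i j; rewrite !mxE; ring.
  have nv : enorm v <= r.
    have := enormD ((1 - t) *: y) (t *: x); rewrite !enormZ ex ey !ger0_norm ?subr_ge0 //.
    by rewrite -/v; lra.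
  have dv : - (10^-1 * r) <= dot v nu.
    rewrite dotDl !dotZl.
    have a1 : (1 - t) * - (10^-1 * r) <= (1 - t) * dot y nu.
      by apply: ler_wpM2l; [lra|exact: mnu].
    have a2 : t * - (10^-1 * r) <= t * dot x nu by apply: ler_wpM2l => //; exact: mnu.
    lra.
  set w := r *: nu + v.
  have dw : (9 / 10) * r <= dot w nu by rewrite dotDl dotZl nu1; lra.
  have nw : enorm w <= 2 * r by have := enormD (r *: nu) v; rewrite -/w; lra.
  have nw' : (9 / 10) * r <= enorm w.
    have := dot_le w nu; rewrite [enorm nu]enormE nu1 sqrtr1 mulr1; lra.
  split; first by apply/andP; split; lra.
  have /(collar_linear c) /ler_normlP[h1 h2] : enorm w < r0 by lra.
  have h3 : K * dot w w <= K * (4 * (r * r)).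
    apply: ler_wpM2l => //; rewrite -enorm_sqr.
    have -> : 4 * (r * r) = (2 * r) ^+ 2 by ring.
    by rewrite ler_sqr ?nnegrE // mulr_ge0 // ltW.
  lra.
have nE : 0 <= n%:R * E by rewrite mulr_ge0.
have s1 : f x <= C ^+ n * (f (x + r *: nu) + n%:R * E).
  apply: (harnack_chain C1 E0 hf).
    move=> t /andP[t0 t1].
    have -> : x + r *: nu + t *: (x - (x + r *: nu)) = x + (1 - t) *: (r *: nu).
      by apply/matrixP => i j; rewrite !mxE; ring.
    by apply: up => //; rewrite subr_ge0 t1 gerBl.
  rewrite opprD addrA subrr add0r enormN en; lra.
have s2 : f (x + r *: nu) <= C ^+ n * (f (y + r *: nu) + n%:R * E).
  apply: (harnack_chain C1 E0 hf) => //.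
  have -> : x + r *: nu - (y + r *: nu) = x - y by apply/matrixP => i j; rewrite !mxE; ring.
  have := enormB x y; rewrite ex ey; lra.
have s3 : f (y + r *: nu) <= C ^+ n * (f y + n%:R * E).
  apply: (harnack_chain C1 E0 hf).
    by move=> t t01; rewrite [_ - y]addrC addKr; apply: up.
  rewrite addrC addKr en; lra.
have Cn : 1 <= C ^+ n by apply: exprn_ege1.
exact: three_steps s1 s2 s3 Cn nE.
Qed.

End HarnackChain.

Section ScalarEstimates.
Context {R : realType}.
Implicit Types (k e t w : R).

Lemma ln_near t w : 0 < t -> t / 4 <= w -> w <= 4 * t -> `|ln w - ln t| <= 2.
Proof.
move=> t0 h1 h2; have w0 : 0 < w by apply: lt_le_trans h1; rewrite divr_gt0.
have e4 : 4 <= expR 2 :> R.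
  have -> : expR 2 = expR 1 * expR 1 :> R by rewrite -expRD; congr expR; lra.
  by have := expR_ge1Dx (1 : R); nra.
have b1 : ln w <= ln t + 2.
  rewrite -ler_expR expRD !lnK ?posrE //.
  by have := ler_wpM2l (ltW t0) e4; lra.
have b2 : ln t <= ln w + 2.
  rewrite -ler_expR expRD !lnK ?posrE //.
  by have := ler_wpM2l (ltW w0) e4; lra.
by rewrite ler_norml; apply/andP; split; lra.
Qed.

(** The truncation at 0 keeps the coefficient nonnegative, as the Harnack step requires. The
    accuracy [e / (k + 1)] of [Z] against [h] keeps the product below [e], however large [k] is. *)
Lemma truncated_coefficient k e : 0 <= k -> 0 < e ->
  [/\ 0 <= Num.max 0 (k - e), Num.max 0 (k - e) <= k, k - Num.max 0 (k - e) <= e &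
      Num.max 0 (k - e) * (e / (k + 1)) <= e].
Proof.
move=> k0 e0; set k' := Num.max _ _.
have k'0 : 0 <= k' by rewrite le_max lexx.
have k'k : k' <= k by rewrite ge_max k0 gerBl ltW.
split=> //; first by have : k - e <= k'; [rewrite le_max lexx orbT|lra].
rewrite mulrA ler_pdivrMr; last lra.
have : k' * e <= k * e by apply: ler_wpM2r => //; exact: ltW.
lra.
Qed.

(* Here [fx], [fy] are the values [u - k' * (h - Z)] divided by [d], at two points of a
   sphere on which the profile is [q]. *)
Lemma chained_estimate (k k' e eta q M n D fx fy ux uy zx zy : R) :
  0 <= k' -> k' <= k -> k - k' <= e -> k' * eta <= e -> 0 < q -> 0 <= M -> 0 <= n -> 0 <= D ->
  0 <= zx -> zy <= eta * q -> uy <= (k + e) * q ->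
  fx = ux - k' * q + k' * zx -> fy = uy - k' * q + k' * zy ->
  fx <= M * (fy + 3 * (n * (2 * k' * eta * (D * q)))) ->
  ux <= (k + M * (3 + 6 * (n * D)) * e) * q.
Proof.
move=> k'0 k'k kk' keta q0 M0 n0 D0 zx0 zyq uyq fxE fyE hfx.
have kg : k' * (eta * q) <= e * q by rewrite mulrA; apply: ler_wpM2r => //; exact: ltW.
have fy3 : fy <= 3 * (e * q).
  have a1 := le_trans (ler_wpM2l k'0 zyq) kg.
  have a3 : (k - k') * q <= e * q by apply: ler_wpM2r => //; exact: ltW.
  lra.
have h3 : n * (2 * k' * eta * (D * q)) <= 2 * (n * D) * (e * q).
  have -> : n * (2 * k' * eta * (D * q)) = 2 * (n * D) * (k' * (eta * q)) by ring.
  by apply: ler_wpM2l => //; apply: mulr_ge0 => //; exact: mulr_ge0.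
have h4 : fx <= M * (3 + 6 * (n * D)) * (e * q).
  by apply: le_trans hfx _; rewrite -[leRHS]mulrA; apply: ler_wpM2l => //; lra.
have h5 : k' * q <= k * q by apply: ler_wpM2r => //; exact: ltW.
have h6 := mulr_ge0 k'0 zx0.
move: (M * (3 + 6 * (n * D))) h4 => Ct h4; lra.
Qed.

End ScalarEstimates.

(** * Lower and upper bounds for the quotient near the origin *)

Section QuotientLimit.
Context {R : realType} {N : nat}.
Notation V := 'rV[R]_N.
Implicit Types x y : V.
Context (d u Z : V -> R) (G : V -> V) (H : V -> 'M[R]_N) (R0 K mu : R) (nu : V).
Context (gz : R -> R) (lh lZ : V -> R) (a b rs : R).
Context (N2 : (2 <= N)%N) (col : collar d G H R0 K nu).
Context (bar : barriers d mu Z gz lh lZ a b rs) (rsR : rs <= R0).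
Let g := main_profile (N := N) mu.
Let h y := d y * g (lognorm y).
Context (hu : forall x, 0 < enorm x < R0 -> 0 < d x -> lap u x (mu / dot x x * u x)).
Context (cu : forall x, 0 < enorm x < R0 -> 0 < d x -> {for x, continuous u}).
Context (u0 : forall x, 0 < enorm x < R0 -> 0 < d x -> 0 <= u x).
Context (ubd : forall y, 0 < enorm y < R0 -> d y = 0 -> forall e, 0 < e ->
  \forall x \near y, 0 < d x -> u x <= e).

Lemma main_profile_continuous (t : R) : {for t, continuous g}.
Proof.
have ct : {for t, continuous (fun t : R => t)} by exact: cvg_id.
rewrite /g /main_profile; case: (mu == mu1 N); apply: cont_mul.
- exact: cont_opp.
- by apply: cont_exp; exact: cont_scale.
- exact: cont_cst.
- by apply: cont_exp; exact: cont_scale.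
Qed.

Lemma lognorm_continuous (x : V) : x != 0 -> {for x, continuous (@lognorm R N)}.
Proof.
move=> x0; apply: cont_scale; apply: cont_comp; first exact: cont_dot.
by apply: continuous_ln; exact: dot_gt0.
Qed.

Lemma small_lt_R0 x : 0 < enorm x < rs -> 0 < enorm x < R0.
Proof. by move=> /andP[-> h1] /=; exact: lt_le_trans h1 rsR. Qed.

Lemma h_continuous x : 0 < enorm x < rs -> {for x, continuous h}.
Proof.
move=> hx; have /andP[x0 xR] := small_lt_R0 hx.
apply: cont_mul; first exact: (collar_continuous col).
apply: cont_comp; last exact: main_profile_continuous.
by apply: lognorm_continuous; rewrite -enorm_gt0.
Qed.

Lemma h_gt0 x : 0 < enorm x < rs -> 0 < d x -> 0 < h x.
Proof.
by move=> hx dx; rewrite mulr_gt0 //; apply: main_profile_gt0; exact: (barriers_lognorm bar).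
Qed.

Lemma Z_gt0 x : 0 < enorm x < rs -> 0 < d x -> 0 < Z x.
Proof.
move=> hx dx; have /andP[z _] := barriers_between bar hx dx; apply: lt_le_trans z.
by rewrite mulr_gt0 ?invr_gt0 // mulr_gt0 // (barriers_profile_gt0 bar).
Qed.

Lemma main_profile_bound (T : R) : 0 <= T ->
  exists2 C, 0 <= C & forall t, `|t| <= T -> g t <= C.
Proof.
move=> T0; set P := expR (`|critical_exponent (N := N) mu| * T).
exists ((T + 1) * P); first by rewrite mulr_ge0 ?expR_ge0 //; lra.
move=> t tT.
have h1 : expR (critical_exponent (N := N) mu * t) <= P.
  rewrite ler_expR; apply: le_trans (ler_norm _) _; rewrite normrM.
  by apply: ler_wpM2l.
have h2 : `|if mu == mu1 N then - t else 1| <= T + 1.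
  by case: ifP => _; rewrite ?normrN ?normr1; lra.
apply: le_trans (ler_norm _) _; rewrite /g /main_profile normrM.
by apply: ler_pM => //; rewrite ger0_norm ?expR_ge0.
Qed.

Lemma ln_norm_bound (r1 r2 r : R) : 0 < r1 -> r1 <= r <= r2 -> `|ln r| <= `|ln r1| + `|ln r2|.
Proof.
move=> r10 /andP[h1 h2].
have l1 : ln r1 <= ln r by rewrite ler_ln ?posrE //; lra.
have l2 : ln r <= ln r2 by rewrite ler_ln ?posrE //; lra.
have n1 := ler_norm (- ln r1); rewrite normrN in n1.
have n2 := ler_norm (ln r2); have n3 := normr_ge0 (ln r1); have n4 := normr_ge0 (ln r2).
rewrite ler_norml; apply/andP; split; lra.
Qed.

(** [B] is chosen so that [h - (1 + B) Z] is nonpositive on the outer sphere, where [u >= 0] then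
    suffices. It depends neither on [c] nor on the inner radius; the supremum argument in
    [lower_limit] rests on this uniformity. *)
Lemma lower_comparison (r2 : R) : 0 < r2 -> r2 < rs ->
  exists2 B : R, 0 <= B & forall c r1, 0 <= c -> 0 < r1 ->
    (forall x, enorm x = r1 -> 0 < d x -> c * h x <= u x) ->
    forall x, r1 <= enorm x <= r2 -> 0 < d x -> c * (h x - (1 + B) * Z x) <= u x.
Proof.
move=> r20 r2s; have a0 := barriers_gt0 bar.
have lr2 (x : V) : enorm x = r2 -> lognorm x = ln r2.
  by move=> e; rewrite lognormE ?e // -enorm_gt0 e.
pose B := 2 * `|g (ln r2)| / gz (ln r2).
have gz2 := barriers_profile_gt0 bar (ln r2).
exists B; first by rewrite divr_ge0 ?mulr_ge0 // ltW.
move=> c r1 c0 r10 hr1 x xr dx.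
have [r12|r12] := ltrP r2 r1; first by move: xr => /andP[]; lra.
have hA y : r1 <= enorm y <= r2 /\ 0 < d y -> 0 < enorm y < rs.
  by move=> [/andP[y1 y2] _]; apply/andP; split; [exact: lt_le_trans y1|exact: le_lt_trans y2 _].
pose A := [set y | r1 <= enorm y <= r2 /\ 0 < d y].
pose S y := c * ((h y - Z y) - B * Z y).
have B0 : 0 <= B by rewrite divr_ge0 ?mulr_ge0 // ltW.
have lS y : A y -> lap S y (c * ((lh y - lZ y) - B * lZ y)).
  move=> Ay; have hy := hA y Ay; have [_ dy] := Ay.
  apply: lap_scale; apply: lap_sub; last by apply: lap_scale; exact: (barriers_lap bar).
  by apply: lap_sub; [exact: (barriers_lap_main bar)|exact: (barriers_lap bar)].
have [GS [HS jS]] := lap_jets lS.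
have [Gu [Hu ju]] := lap_jets (fun y (Ay : A y) => hu (small_lt_R0 (hA y Ay)) Ay.2).
have [GZ [HZ jZ]] := lap_jets (fun y (Ay : A y) => barriers_lap bar (hA y Ay) Ay.2).
pose T := `|ln r1| + `|ln r2|.
have T0 : 0 <= T by rewrite addr_ge0.
have lT y : A y -> `|lognorm y| <= T.
  move=> Ay; have hy := hA y Ay; have [hy1 _] := Ay.
  rewrite lognormE ?(ln_norm_bound r10) //.
  by rewrite -enorm_gt0; case/andP: hy.
have [C C0 hC] := main_profile_bound T0.
have cS y : A y -> {for y, continuous S}.
  move=> Ay; have hy := hA y Ay; have [_ dy] := Ay.
  apply: cont_scale; apply: cont_sub; last by apply: cont_scale; exact: (barriers_continuous bar).
  by apply: cont_sub; [exact: h_continuous|exact: (barriers_continuous bar)].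
have SE y : S y = c * (h y - (1 + B) * Z y) by rewrite /S; ring.
have Sh y : A y -> S y <= c * h y.
  move=> Ay; have hy := hA y Ay; have [_ dy] := Ay.
  rewrite SE; apply: ler_wpM2l => //; rewrite gerBl mulr_ge0 //; first lra.
  by apply: ltW; exact: Z_gt0.
rewrite -SE.
apply: (@comparison_principle _ _ d S u Z (fun y => mu / dot y y) GS Gu GZ HS Hu HZ
   R0 r1 r2 (c * C) (`|mu| / r1 ^+ 2) (a * expR (- (`|b| * T)))) => //.
- exact: lt_le_trans r2s rsR.
- by rewrite mulr_gt0 ?expR_gt0.
- by rewrite divr_ge0 // sqr_ge0.
- by move=> y /andP[_ yR]; exact: (collar_continuous col).
- by move=> y Ay; have [] := jS y Ay.
- by move=> y Ay; have [] := ju y Ay.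
- by move=> y Ay; have [] := jZ y Ay.
- by move=> y Ay; apply: cu; [exact: small_lt_R0 (hA y Ay)|exact: Ay.2].
- by move=> y Ay; apply: (barriers_continuous bar); [exact: hA|exact: Ay.2].
- move=> y Ay; have hy := hA y Ay; rewrite normrM normfV.
  have yy : r1 ^+ 2 <= dot y y.
    by rewrite -enorm_sqr ler_sqr ?nnegrE ?(ltW r10) //; case: Ay => /andP[].
  have r12' : 0 < r1 ^+ 2 by rewrite exprn_gt0.
  apply: ler_wpM2l => //; rewrite ger0_norm ?dot_ge0 // lef_pV2 ?posrE //.
  exact: lt_le_trans yy.
- move=> y Ay; have hy := hA y Ay; have [_ ->] := jS y Ay; have [_ dy] := Ay.
  have s1 : mu / dot y y * (h y - Z y) <= lh y - lZ y := barriers_subsolution bar hy dy.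
  have s2 := barriers_strict bar hy dy.
  have s3 : 0 <= a * expR (b * lognorm y) by rewrite mulr_ge0 ?expR_ge0 // ltW.
  have s4 : B * lZ y <= B * (mu / dot y y * Z y) by apply: ler_wpM2l => //; lra.
  have -> : mu / dot y y * S y = c * (mu / dot y y * (h y - Z y) - B * (mu / dot y y * Z y)).
    by rewrite /S; ring.
  by apply: ler_wpM2l => //; lra.
- by move=> y Ay; have [_ ->] := ju y Ay.
- by move=> y Ay; apply: Z_gt0; [exact: hA|exact: Ay.2].
- move=> y Ay; have [_ ->] := jZ y Ay; apply: le_trans (barriers_strict bar (hA y Ay) Ay.2) _.
  rewrite lerD2l lerN2; apply: ler_wpM2l; first exact: ltW.
  rewrite ler_expR lerNl -mulrN; apply: le_trans (ler_norm _) _.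
  by rewrite normrM normrN; apply: ler_wpM2l => //; exact: lT.
- by move=> y Ay; apply: u0; [exact: small_lt_R0 (hA y Ay)|exact: Ay.2].
- move=> y Ay; have [_ dy] := Ay; apply: le_trans (Sh y Ay) _.
  rewrite -mulrA; apply: ler_wpM2l => //; rewrite /h mulrC.
  by apply: ler_wpM2r; [exact: ltW|apply: hC; exact: lT].
- by move=> y Ay ey; apply: le_trans (Sh y Ay) _; apply: hr1 => //; exact: Ay.2.
- move=> y Ay ey; have hy := hA y Ay; have [_ dy] := Ay.
  apply: (@le_trans _ _ 0); last exact: u0 (small_lt_R0 hy) dy.
  rewrite SE mulr_ge0_le0 // subr_le0.
  have /andP[z1 _] := barriers_between bar hy dy; rewrite (lr2 y ey) in z1.
  have z0 := Z_gt0 hy dy.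
  have : h y <= B * Z y.
    rewrite /h (lr2 y ey).
    apply: (@le_trans _ _ (B * (2^-1 * (d y * gz (ln r2))))); last exact: ler_wpM2l.
    have -> : B * (2^-1 * (d y * gz (ln r2))) = d y * `|g (ln r2)|.
      by rewrite /B; field; rewrite gt_eqF.
    by apply: ler_wpM2l; [exact: ltW|exact: ler_norm].
  lra.
Qed.

Lemma Z_small (e : R) : 0 < e -> exists2 r : R, 0 < r <= rs & forall x, 0 < enorm x < r ->
  0 < d x -> Z x <= e * h x /\ gz (lognorm x) <= e * g (lognorm x).
Proof.
move=> e0; have [t0 ht0] := barriers_small bar e0.
exists (Num.min rs (expR t0)); first by rewrite lt_min (barriers_radius bar) expR_gt0 ge_min lexx.
move=> x /andP[x0 xr] dx.
have xs : 0 < enorm x < rs by rewrite x0; move: xr; rewrite lt_min => /andP[].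
have h1 : gz (lognorm x) <= e * g (lognorm x).
  apply: ht0; rewrite lognormE -?enorm_gt0 // -[ltRHS]expRK ltr_ln ?posrE ?expR_gt0 //.
  by move: xr; rewrite lt_min => /andP[].
split=> //; have /andP[_ z] := barriers_between bar xs dx; apply: le_trans z _.
by rewrite /h mulrCA; apply: ler_wpM2l => //; exact: ltW.
Qed.

Lemma nu_inside (r : R) : 0 < r -> r < R0 -> K * r < 1 ->
  enorm (r *: nu) = r /\ 0 < d (r *: nu).
Proof.
move=> r0 rR Kr.
have e : enorm (r *: nu) = r.
  by rewrite enormZ enormE (collar_normal col) sqrtr1 mulr1 gtr0_norm.
split=> //; have : enorm (r *: nu) < R0 by rewrite e.
move=> /(collar_linear col); rewrite -enorm_sqr e dotZl (collar_normal col) mulr1 => /ler_normlP[h1 _].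
have : K * r * r < 1 * r by rewrite ltr_pM2r.
rewrite expr2 in h1; lra.
Qed.

Lemma lower_limit : exists k : R, [/\ 0 <= k,
  (forall e, 0 < e -> exists2 r, 0 < r <= rs & forall x, 0 < enorm x < r -> 0 < d x ->
     (k - e) * h x <= u x) &
  (forall e, 0 < e -> exists2 r, 0 < r <= rs & forall s, 0 < s < r ->
     exists y, [/\ enorm y = s, 0 < d y & u y <= (k + e) * h y])].
Proof.
have rs0 := barriers_radius bar; pose r2 := rs / 2.
have r20 : 0 < r2 by rewrite divr_gt0.
have r2s : r2 < rs by rewrite /r2; have := barriers_radius bar; lra.
have [B B0 hB] := lower_comparison r20 r2s.
have B1 : 0 < 2 * (1 + B) by lra.
pose S := [set c : R | 0 <= c /\ exists2 r, 0 < r & forall x, 0 < enorm x < r -> 0 < d x ->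
  c * h x <= u x].
have S0 : S 0.
  split=> //; exists rs => // x hx dx; rewrite mul0r; apply: u0 => //; exact: small_lt_R0.
have [r [/andP[r0 rrs]] hr] : exists2 r : R, 0 < r <= rs & forall x, 0 < enorm x < r ->
  0 < d x -> Z x <= (2 * (1 + B))^-1 * h x /\ gz (lognorm x) <= (2 * (1 + B))^-1 * g (lognorm x).
  by apply: Z_small; rewrite invr_gt0.
have [xs [xs1 xs2 xs3]] : exists xs : V, [/\ 0 < enorm xs < r, enorm xs <= r2 & 0 < d xs].
  pose t := Num.min (r / 2) (Num.min (rs / 2) (K + 1)^-1).
  have K1 : 0 < K + 1 by have := collar_const_ge0 col; lra.
  have t0 : 0 < t by rewrite !lt_min !divr_gt0 // invr_gt0.
  have tr : t <= r / 2 by rewrite ge_min lexx.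
  have trs : t <= rs / 2 by rewrite !ge_min lexx orbT.
  have tK : t <= (K + 1)^-1 by rewrite !ge_min lexx !orbT.
  have [||e dx] := @nu_inside t t0.
  - by have := rsR; have := barriers_radius bar; lra.
  - apply: (@lt_le_trans _ _ ((K + 1) * t)); first by rewrite ltr_pM2r //; lra.
    by rewrite mulrC -ler_pdivlMr // mul1r.
  by exists (t *: nu); rewrite e t0; split=> //; lra.
have xss : 0 < enorm xs < rs by case/andP: xs1 => -> h1 /=; apply: lt_le_trans h1 rrs.
have hxs := h_gt0 xss xs3.
(* At the fixed point [xs] the corrector takes at most half of [h], so every admissible [c]
   satisfies [c * (h xs / 2) <= u xs]. *)
have Sub : ubound S (2 * u xs / h xs).
  move=> c [c0 [rc rc0 hc]].
  pose r1 := Num.min (rc / 2) (enorm xs).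
  have x0 : 0 < enorm xs by case/andP: xs1.
  have r10 : 0 < r1 by rewrite lt_min x0 divr_gt0.
  have := hB c r1 c0 r10 _ xs _ xs3; rewrite ge_min lexx orbT xs2 => /(_ _ erefl) h1.
  have {}h1 : c * (h xs - (1 + B) * Z xs) <= u xs.
    apply: h1 => y ey dy; apply: hc => //; rewrite ey r10 /= /r1 gt_min; apply/orP; left; lra.
  have [hz _] := hr xs xs1 xs3.
  have hz2 : (1 + B) * Z xs <= h xs / 2.
    have h3 : (1 + B) * Z xs <= (1 + B) * ((2 * (1 + B))^-1 * h xs) by apply: ler_wpM2l => //; lra.
    apply: le_trans h3 _; rewrite le_eqVlt; apply/orP; left; apply/eqP; field.
    by rewrite gt_eqF //; lra.
  have h2 : c * (h xs / 2) <= c * (h xs - (1 + B) * Z xs) by apply: ler_wpM2l => //; lra.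
  rewrite ler_pdivlMr //; lra.
have hS : has_sup S by split; [exists 0|exists (2 * u xs / h xs)].
pose k := sup S.
have k0 : 0 <= k by apply: sup_upper_bound.
exists k; split=> //.
- move=> e e0; have [c [c0 [rc rc0 hc]] ck] := sup_adherent e0 hS.
  exists (Num.min rc rs); first by rewrite lt_min rc0 (barriers_radius bar) ge_min lexx orbT.
  move=> x /andP[x0]; rewrite lt_min => /andP[xc xrs] dx.
  apply: le_trans (hc x _ dx); last by rewrite x0.
  by apply: ler_wpM2r; [apply: ltW; apply: h_gt0; rewrite ?x0|exact: ltW].
(* Otherwise spheres of arbitrarily small radius carry [u > (k + e) h] throughout. Comparison from
   them up to radius [r2] gives [u >= (k + e) (h - (1 + B) Z)], and [k + e / 2] would be
   admissible. *)
move=> e e0; apply: contrapT => /forall2NP hno.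
have hex rho : 0 < rho -> rho <= rs -> exists2 s, 0 < s < rho & forall y, enorm y = s -> 0 < d y ->
    (k + e) * h y <= u y.
  move=> rho0 rhos; have [|] := hno rho; first by rewrite rho0 rhos.
  move=> /existsNP[s /not_implyP[hs /forallNP hy]]; exists s => // y ey dy.
  rewrite leNgt; apply/negP => hlt; apply: (hy y); split=> //; exact: ltW.
have ke0 : 0 < k + e by lra.
have lb x : 0 < enorm x <= r2 -> 0 < d x -> (k + e) * (h x - (1 + B) * Z x) <= u x.
  move=> /andP[x0 xr2] dx.
  have [|s /andP[s0 sx] hs] := hex (enorm x) x0; first by lra.
  by apply: (hB (k + e) s) => //; [exact: ltW|rewrite (ltW sx) xr2].
pose eta := e / (2 * (1 + B) * (k + e)).
have eta0 : 0 < eta by rewrite divr_gt0 // mulr_gt0.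
have [ro /andP[ro0 rors] hro] := Z_small eta0.
have : S (k + e / 2).
  split; first by rewrite addr_ge0 // divr_ge0 // ltW.
  exists (Num.min ro r2); first by rewrite lt_min ro0.
  move=> x /andP[x0]; rewrite lt_min => /andP[xro xr2] dx.
  have xro' : 0 < enorm x < ro by rewrite x0.
  have xs' : 0 < enorm x < rs by rewrite x0 /=; apply: lt_le_trans xro rors.
  apply: le_trans (lb x _ dx); last by rewrite x0 ltW.
  have [hz _] := hro x xro' dx; have hx := h_gt0 xs' dx.
  have : (k + e) * (1 + B) * Z x <= (k + e) * (1 + B) * (eta * h x).
    by apply: ler_wpM2l => //; rewrite mulr_ge0 //; lra.
  have -> : (k + e) * (1 + B) * (eta * h x) = e / 2 * h x.
    by rewrite /eta; field; rewrite !gt_eqF //; lra.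
  lra.
move=> /(sup_upper_bound hS); rewrite -/k; lra.
Qed.

(** In a ball of radius [2 * harnack_step * r] about a point of norm at least [r / 2] the norm stays
    above [r / 4], and this choice makes the rescaled potential at most 1/2 there. *)
Definition harnack_step : R := (8 * (1 + `|mu|))^-1.

Lemma harnack_stepP : 0 < harnack_step <= 8^-1 /\ 16 * harnack_step ^+ 2 * `|mu| <= 2^-1.
Proof.
have m0 := normr_ge0 mu; rewrite /harnack_step; move: (`|mu|) m0 => m m0.
have p : 0 < 1 + m by lra.
split.
  by rewrite invr_gt0 mulr_gt0 //= lef_pV2 ?posrE ?mulr_gt0 // ler_peMr //; lra.
have -> : 16 * (8 * (1 + m))^-1 ^+ 2 * m = m / (4 * (1 + m) ^+ 2) by field; rewrite gt_eqF.
rewrite ler_pdivrMr ?mulr_gt0 ?exprn_gt0 //.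
have : 0 <= m ^+ 2 by exact: sqr_ge0.
have -> : (1 + m) ^+ 2 = 1 + 2 * m + m ^+ 2 by ring.
lra.
Qed.

(** This is [scaled_boundary_harnack] for [u - k (h + Z)] and [u - k (h - Z)]. Replacing the first
    by the second on the left costs [2 k Z / d], the additive error; both sides then concern one
    function, so the step can be iterated. *)
Lemma local_harnack (k eta r : R) z x :
  0 <= k -> 0 <= eta -> 0 < r -> 4 * r <= rs ->
  (forall y, 0 < enorm y < 4 * r -> 0 < d y ->
     k * h y <= u y /\ gz (lognorm y) <= eta * g (lognorm y)) ->
  r / 2 <= enorm z <= 3 * r -> 0 < d z -> 0 < enorm x < 4 * r -> 0 < d x ->
  enorm (x - z) <= harnack_radius (R := R) (N := N) * (harnack_step * r) ->
  (u x - k * (h x - Z x)) / d x <=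
  harnack_const (R := R) (N := N) * ((u z - k * (h z - Z z)) / d z) +
  2 * k * eta * g (lognorm x).
Proof.
move=> k0 eta0 r0 rrs hk /andP[z1 z2] dz x4 dx hx.
have [/andP[s0 s8] smu] := harnack_stepP.
set s := harnack_step in s0 s8 smu hx.
have rR : 4 * r <= R0 by apply: le_trans rrs _.
have sr0 : 0 < s * r by rewrite mulr_gt0.
have sr8 : s * r <= 8^-1 * r by apply: ler_wpM2r => //; exact: ltW.
have Bn y : enorm (y - z) < 2 * (s * r) -> r / 4 <= enorm y < 4 * r.
  move=> hy; have a1 := enorm_le_sub y z; have a2 := enorm_le_sub z y.
  by rewrite (enormC z y) in a2; apply/andP; split; lra.
have BR y : enorm (y - z) < 2 * (s * r) -> enorm y < R0.
  by move=> /Bn /andP[_ h1]; apply: lt_le_trans h1 rR.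
have B4 y : enorm (y - z) < 2 * (s * r) -> 0 < enorm y < 4 * r.
  by move=> /Bn /andP[h1 ->]; rewrite andbT; lra.
have Bs y : enorm (y - z) < 2 * (s * r) -> 0 < enorm y < rs.
  by move=> /B4 /andP[-> h1]; apply: lt_le_trans h1 rrs.
pose A := [set y | enorm (y - z) < 2 * (s * r) /\ 0 < d y].
pose W1 y := u y - k * (h y + Z y); pose W2 y := u y - k * (h y - Z y).
have l1 y : A y -> lap W1 y (mu / dot y y * u y - k * (lh y + lZ y)).
  move=> [/Bs hy dy]; apply: lap_sub; first by apply: hu => //; exact: small_lt_R0.
  by apply: lap_scale; apply: lap_add; [exact: (barriers_lap_main bar)|exact: (barriers_lap bar)].
have l2 y : A y -> lap W2 y (mu / dot y y * u y - k * (lh y - lZ y)).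
  move=> [/Bs hy dy]; apply: lap_sub; first by apply: hu => //; exact: small_lt_R0.
  by apply: lap_scale; apply: lap_sub; [exact: (barriers_lap_main bar)|exact: (barriers_lap bar)].
have [G1 [H1 j1]] := lap_jets l1; have [G2 [H2 j2]] := lap_jets l2.
have K0 := collar_const_ge0 col.
have KR0 : 0 <= K * R0 := mulr_ge0 K0 (ltW (collar_radius col)).
have Ksr : K * (s * r) <= K * R0 by apply: ler_wpM2l => //; lra.
have hR0K := collar_small col.
have key : W1 x * d z <= harnack_const (R := R) (N := N) * (W2 z * d x).
  apply: (@scaled_boundary_harnack R N d G H K (s * r) z W1 W2 (fun y => mu / dot y y)
    G1 G2 H1 H2) => //.
  - lra.
  - by move=> y /BR; exact: (collar_jet col).
  - by move=> y /BR; exact: (collar_continuous col).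
  - move=> y /BR hy; have /andP[g1 g2] := collar_grad col hy.
    by apply/andP; split=> //; lra.
  - by move=> y v /BR; exact: (collar_hess col).
  - by move=> y /BR; exact: (collar_trace col).
  - move=> y hy; have yR := BR y hy; have h1 := collar_le col yR.
    have h2 : K * d y <= K * (2 * R0) by apply: ler_wpM2l => //; lra.
    lra.
  - by move=> y hy dy; have [] := j1 y (conj hy dy).
  - by move=> y hy dy; have [] := j2 y (conj hy dy).
  - move=> y /Bs hy dy; apply: cont_sub; first by apply: cu => //; exact: small_lt_R0.
    by apply: cont_scale; apply: cont_add; [exact: h_continuous|exact: (barriers_continuous bar)].
  - move=> y /Bs hy dy; apply: cont_sub; first by apply: cu => //; exact: small_lt_R0.
    by apply: cont_scale; apply: cont_sub; [exact: h_continuous|exact: (barriers_continuous bar)].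
  - move=> y /Bs hy dy; rewrite /W1 /W2 lerD2l lerN2; apply: ler_wpM2l => //.
    have := Z_gt0 hy dy; lra.
  - move=> y hy dy; have [hk1 _] := hk y (B4 y hy) dy.
    have : 0 <= k * Z y by rewrite mulr_ge0 // ltW // Z_gt0 // Bs.
    rewrite /W2 mulrBr; lra.
  - move=> y hy dy; have /andP[y1 _] := Bn y hy.
    have r4 : 0 < r / 4 by rewrite divr_gt0.
    have yy : (r / 4) ^+ 2 <= dot y y by rewrite -enorm_sqr ler_sqr ?nnegrE // ltW.
    have rr : 0 < (r / 4) ^+ 2 by rewrite exprn_gt0.
    have y0 : 0 < dot y y by apply: lt_le_trans yy.
    rewrite normrM normfV (ger0_norm (ltW y0)) mulrA ler_pdivrMr //.
    apply: (@le_trans _ _ (2^-1 * (r / 4) ^+ 2)); last by apply: ler_wpM2l.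
    have -> : (s * r) ^+ 2 * `|mu| = (16 * s ^+ 2 * `|mu|) * (r / 4) ^+ 2 by field.
    by apply: ler_wpM2r => //; exact: ltW.
  - move=> y hy dy; have [_ ->] := j1 y (conj hy dy).
    have s1 : lh y + lZ y <= mu / dot y y * (h y + Z y) := barriers_supersolution bar (Bs y hy) dy.
    have := ler_wpM2l k0 s1; rewrite /W1.
    have -> : mu / dot y y * (u y - k * (h y + Z y)) =
      mu / dot y y * u y - k * (mu / dot y y * (h y + Z y)) by ring.
    lra.
  - move=> y hy dy; have [_ ->] := j2 y (conj hy dy).
    have s1 : mu / dot y y * (h y - Z y) <= lh y - lZ y := barriers_subsolution bar (Bs y hy) dy.
    have := ler_wpM2l k0 s1; rewrite /W2.
    have -> : mu / dot y y * (u y - k * (h y - Z y)) =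
      mu / dot y y * u y - k * (mu / dot y y * (h y - Z y)) by ring.
    lra.
  - move=> y hy dy e e0; have hys := Bs y hy.
    have hb := ubd (small_lt_R0 hys) dy e0.
    have hn : \forall w \near y, enorm (w - z) < 2 * (s * r).
      apply/nbhs_enormP; exists (2 * (s * r) - enorm (y - z)); first by rewrite subr_gt0.
      by move=> w hw; have := enorm_triangle w y z; lra.
    near=> w => dw.
    have hw : enorm (w - z) < 2 * (s * r) by near: w.
    have uw : u w <= e by move: dw; near: w.
    apply: le_trans uw; rewrite gerBl mulr_ge0 // addr_ge0 // ltW //.
      by apply: h_gt0 => //; exact: Bs.
    by apply: Z_gt0 => //; exact: Bs.
have [_ hz] := hk x x4 dx.
have xs : 0 < enorm x < rs by case/andP: x4 => -> h1; apply: lt_le_trans h1 rrs.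
have /andP[_ zx] := barriers_between bar xs dx.
have e1 : W1 x / d x <= harnack_const (R := R) (N := N) * (W2 z / d z).
  rewrite ler_pdivrMr // !mulrA -(ler_pM2r dz).
  have -> : harnack_const (R := R) (N := N) * W2 z / d z * d x * d z =
    harnack_const (R := R) (N := N) * (W2 z * d x) by field; rewrite gt_eqF.
  exact: key.
have e2 : Z x / d x <= eta * g (lognorm x).
  rewrite ler_pdivrMr //; apply: le_trans zx _; rewrite mulrC.
  by apply: ler_wpM2r => //; exact: ltW.
have -> : (u x - k * (h x - Z x)) / d x = W1 x / d x + 2 * k * (Z x / d x).
  by rewrite /W1; field; rewrite gt_eqF.
apply: lerD; first exact: e1.
by rewrite -[leRHS]mulrA; apply: ler_wpM2l => //; rewrite mulr_ge0.
Unshelve. all: by end_near. Qed.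

(** The last hypothesis supplies one good point on each small sphere. There [(u - k' (h - Z)) / d]
    is at most [3 e g], since [k - k' <= e], and the chain carries this bound over the whole sphere
    with constants independent of the radius. *)
Lemma upper_limit (k : R) : 0 <= k ->
  (forall e, 0 < e -> exists2 r, 0 < r <= rs & forall x, 0 < enorm x < r -> 0 < d x ->
     (k - e) * h x <= u x) ->
  (forall e, 0 < e -> exists2 r, 0 < r <= rs & forall s, 0 < s < r ->
     exists y, [/\ enorm y = s, 0 < d y & u y <= (k + e) * h y]) ->
  exists2 C, 0 <= C & forall e, 0 < e -> exists2 r, 0 < r <= rs &
    forall x, 0 < enorm x < r -> 0 < d x -> u x <= (k + C * e) * h x.
Proof.
move=> k0 hlo hup.
have [D D1 hD] := @main_profile_doubling R N mu; rewrite -/g in hD.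
have [/andP[s0 s8] _] := harnack_stepP.
have hr0 := harnack_radius_gt0 (R := R) (N := N); have C1 := harnack_const_ge1 (R := R) (N := N).
set hr := harnack_radius (R := R) (N := N) in hr0.
set Ch := harnack_const (R := R) (N := N) in C1.
set s := harnack_step in s0 s8.
(* The step length is a fixed fraction [hr * s] of the radius, so the number of steps over a
   distance of two radii is the same on every sphere. *)
pose n := (Num.truncn (2 / (hr * s))).+1.
have hrs : 0 < hr * s by rewrite mulr_gt0.
have hn : 2 <= n%:R * (hr * s).
  by rewrite -ler_pdivrMr //; apply: ltW; rewrite truncnS_gt.
pose M := (Ch ^+ n) ^+ 3.
have M0 : 0 <= M by rewrite !exprn_ge0 //; lra.
have n0 : (0 : R) <= n%:R by [].
have D0 : 0 <= D := le_trans ler01 D1.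
exists (M * (3 + 6 * (n%:R * D))).
  by rewrite mulr_ge0 // addr_ge0 // mulr_ge0 // mulr_ge0.
move=> e e0; have [k'0 k'k kk' keta] := truncated_coefficient k0 e0.
set k' := Num.max 0 (k - e) in k'0 k'k kk' keta; set eta := e / (k + 1) in keta.
have eta0 : 0 < eta by rewrite divr_gt0 // ltr_wpDl.
have [r1 /andP[r10 r1s] h1] := hlo e e0.
have [r2 /andP[r20 r2s] h2] := hup e e0.
have [r3 /andP[r30 r3s] h3] := Z_small eta0.
(* The chain runs up to radius [3 t] and its balls up to [4 t], hence the quarters; [expR (-4)] is
   the range of [main_profile_doubling]. *)
pose r := Num.min (r1 / 4) (Num.min r2 (Num.min (r3 / 4) (expR (-4)))).
have r0 : 0 < r by rewrite !lt_min !divr_gt0 // r20 expR_gt0.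
exists r; first by rewrite r0 /=; apply: le_trans r2s; rewrite !ge_min lexx !orbT.
move=> x /andP[x0]; rewrite !lt_min => /and4P[xr1 xr2 xr3 xr4] dx.
set t := enorm x in x0 xr1 xr2 xr3 xr4; rewrite ltr_pdivlMr // mulrC in xr1.
rewrite ltr_pdivlMr // mulrC in xr3.
have [y [ey dy uy]] := h2 t (introT andP (conj x0 xr2)).
have t4 : t < 4 * t by rewrite ltr_pMl // ltr1n.
have t4s : 4 * t <= rs by apply: ltW; exact: lt_le_trans r1s.
have t4R : 4 * t <= R0 by apply: le_trans t4s _.
have lt4 : ln t < -4 by rewrite -[ltRHS]expRK ltr_ln ?posrE ?expR_gt0.
have hk w : 0 < enorm w < 4 * t -> 0 < d w ->
    k' * h w <= u w /\ gz (lognorm w) <= eta * g (lognorm w).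
  move=> /andP[w0 wt] dw.
  have ws : 0 < enorm w < rs by rewrite w0; apply: lt_le_trans wt t4s.
  have w3 : 0 < enorm w < r3 by rewrite w0; apply: lt_trans xr3.
  split; last by have [] := h3 w w3 dw.
  rewrite /k'; case: (leP 0 (k - e)) => _; last first.
    by rewrite mul0r; apply: u0 => //; exact: small_lt_R0.
  by apply: h1 => //; rewrite w0; apply: lt_trans xr1.
pose f w := (u w - k' * (h w - Z w)) / d w.
have xs : 0 < enorm x < rs by rewrite x0 /=; apply: lt_le_trans t4s.
have ys : 0 < enorm y < rs by rewrite ey x0 /=; apply: lt_le_trans t4s.
have lx : lognorm x = ln t by rewrite lognormE // -enorm_gt0.
have ly : lognorm y = ln t by rewrite lognormE ?ey // -enorm_gt0 ey.
have gt0 : 0 < g (ln t) by rewrite -lx; apply: main_profile_gt0; exact: (barriers_lognorm bar).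
have Kt0 : 0 <= K * t by rewrite mulr_ge0 ?(collar_const_ge0 col) // ltW.
have hKt : 10 * (K * t) <= 1.
  apply: le_trans (collar_small col); apply: ler_pM => //; first by rewrite ler_nat.
  apply: ler_wpM2l; first exact: collar_const_ge0 col.
  by apply: le_trans t4R; exact: ltW.
have E0 : 0 <= 2 * k' * eta * (D * g (ln t)) :=
  mulr_ge0 (mulr_ge0 (mulr_ge0 (ler0n _ 2) k'0) (ltW eta0)) (mulr_ge0 D0 (ltW gt0)).
have tR : 2 * t < R0 by apply: lt_le_trans t4R; rewrite ltr_pM2r // ltr_nat.
have nt : 2 * t <= n%:R * (hr * (s * t)).
  have -> : n%:R * (hr * (s * t)) = n%:R * (hr * s) * t by ring.
  by apply: ler_wpM2r; [exact: ltW|exact: hn].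
have fx : f x <= M * (f y + 3 * (n%:R * (2 * k' * eta * (D * g (ln t))))).
  apply: (harnack_path col x0 tR hKt C1 E0 nt _ erefl ey dx dy).
  move=> z w [z13 dz] [/andP[w1 w3] dw] hw.
  have w0 : 0 < enorm w by apply: lt_le_trans w1; rewrite divr_gt0.
  have w4 : 0 < enorm w < 4 * t.
    by rewrite w0; apply: le_lt_trans w3 _; rewrite ltr_pM2r // ltr_nat.
  apply: le_trans (local_harnack k'0 (ltW eta0) x0 t4s hk z13 dz w4 dw hw) _.
  rewrite lerD2l; apply: ler_wpM2l; first exact: mulr_ge0 (mulr_ge0 (ler0n _ 2) k'0) (ltW eta0).
  apply: hD => //; rewrite lognormE -?enorm_gt0 //; apply: ln_near => //.
    by apply: le_trans w1; apply: ler_wpM2l; [exact: ltW|rewrite lef_pV2 ?posrE // ler_nat].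
  by apply: le_trans w3 _; rewrite ler_pM2r // ler_nat.
have zq w : 0 < enorm w < rs -> 0 < d w -> enorm w = t ->
    0 <= Z w / d w <= eta * g (ln t).
  move=> ws dw ew; have lw : lognorm w = ln t by rewrite lognormE ?ew // -enorm_gt0 ew.
  rewrite divr_ge0 ?(ltW dw) ?(ltW (Z_gt0 ws dw)) //= ler_pdivrMr //.
  have /andP[_ z1] := barriers_between bar ws dw; apply: le_trans z1 _; rewrite lw mulrC.
  have wt : 0 < enorm w < 4 * t by rewrite ew x0.
  have [_ gw] := hk w wt dw; rewrite lw in gw.
  by apply: ler_wpM2r => //; exact: ltW.
have fE w : 0 < d w -> lognorm w = ln t -> f w = u w / d w - k' * g (ln t) + k' * (Z w / d w).
  by move=> dw lw; rewrite /f /h lw; field; rewrite gt_eqF.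
have /andP[zx _] := zq x xs dx erefl; have /andP[_ zy] := zq y ys dy ey.
have uy' : u y / d y <= (k + e) * g (ln t).
  by rewrite ler_pdivrMr // -mulrA [g _ * _]mulrC -ly.
rewrite /h lx [_ * (d x * _)]mulrCA [leRHS]mulrC -ler_pdivrMr //.
exact: chained_estimate k'0 k'k kk' keta gt0 M0 n0 D0 zx zy uy' (fE x dx lx) (fE y dy ly) fx.
Qed.

Lemma quotient_limit : exists2 k : R, 0 <= k & forall e, 0 < e ->
  exists2 r, 0 < r <= rs & forall x, 0 < enorm x < r -> 0 < d x -> `|u x - k * h x| <= e * h x.
Proof.
have [k [k0 hlo hup]] := lower_limit; have [C C0 hC] := upper_limit k0 hlo hup.
exists k => // e e0; have C1 : 0 < C + 1 by lra.
have [r1 /andP[r10 r1s] h1] := hlo e e0.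
have eC0 : 0 < e / (C + 1) by rewrite divr_gt0.
have [r2 /andP[r20 r2s] h2] := hC _ eC0.
exists (Num.min r1 r2); first by rewrite lt_min r10 r20 /= ge_min r1s.
move=> x /andP[x0]; rewrite lt_min => /andP[x1 x2] dx.
have xs : 0 < enorm x < rs by rewrite x0 (lt_le_trans x1 r1s).
have hx := h_gt0 xs dx.
have b1 := h1 x (introT andP (conj x0 x1)) dx; have b2 := h2 x (introT andP (conj x0 x2)) dx.
have b3 : C * (e / (C + 1)) * h x <= e * h x.
  apply: ler_wpM2r; first exact: ltW.
  by rewrite mulrA ler_pdivrMr // mulrC; apply: ler_wpM2l; lra.
by rewrite ler_norml; apply/andP; split; lra.
Qed.

End QuotientLimit.

(** * The defining function of the domain and the distance to its boundary *)

Section DomainCollar.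
Context {R : realType} {N : nat}.
Notation V := 'rV[R]_N.
Implicit Types (x y z : V) (Omega : set V).

Lemma collar_shrink (d : V -> R) (G : V -> V) (H : V -> 'M[R]_N) (r s K : R) (nu : V) :
  0 < s <= r -> collar d G H r K nu -> collar d G H s K nu.
Proof.
move=> /andP[s0 sr] c; have w x : enorm x < s -> enorm x < r by move=> h; exact: lt_le_trans sr.
split.
- exact: s0.
- exact: collar_const_ge0 c.
- apply: le_trans (collar_small c); apply: ler_wpM2l; first exact: ler0n.
  by apply: ler_wpM2l; [exact: collar_const_ge0 c|exact: sr].
- exact: collar_normal c.
- by move=> x /w; exact: (collar_jet c).
- by move=> x /w; exact: (collar_continuous c).
- by move=> x /w; exact: (collar_grad c).
- by move=> x /w; exact: (collar_grad_normal c).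
- by move=> x v /w; exact: (collar_hess c).
- by move=> x /w; exact: (collar_trace c).
- by move=> x /w; exact: (collar_linear c).
- by move=> x /w; exact: (collar_euler c).
- by move=> x /w; exact: (collar_le c).
- move=> e e0; have [t /andP[t0 tr] h] := collar_grad_near c e0.
  exists (Num.min t s); first by rewrite lt_min t0 s0 ge_min lexx orbT.
  by move=> x; rewrite lt_min => /andP[hx _]; exact: h.
Qed.

Lemma domain_collar Omega : open Omega -> C2_boundary Omega -> bdry Omega 0 ->
  exists (d : V -> R) (G : V -> V) (H : V -> 'M[R]_N) (r K : R) (nu : V),
    collar d G H r K nu /\ forall x, enorm x < r -> (Omega x <-> 0 < d x).
Proof.
move=> oO hC b0; have [r [Q [j [g [r0 QQ gC gj hO]]]]] := hC 0 b0.
have gJ y : J2 g y (grad g y) (hess g y) by apply: (C2_J2 openT gC).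
have [gc _ _ gc1 gc2] := gC.
pose w y : V := evec j - grad g y.
have wj : w 0 ord0 j = 1.
  rewrite !mxE !eqxx; have -> : partial j g 0 = 0; last by rewrite subr0.
  have h := D2_is_derive (gJ 0 (evec j)); rewrite dot_evec mxE in h.
  have e : (fun t => g (0 + t *: evec j)) = cst (g 0) by apply/funext => t; rewrite gj.
  by rewrite e in h; rewrite -(@derive_val _ _ _ _ _ _ _ h) derive_cst.
pose n := enorm (w 0).
have n0 : 0 < n.
  rewrite enorm_gt0; apply/eqP => w0; move/eqP: wj; rewrite w0 mxE.
  by rewrite eq_sym oner_eq0.
pose f y := n^-1 * (dot y (evec j) - g y).
have O0 x : enorm x < r -> (Omega x <-> 0 < f (x *m Q)).
  move=> xr; rewrite /f pmulr_rgt0 ?invr_gt0 // subr_gt0 dotC dot_evec.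
  by have := hO x; rewrite subr0; apply.
have cf y : {for y, continuous f}.
  apply: cont_scale; apply: cont_sub; last exact: gc.
  have -> : (fun y : V => dot y (evec j)) = (fun y => y ord0 j).
    by apply/funext => z; rewrite dotC dot_evec.
  exact: coord_continuous.
(* A negative value would keep the domain away from the origin, a positive one would put the origin
   inside it; both contradict [bdry Omega 0]. *)
have f0 : f 0 = 0.
  have [fn|fp|//] := ltrgtP (f 0) 0.
    have /nbhs_enormP[e e0 he] : \forall y \near (0 : V), f y < 0 by exact: (cf 0 _ (lt_nbhsl fn)).
    have [|x [Ox xe]] := b0.1 [set x | enorm x < Num.min e r].
      by apply/nbhs_enormP; exists (Num.min e r) => [|y]; rewrite ?lt_min ?e0 //= subr0 lt_min.
    move: xe => /=; rewrite lt_min => /andP[xe xr].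
    have := he (x *m Q); rewrite subr0 enormE dot_mulmx -mulmxA QQ mulmx1 -enormE => /(_ xe).
    by move=> /= h; have := (O0 x xr).1 Ox; rewrite ltNge (ltW h).
  case: b0 => _; case; have oi := (interior_id Omega).1 oO.
  by rewrite oi; apply/O0; rewrite ?enorm0 ?mul0mx.
have [||||||s [K c]] := @collar_of_jets R N f (fun y => n^-1 *: w y) (fun y => n^-1 *: (0 - hess g y)).
- by move=> y; apply: J2_scale; apply: J2_sub; [exact: J2_dot|exact: gJ].
- exact: cf.
- move=> i; have -> : (fun x : V => (n^-1 *: w x) ord0 i) =
      (fun x => n^-1 * ((evec j : V) ord0 i - partial i g x)).
    by apply/funext => x; rewrite !mxE.
  by apply: cont_scale; apply: cont_sub; [exact: cont_cst|exact: gc1].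
- move=> i k; have -> : (fun x : V => (n^-1 *: (0 - hess g x)) i k) =
      (fun x => n^-1 * (0 - partial k (partial i g) x)).
    by apply/funext => x; rewrite !mxE.
  by apply: cont_scale; apply: cont_sub; [exact: cont_cst|exact: gc2].
- exact: f0.
- by rewrite dotZl dotZr -enorm_sqr -/n; field; rewrite gt_eqF.
have t0 : 0 < Num.min s r by rewrite lt_min r0 (collar_radius c).
have := collar_shrink (s := Num.min s r) _ (collar_rotate QQ c).
rewrite t0 ge_min lexx => /(_ isT) c'.
exists (fun x => f (x *m Q)); do 5 eexists; split; first exact: c'.
by move=> x; rewrite lt_min => /andP[_ xr]; exact: O0.
Qed.

Section Distance.
Context (Omega : set V) (d : V -> R) (G : V -> V) (H : V -> 'M[R]_N) (r K : R) (nu : V).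
Context (c : collar d G H r K nu) (oO : open Omega).
Context (hO : forall x, enorm x < r -> (Omega x <-> 0 < d x)).

(** A zero of [d] is a limit of the points [z + s *: nu], which lie in the domain because [d] grows
    along [nu]. *)
Lemma collar_bdry z : enorm z < r -> (bdry Omega z <-> d z = 0).
Proof.
move=> zr; have intE := (interior_id Omega).1 oO.
have zn : \forall y \near z, enorm y < r by exact: (enorm_continuous (lt_nbhsl zr)).
split=> [[cl]|dz].
  rewrite intE => nO; apply/eqP; rewrite eq_le; apply/andP; split.
    by rewrite leNgt; apply/negP => /(hO zr).2.
  rewrite leNgt; apply/negP => dz.
  have hd : \forall y \near z, d y < 0 by apply: (collar_continuous c zr (lt_nbhsl dz)).
  have [y [Oy [yr dy]]] := cl _ (filterI zn hd).
  by have := (hO yr).1 Oy; rewrite ltNge (ltW dy).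
split; last by rewrite intE => /(hO zr).1; rewrite dz ltxx.
move=> A /nbhs_enormP[e e0 hA].
pose s := Num.min (e / 2) ((r - enorm z) / 2).
have s0 : 0 < s by rewrite lt_min !divr_gt0 // subr_gt0.
have se : s <= e / 2 by rewrite ge_min lexx.
have sr : s <= (r - enorm z) / 2 by rewrite ge_min lexx orbT.
have n1 : enorm nu = 1 by rewrite enormE (collar_normal c) sqrtr1.
have nt t : 0 <= t <= 1 -> enorm (z + t *: (s *: nu)) < r.
  move=> /andP[t0 t1]; apply: le_lt_trans (enormD _ _) _.
  rewrite !enormZ n1 mulr1 !ger0_norm ?(ltW s0) //.
  have : t * s <= s by rewrite ler_piMl // ltW.
  by move: zr => zr; lra.
exists (z + s *: nu); split; last by apply: hA; rewrite addrC addKr enormZ n1 mulr1 gtr0_norm //; lra.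
have zr' : enorm (z + s *: nu) < r by have := nt 1; rewrite scale1r; apply; rewrite ler01 lexx.
apply/(hO zr').
have [|t t01] := @J2_mean_value _ _ d G H (z + s *: nu) z.
  by move=> t t01; rewrite /= [_ - z]addrC addKr; apply: (collar_jet c); exact: nt.
rewrite dz subr0 [_ - z]addrC addKr => ->; rewrite dotZl dotC mulr_gt0 //.
by apply: lt_le_trans (collar_grad_normal c (nt t t01)); rewrite invr_gt0.
Qed.

(** For the first inequality, [|grad d| <= 1 + e] on the segment to a nearby boundary point, and
    [(1 - e) (1 + e) <= 1]. For the second, [d] decreases along [- nu] at rate at least [1 - e], so
    a zero of [d] is met within distance [d x / (1 - e)]. *)
Lemma dist_bdry_collar : bdry Omega 0 -> forall e : R, 0 < e <= 2^-1 ->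
  exists2 s, 0 < s <= r & forall x, 0 < enorm x < s -> 0 < d x ->
    (1 - e) * d x <= dist_bdry Omega x /\ (1 - e) * dist_bdry Omega x <= d x.
Proof.
move=> b0 e /andP[e0 e2]; have [t /andP[t0 tr] ht] := collar_grad_near c e0.
have n1 : enorm nu = 1 by rewrite enormE (collar_normal c) sqrtr1.
(* The gradient is used only at points of norm at most [5 |x|]: on segments to boundary points with
   [|y| < 3 |x|], and at shifts of [x] by at most [s1 <= 4 |x|]. *)
exists (t / 5).
  by rewrite divr_gt0 //=; lra.
move=> x /andP[x0 xt] dx.
have xr : enorm x < r by lra.
have d2 := collar_le c xr.
pose S := [set enorm (x - y) | y in bdry Omega].
have lbS : lbound S ((1 - e) * d x).
  (* Boundary points with [|y| >= 3 |x|] are at distance at least [2 |x| >= d x]. *)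
  move=> _ [y by0 <-]; have [y3|y3] := lerP (3 * enorm x) (enorm y).
    have := enorm_le_sub y x; rewrite enormC => h.
    have : (1 - e) * d x <= 1 * d x by apply: ler_wpM2r; [exact: ltW|lra].
    lra.
  have yr : enorm y < r by lra.
  have dy := (collar_bdry yr).1 by0.
  have nz (q : R) : 0 <= q <= 1 -> enorm (y + q *: (x - y)) < t.
    move=> /andP[q0 q1].
    have -> : y + q *: (x - y) = (1 - q) *: y + q *: x.
      by apply/matrixP => i j; rewrite !mxE; ring.
    apply: le_lt_trans (enormD _ _) _; rewrite !enormZ !ger0_norm ?subr_ge0 //.
    have a1 : (1 - q) * enorm y <= 1 * (3 * enorm x).
      by apply: ler_pM; rewrite ?subr_ge0 ?gerBl // ltW.
    have a2 : q * enorm x <= enorm x by rewrite ler_piMl // ltW.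
    lra.
  have [|q q01] := @J2_mean_value _ _ d G H x y.
    by move=> q q01; apply: (collar_jet c); apply: lt_le_trans (nz q q01) tr.
  rewrite dy subr0 => ->; set g := G _.
  have g1 : enorm g <= 1 + e.
    by apply: le_trans (enorm_le_sub g nu) _; rewrite n1 lerD2l; exact: ht (nz q q01).
  have h1 : dot (x - y) g <= enorm (x - y) * (1 + e).
    by apply: le_trans (dot_le _ _) _; apply: ler_wpM2l.
  have h2 : (1 - e) * dot (x - y) g <= (1 - e) * (enorm (x - y) * (1 + e)).
    by apply: ler_wpM2l => //; lra.
  apply: le_trans h2 _.
  have -> : (1 - e) * (enorm (x - y) * (1 + e)) = enorm (x - y) - e ^+ 2 * enorm (x - y) by ring.
  by rewrite gerBl mulr_ge0 ?sqr_ge0.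
have S0 : S !=set0 by exists (enorm (x - 0)); exists 0.
split; first exact: lb_le_inf.
have e1 : 0 < 1 - e by lra.
pose s1 := d x / (1 - e).
have s10 : 0 < s1 by rewrite divr_gt0.
have s14 : s1 <= 4 * enorm x.
  rewrite ler_pdivrMr //.
  have : 2^-1 * (4 * enorm x) <= (1 - e) * (4 * enorm x) by apply: ler_wpM2r; lra.
  lra.
have ns s : 0 <= s <= s1 -> enorm (x + s *: (- nu)) < t.
  move=> /andP[s0 ss]; apply: le_lt_trans (enormD _ _) _.
  by rewrite enormZ enormN n1 mulr1 ger0_norm //; lra.
have nr s : 0 <= s <= s1 -> enorm (x + s *: (- nu)) < r.
  by move=> hs; apply: lt_le_trans (ns s hs) tr.
have [s ss ds] : exists2 s, 0 <= s <= s1 & d (x + s *: (- nu)) = 0.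
  have cphi : {within `[0, s1], continuous (fun s : R => d (x + s *: (- nu)))}.
    apply: continuous_in_subspaceT => s; rewrite inE /= in_itv /= => hs.
    apply: (@continuous_comp _ _ _ (fun s : R => x + s *: (- nu)) d).
      exact: line_continuous.
    exact: (collar_continuous c (nr s hs)).
  have d1 : d (x + s1 *: (- nu)) <= 0.
    have ev : x + s1 *: (- nu) - x = s1 *: (- nu) by rewrite addrC addKr.
    have nq (q : R) : 0 <= q <= 1 -> enorm (x + q *: (s1 *: (- nu))) < t.
      move=> /andP[q0 q1]; rewrite scalerA; apply: ns.
      by rewrite mulr_ge0 ?(ltW s10) //= ler_piMl // ltW.
    have [|q q01] := @J2_mean_value _ _ d G H (x + s1 *: (- nu)) x.
      by move=> q q01; rewrite /= ev; apply: (collar_jet c); apply: lt_le_trans (nq q q01) tr.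
    rewrite ev; set g := G _; rewrite dotZl dotNl dotC.
    have h1 : 1 - e <= dot g nu.
      have := dot_le (nu - g) nu; rewrite n1 mulr1 dotDl dotNl (collar_normal c) enormC.
      by have := ht _ (nq q q01); rewrite -/g; lra.
    have h2 : s1 * (1 - e) <= s1 * dot g nu by apply: ler_wpM2l => //; exact: ltW.
    have h3 : s1 * (1 - e) = d x by rewrite /s1 mulfVK // gt_eqF.
    lra.
  have [|s] := @IVT _ (fun s : R => d (x + s *: (- nu))) 0 s1 0 (ltW s10) cphi.
    by rewrite scale0r addr0 ge_min d1 orbT le_max (ltW dx).
  by rewrite in_itv /= => hs hds; exists s.
rewrite mulrC -ler_pdivlMr // -/s1; apply: le_trans (_ : s <= s1); last by case/andP: ss.
have /andP[s0 _] := ss.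
have <- : enorm (x - (x + s *: (- nu))) = s.
  by rewrite opprD addrA subrr add0r enormN enormZ enormN n1 mulr1 ger0_norm.
have yb : bdry Omega (x + s *: (- nu)) by apply/collar_bdry; [exact: nr|exact: ds].
by apply: ge_inf; [exists ((1 - e) * d x)|exists (x + s *: (- nu))].
Qed.

End Distance.
End DomainCollar.

(** * The limit for harmonic functions on the domain *)

Section BoundaryQuotient.
Context {R : realType} {N : nat}.
Notation V := 'rV[R]_N.
Implicit Types (x y : V) (Omega : set V).

Lemma quotient_estimate (w k e D P : R) : 0 < D -> 0 < e <= 2^-1 -> 0 <= k ->
  (1 - e) * D <= P -> (1 - e) * P <= D -> `|w - k * D| <= e * D ->
  `|k - w / P| <= 2 * (1 + k) * e.
Proof.
move=> D0 /andP[e0 e2] k0 h1 h2 /ler_normlP[h3 h4].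
have P2 : 2^-1 * D <= P.
  have : 2^-1 * D <= (1 - e) * D by apply: ler_wpM2r; [exact: ltW|lra].
  lra.
have P0 : 0 < P by lra.
have e1 : e * D <= e * (2 * P) by apply: ler_wpM2l; [exact: ltW|lra].
have e3 : D - P <= e * (2 * P) by lra.
have e4 : P - D <= e * (2 * P).
  have : 0 <= e * P by rewrite mulr_ge0 // ltW.
  lra.
have e5 : k * (D - P) <= k * (e * (2 * P)) by apply: ler_wpM2l.
have e6 : k * (P - D) <= k * (e * (2 * P)) by apply: ler_wpM2l.
have -> : k - w / P = (k * P - w) / P by field; rewrite gt_eqF.
rewrite normrM normfV (ger0_norm (ltW P0)) ler_pdivrMr // ler_norml.
have -> : 2 * (1 + k) * e * P = e * (2 * P) + k * (e * (2 * P)) by ring.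
by apply/andP; split; lra.
Qed.

(** Both cases of the theorem at once: on the domain [main_profile] is [|x|^(alpha_- - 1)] or, in
    the critical case, [- |x|^(- N / 2) ln |x|]. *)
Lemma harmonic_quotient Omega (mu r0 : R) (u : V -> R) :
  (2 <= N)%N -> open Omega -> C2_boundary Omega -> bdry Omega 0 ->
  mu1 N <= mu -> L_harmonic mu Omega u -> (forall x, Omega x -> 0 <= u x) -> 0 < r0 ->
  (forall z, bdry Omega z -> z != 0 -> enorm z < r0 -> u @ within Omega (nbhs z) --> 0) ->
  exists2 k : R, 0 <= k &
    u x / (dist_bdry Omega x * main_profile (N := N) mu (lognorm x)) @[x --> within Omega (nbhs (0 : V))]
      --> k.
Proof.
move=> N2 oO CO b0 hmu [uC uL] u0 r00 ub.
have [d [G [H [r1 [K [nu [c1 hO1]]]]]]] := domain_collar oO CO b0.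
pose r := Num.min r1 r0.
have r_r1 : r <= r1 by rewrite ge_min lexx.
have r_r0 : r <= r0 by rewrite ge_min lexx orbT.
have r_gt0 : 0 < r by rewrite lt_min r00 (collar_radius c1).
have c : collar d G H r K nu by apply: collar_shrink c1; rewrite r_gt0.
have hO x : enorm x < r -> (Omega x <-> 0 < d x).
  by move=> xr; apply: hO1; exact: lt_le_trans r_r1.
have [Z [gz [lh [lZ [a [b [rs [rsr bar]]]]]]]] := barriers_exist c hmu.
have uharm x : 0 < enorm x < r -> 0 < d x -> lap u x (mu / dot x x * u x).
  move=> /andP[_ xr] dx; have Ox := (hO x xr).2 dx.
  exists (grad u x, hess u x); split; first exact: C2_J2 uC Ox.
  by rewrite /= tr_hess; have := uL x Ox; rewrite /L_op enorm_sqr; lra.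
have ucont x : 0 < enorm x < r -> 0 < d x -> {for x, continuous u}.
  by move=> /andP[_ xr] dx; have [cu _ _ _ _] := uC; apply: cu; apply/hO.
have upos x : 0 < enorm x < r -> 0 < d x -> 0 <= u x.
  by move=> /andP[_ xr] dx; apply: u0; apply/hO.
have uvan y : 0 < enorm y < r -> d y = 0 -> forall e, 0 < e ->
    \forall x \near y, 0 < d x -> u x <= e.
  move=> /andP[y0 yr] dy e e0.
  have yb : bdry Omega y by apply/(collar_bdry c oO hO yr).
  have := ub y yb _ (lt_le_trans yr r_r0); rewrite -enorm_gt0 => /(_ y0) /cvgrPdist_le.
  move=> /(_ e e0) hn.
  have {}hn : \forall x \near y, Omega x -> `|0 - u x| <= e by exact: hn.
  have hr : \forall x \near y, enorm x < r by exact: (enorm_continuous (lt_nbhsl yr)).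
  near=> x => dx.
  have xr : enorm x < r by near: x.
  have Ox : Omega x by apply/hO.
  apply: le_trans (ler_norm _) _; rewrite -normrN -sub0r.
  by move: Ox; near: x.
have [k k0 hk] := quotient_limit N2 c bar rsr uharm ucont upos uvan.
exists k => //; apply/cvgrPdist_le => e e0.
pose q := Num.min 2^-1 (e / (2 * (1 + k))).
have k2 : 0 < 2 * (1 + k) by lra.
have q0 : 0 < q by rewrite lt_min invr_gt0 /= ltr0n divr_gt0.
have q2 : 0 < q <= 2^-1 by rewrite q0 ge_min lexx.
have qe : 2 * (1 + k) * q <= e.
  by rewrite mulrC -ler_pdivlMr // ge_min lexx orbT.
have [s1 /andP[s10 s1r] h1] := dist_bdry_collar c oO hO b0 q2.
have [s2 /andP[s20 s2r] h2] := hk q q0.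
have hn : \forall x \near (0 : V), enorm x < Num.min s1 s2.
  have h0 : enorm (0 : V) < Num.min s1 s2 by rewrite enorm0 lt_min s10.
  exact: (enorm_continuous (lt_nbhsl h0)).
have nO0 : ~ Omega 0 by case: b0 => _; rewrite ((interior_id Omega).1 oO).
rewrite near_withinE; apply: filterS hn => x; rewrite lt_min => /andP[x1 x2] Ox.
have x0 : 0 < enorm x by rewrite enorm_gt0; apply/eqP => x0; apply: nO0; rewrite -x0.
have dx : 0 < d x by apply/(hO x (lt_le_trans x1 s1r)).
have [d1 d2] := h1 x (introT andP (conj x0 x1)) dx.
have h3 := h2 x (introT andP (conj x0 x2)) dx.
have xs : 0 < enorm x < rs by rewrite x0 (lt_le_trans x2 s2r).
have g0 := @main_profile_gt0 R N mu _ (barriers_lognorm bar xs dx).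
move: (main_profile (N := N) mu (lognorm x)) g0 h3 => g g0 h3.
apply: le_trans qe; apply: (@quotient_estimate _ _ _ (d x * g)) => //.
- by rewrite mulr_gt0.
- by rewrite mulrA; apply: ler_wpM2r; [exact: ltW|].
- by rewrite mulrA; apply: ler_wpM2r; [exact: ltW|].
Unshelve. all: by end_near. Qed.

End BoundaryQuotient.

Theorem theoremA (R : realType) (N : nat) (Omega : set 'rV[R]_N) (mu : R)
  (u : 'rV[R]_N -> R) (r0 : R) :
  (2 <= N)%N ->
  bounded_domain Omega -> C2_boundary Omega -> bdry Omega 0 ->
  mu1 N <= mu ->
  L_harmonic mu Omega u ->
  (forall x, Omega x -> 0 <= u x) ->
  0 < r0 ->
  (forall z, bdry Omega z -> z != 0 -> enorm z < r0 ->
     u @ within Omega (nbhs z) --> 0) ->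
  exists k : R, 0 <= k /\
    (mu1 N < mu ->
       (fun x => u x / (dist_bdry Omega x * enorm x `^ (alpha_minus N mu - 1)))
         @ within Omega (nbhs (0 : 'rV[R]_N)) --> k) /\
    (mu = mu1 N ->
       (fun x => enorm x `^ (N%:R / 2) * u x / (dist_bdry Omega x * ln (enorm x)))
         @ within Omega (nbhs (0 : 'rV[R]_N)) --> - k).
Proof.
move=> N2 [oO _ _ _] CO b0 hmu uL u0 r00 ub.
have [k k0 hk] := harmonic_quotient N2 oO CO b0 hmu uL u0 r00 ub.
(* The origin is a boundary point of an open set, hence outside [Omega]; this excludes the special
   value of the power at base 0. *)
have nO0 : ~ Omega 0 by case: b0 => _; rewrite ((interior_id Omega).1 oO).
have pE (x : 'rV[R]_N) p : Omega x -> enorm x `^ p = expR (p * lognorm x).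
  move=> Ox; have x0 : x != 0 by apply/eqP => x0; apply: nO0; rewrite -x0.
  by rewrite /powR enorm_eq0 (negbTE x0) lognormE.
exists k; split=> //; split=> [mu1lt|muE].
- apply: cvg_trans hk; apply: near_eq_cvg; rewrite near_withinE; apply: filterE => x Ox.
  have -> : alpha_minus N mu - 1 = critical_exponent (N := N) mu.
    by rewrite /alpha_minus /critical_exponent; move: (Num.sqrt _) => s; field.
  have mne : (mu == mu1 N) = false by apply/eqP => e; move: mu1lt; rewrite e ltxx.
  by rewrite pE // /main_profile mne mul1r.
- apply: cvg_trans (cvgN hk); apply: near_eq_cvg; rewrite near_withinE; apply: filterE => x Ox.
  have x0 : x != 0 by apply/eqP => x0; apply: nO0; rewrite -x0.
  rewrite -[LHS]/(- (u x / (dist_bdry Omega x * main_profile mu (lognorm x)))).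
  (* At [mu = mu1] the square root vanishes and the exponent is [- N / 2]; the minus sign of the
     logarithmic factor turns the limit [k] into [- k]. *)
  have -> : main_profile (N := N) mu (lognorm x) = - lognorm x * (enorm x `^ (N%:R / 2))^-1.
    rewrite (pE x _ Ox) -expRN /main_profile muE eqxx; congr (_ * expR _).
    have e : mu1 N + N%:R ^+ 2 / 4 = 0 :> R by rewrite /mu1; field.
    by rewrite /critical_exponent e sqrtr0 subr0 mulNr.
  rewrite -(lognormE x0); move: (enorm x `^ _) (dist_bdry _ _) (lognorm x) => E D l.
  by rewrite !invfM invrN invrK; ring.
Qed.
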